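(* (1) The set $\{\mathbb{C}_{\lambda,\mu},\ V(k)\;|\;(\lambda,\mu)\in\mathfrak{T},\ 0\leq k\leq n-1,\ d\nmid k\}$ forms a complete list of finite dimensional indecomposable representations of $R(H_{n,d})$, with cardinal number $nd$. Moreover, $\mathbb{C}_{\lambda,\mu}$ is projective if and only if $\mu\neq 1+\lambda^m$, and $V(k)$ is projective for each $k$. (2) There are $nd-2(n-m)$ blocks of $R(H_{n,d})$ of dimension $1$ and $n-m$ blocks of dimension $2$.
   Context: Let $K$ be an algebraically closed field of characteristic $0$, let $n,d\geq 2$ be integers with $d\mid n$, put $m=n/d$, and let $q\in K$ be a primitive $d$-th root of unity. The generalized Taft algebra $H_{n,d}=H_{n,d}(q)$ is the $K$-algebra generated by $g,h$ subject to $g^n=1$, $h^d=0$, $hg=qgh$; it is a Hopf algebra of dimension $nd$ with $\Delta(g)=g\otimes g$, $\Delta(h)=1\otimes h+h\otimes g$, $\varepsilon(g)=1$, $\varepsilon(h)=0$, $S(g)=g^{-1}$, $S(h)=-q^{-1}g^{n-1}h$. Modules are finite dimensional left modules; tensor products of $H_{n,d}$-modules are over $K$ with action through $\Delta$. Fix a primitive $n$-th root of unity $\omega\in K$ with $\omega^m=q$. For $1\leq l\leq d$ and $i\in\mathbb{Z}_n=\mathbb{Z}/(n)$, $M(l,i)$ is the $H_{n,d}$-module with basis $v_0,\dots,v_{l-1}$ and action $g\cdot v_j=\omega^i q^{-j}v_j$ for $0\leq j\leq l-1$, $h\cdot v_j=v_{j+1}$ for $0\le j\leq l-2$, $h\cdot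 v_{l-1}=0$. These form a complete list of pairwise non-isomorphic indecomposable $H_{n,d}$-modules. The Green ring $r(H)$ of a Hopf algebra $H$ is the abelian group generated by isomorphism classes $[V]$ of finite dimensional $H$-modules modulo $[V\oplus W]=[V]+[W]$, with multiplication $[V][W]=[V\otimes W]$. The Green algebra is $R(H)=\mathbb{C}\otimes_{\mathbb{Z}}r(H)$. The algebra $R(H_{n,d})$ is identified with $\mathbb{C}[y,z]/(y^n-1,\ (z-y^m-1)F_d(y^m,z))$ via $y=[M(1,-1)]$, $z=[M(2,0)]$, where $F_0(y,z)=0$, $F_1(y,z)=1$, $F_{s+2}(y,z)=zF_{s+1}(y,z)-yF_s(y,z)$. For $0\leq k\leq n-1$ put $\omega_k=\cos\frac{2k\pi}{n}+i\sin\frac{2k\pi}{n}\in\mathbb{C}$ and, for $1\leq j\leq d-1$, $\sigma_{k,j}=2\sqrt{\omega_k^m}\cos\frac{\pi j}{d}$ (for a fixed choice of square root). Let $$\mathfrak{T}=\{(\omega_k,2)\;|\;0\leq k\leq n-1,\ d\mid k\}\cup\{(\omega_k,\sigma_{k,j})\;|\;0\leq k\leq n-1,\ 1\leq j\leq d-1\}\subset\mathbb{C}^2.$$ For $(\lambda,\mu)\in\mathfrak{T}$, $\mathbb{C}_{\lambda,\mu}$ is the $1$-dimensional $R(H_{n,d})$-module $\mathbb{C}$ with $y\cdot 1=\lambda$, $z\cdot 1=\mu$. For $0\leq k\leq n-1$ with $d\nmid k$, $V(k)$ is the $R(H_{n,d})$-module with $\mathbb{C}$-basis $\{v_1,v_2\}$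 and action $y\cdot v_i=\omega_k v_i$ ($i=1,2$), $z\cdot v_1=(1+\omega_k^m)v_1$, $z\cdot v_2=v_1+(1+\omega_k^m)v_2$. The blocks of $R(H_{n,d})$ are its indecomposable direct factors as an algebra; their dimensions are over $\mathbb{C}$.
   Formalization: The printed criterion fails at the points (ω_k,2) with d|k, where μ=1+λ^m but C_{λ,μ} is projective (2 is a simple root of (z-2)F_d(1,z)); proved instead: C_{λ,μ} is projective iff μ≠1+λ^m or λ^m=1. *)

(* Defs.v *)
From HB Require Import structures.
From mathcomp Require Import all_boot all_order all_algebra.
From mathcomp Require Import mxtens complex ring.
From mathcomp Require Import boolp classical_sets functions cardinality.
From mathcomp Require Import reals trigo.
From mathcomp Require Import freeg.

Set Implicit Arguments.
Unset Strict Implicit.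
Unset Printing Implicit Defensive.

Import Order.TTheory GRing.Theory Num.Theory.
Local Open Scope ring_scope.

(* q-binomial theorem: the action through the comultiplication respects h^d = 0. *)
Section QBinomial.
Variable K : fieldType.
Variable q : K.

Fixpoint qbin (k i : nat) : K :=
  match k, i with
  | _, 0%N => 1
  | 0%N, _.+1 => 0
  | k'.+1, i'.+1 => qbin k' i' + q ^+ i * qbin k' i
  end.

Lemma qbin0 k : qbin k 0 = 1. Proof. by case: k. Qed.

Lemma qbin_small k i : (k < i)%N -> qbin k i = 0.
Proof.
elim: k i => [|k IHk] [|i] //= lt_ki.
rewrite (IHk i) // (IHk i.+1) ?mulr0 ?addr0 //; exact: ltnW.
Qed.

Lemma qbinn k : qbin k k = 1.
Proof. by elim: k => //= k ->; rewrite qbin_small // mulr0 addr0. Qed.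

Definition qfact (k : nat) : K := \prod_(j < k) (1 - q ^+ j.+1).

Lemma qfactS k : qfact k.+1 = qfact k * (1 - q ^+ k.+1).
Proof. by rewrite /qfact big_ord_recr. Qed.

Lemma qbin_qfact k i p :
  (i + p)%N = k -> qbin k i * (qfact i * qfact p) = qfact k.
Proof.
have f0 : qfact 0 = 1 by rewrite /qfact big_ord0.
elim: k i p => [|k IHk] [|i] [|p] //.
- by rewrite /= f0 !mulr1.
- by move=> [<-]; rewrite qbin0 f0 !mul1r.
- by rewrite addn0 => ->; rewrite qbinn f0 mul1r mulr1.
rewrite addSn addnS => -[e].
have := IHk i.+1 p (etrans (addSnnS i p) (etrans (addnS i p) e)).
have := IHk i p.+1 (etrans (addnS i p) e).
have -> : qfact k.+1 = qfact k * (1 - q ^+ i.+1 * q ^+ p.+1).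
  by rewrite qfactS -exprD addSn addnS e.
rewrite /= !qfactS.
move: (qbin k i) (qbin k i.+1) (qfact i) (qfact p) (qfact k) (q ^+ i.+1)
  (q ^+ p.+1) => a b c f g x y h1 h2.
transitivity ((a * (c * (f * (1 - y)))) * (1 - x) + x * (1 - y) * (b * (c * (1 - x) * f))).
  by ring.
by rewrite h1 h2; ring.
Qed.

Lemma qbin_prim_root d i :
  d.-primitive_root q -> (0 < i < d)%N -> qbin d i = 0.
Proof.
move=> hq /andP[i_gt0 lt_id].
have d_gt0 := prim_order_gt0 hq.
have qf0 k : (k < d)%N -> qfact k != 0.
  move=> lt_kd; apply/prodf_neq0 => j _; rewrite subr_eq0 eq_sym.
  rewrite -(prim_order_dvd hq); apply: contraL (leq_trans (ltn_ord j) (ltnW lt_kd)).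
  move=> /dvdn_leq; rewrite -ltnNge; case: (leqP d j.+1) => //.
    by move=> le_dj _; move: (leq_trans le_dj (ltn_ord j)); rewrite leqNgt lt_kd.
  by move=> _ /(_ isT).
have /eqP := qbin_qfact (subnKC (ltnW lt_id)).
have -> : qfact d = 0.
  by rewrite -(prednK d_gt0) qfactS (prednK d_gt0) (prim_expr_order hq) subrr mulr0.
rewrite !mulf_eq0 (negbTE (qf0 i lt_id)) (negbTE (qf0 (d - i)%N _)) ?orbF.
  by move/eqP.
by rewrite ltn_subrL i_gt0.
Qed.

Lemma qbin_expansion N (a b : 'M[K]_N) k : a *m b = q *: (b *m a) ->
  (a + b) ^+ k = \sum_(i < k.+1) qbin k i *: (b ^+ i *m a ^+ (k - i)).
Proof.
move=> ab.
have abX i : a *m b ^+ i = q ^+ i *: (b ^+ i *m a).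
  elim: i => [|i IHi]; first by rewrite !expr0 scale1r mul1mx mulmx1.
  rewrite !exprS -!mulmxE mulmxA ab -scalemxAl -mulmxA IHi -scalemxAr scalerA.
  by rewrite mulmxA.
elim: k => [|k IHk].
  by rewrite big_ord_recl big_ord0 /= !expr0 scale1r mul1mx addr0.
rewrite exprS IHk -mulmxE mulmxDl !mulmx_sumr.
rewrite [RHS]big_ord_recl /=.
under [in RHS]eq_bigr => i _ do rewrite /bump /= add1n subSS scalerDl.
rewrite big_split /= addrCA [LHS]addrC; congr (_ + _).
  apply: eq_bigr => i _.
  by rewrite -scalemxAr mulmxA mulmxE -exprS.
transitivity (\sum_(j < k.+2) (q ^+ j * qbin k j) *: (b ^+ j *m a ^+ (k.+1 - j))).
  rewrite [RHS]big_ord_recr /= qbin_small // mulr0 scale0r addr0.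
  apply: eq_bigr => i _; rewrite -scalemxAr mulmxA abX -scalemxAl scalerA mulrC.
  by rewrite -mulmxA mulmxE -exprS subSn // -ltnS.
by rewrite big_ord_recl /= expr0 mul1r qbin0.
Qed.

Lemma qcomm_nilp N (a b : 'M[K]_N) d : d.-primitive_root q ->
  a *m b = q *: (b *m a) -> a ^+ d = 0 -> b ^+ d = 0 -> (a + b) ^+ d = 0.
Proof.
move=> hq ab a0 b0; rewrite (qbin_expansion d ab) big1 // => -[i /= lt_id] _.
have [->|i0] := posnP i; first by rewrite subn0 a0 mulmx0 scaler0.
have [->|ne_id] := eqVneq i d; first by rewrite b0 mul0mx scaler0.
by rewrite qbin_prim_root ?scale0r // i0 ltn_neqAle ne_id -ltnS.
Qed.

End QBinomial.

(* A finite dimensional left module over the algebra presented by g, h and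
   g^n = 1, h^d = 0, hg = qgh, in coordinates: the vector space is K^tdim
   (column vectors) and g, h act by left multiplication by matrices. *)
Definition taft_rel (K : fieldType) (n d : nat) (q : K) (N : nat)
    (G H : 'M[K]_N) : bool :=
  [&& G ^+ n == 1, H ^+ d == 0 & H *m G == q *: (G *m H)].

Record taft_mod (K : fieldType) (n d : nat) (q : K) := TaftMod {
  tdim : nat;
  tg : 'M[K]_tdim;
  th : 'M[K]_tdim;
  tmodP : taft_rel n d q tg th }.

Section TaftModChoice.
Variables (K : fieldType) (n d : nat) (q : K).

Let code := {x : {N : nat & ('M[K]_N * 'M[K]_N)%type} |
  taft_rel n d q (tagged x).1 (tagged x).2}.

Definition taft_mod_code (V : taft_mod n d q) : code :=
  exist _ (Tagged (fun N => ('M[K]_N * 'M[K]_N)%type) (tg V, th V)) (tmodP V).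

Definition taft_mod_decode (x : code) : taft_mod n d q := TaftMod (valP x).

Lemma taft_mod_codeK : cancel taft_mod_code taft_mod_decode.
Proof. by case=> N G H r; congr TaftMod; exact: eq_irrelevance. Qed.

HB.instance Definition _ := Choice.copy (taft_mod n d q) (can_type taft_mod_codeK).

End TaftModChoice.

Section TaftModOps.
Variables (K : fieldType) (n d : nat) (q : K).
Local Notation tmod := (taft_mod n d q).

Definition taft_iso (V W : tmod) : Prop :=
  exists (P : 'M[K]_(tdim W, tdim V)) (P' : 'M[K]_(tdim V, tdim W)),
    [/\ P *m P' = 1%:M, P' *m P = 1%:M,
        P *m tg V = tg W *m P & P *m th V = th W *m P].

Lemma block_diagX N M (A : 'M[K]_N) (B : 'M[K]_M) k :
  block_mx A 0 0 B ^+ k = block_mx (A ^+ k) 0 0 (B ^+ k).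
Proof.
elim: k => [|k IHk]; first by rewrite !expr0; rewrite -scalar_mx_block.
rewrite !exprS IHk -!mulmxE mulmx_block.
by rewrite !(mul0mx, mulmx0, addr0, add0r).
Qed.

Lemma taft_sum_rel (V W : tmod) :
  taft_rel n d q (block_mx (tg V) 0 0 (tg W)) (block_mx (th V) 0 0 (th W)).
Proof.
have /and3P[/eqP g1 /eqP h0 /eqP hg] := tmodP V.
have /and3P[/eqP g1' /eqP h0' /eqP hg'] := tmodP W.
apply/and3P; split; apply/eqP.
- by rewrite block_diagX g1 g1'; rewrite -scalar_mx_block.
- by rewrite block_diagX h0 h0' block_mx0.
- by rewrite !mulmx_block !(mul0mx, mulmx0, addr0, add0r) hg hg' scale_block_mx !scaler0.
Qed.

Definition taft_sum (V W : tmod) : tmod := TaftMod (taft_sum_rel V W).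

Lemma taft_triv_rel : (0 < d)%N -> taft_rel n d q (1 : 'M[K]_1) 0.
Proof.
by move=> d_gt0; rewrite /taft_rel expr1n expr0n gtn_eqF // mul0mx mulmx0 scaler0 !eqxx.
Qed.

Lemma tensmxX N M (A : 'M[K]_N) (B : 'M[K]_M) k :
  (A *t B) ^+ k = (A ^+ k) *t (B ^+ k).
Proof.
elim: k => [|k IHk].
  rewrite !expr0; apply/matrixP => i j.
  case: (mxtens_indexP i) => i0 i1; case: (mxtens_indexP j) => j0 j1.
  rewrite tensmxE !mxE (inj_eq (can_inj (@mxtens_indexK _ _))) xpair_eqE.
  by rewrite -natrM mulnb.
by rewrite !exprS IHk -!mulmxE tensmx_mul.
Qed.

Lemma tensmx11 N M : (1 : 'M[K]_N) *t (1 : 'M[K]_M) = 1.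
Proof. by have := tensmxX (1 : 'M[K]_N) (1 : 'M[K]_M) 0; rewrite !expr0 => <-. Qed.

Lemma taft_tens_rel (hq : d.-primitive_root q) (V W : tmod) :
  taft_rel n d q (tg V *t tg W) (1 *t th W + th V *t tg W).
Proof.
have /and3P[/eqP g1 /eqP h0 /eqP hg] := tmodP V.
have /and3P[/eqP g1' /eqP h0' /eqP hg'] := tmodP W.
have d_gt0 := prim_order_gt0 hq.
apply/and3P; split; apply/eqP.
- by rewrite tensmxX g1 g1' tensmx11.
- apply: (qcomm_nilp hq).
  + by rewrite !tensmx_mul mul1mx mulmx1 hg'; apply/matrixP => i j; rewrite !mxE mulrCA.
  + by rewrite tensmxX h0' tensmx0.
  + by rewrite tensmxX h0 tens0mx.
rewrite mulmxDl mulmxDr !tensmx_mul mul1mx mulmx1 hg hg' scalerDr; congr (_ + _).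
  by apply/matrixP => i j; rewrite !mxE mulrCA.
by apply/matrixP => i j; rewrite !mxE mulrA.
Qed.

Lemma taft_iso_bij (V W : tmod) (f : 'I_(tdim V) -> 'I_(tdim W))
    (f' : 'I_(tdim W) -> 'I_(tdim V)) :
  cancel f f' -> cancel f' f ->
  (forall i j, tg V i j = tg W (f i) (f j)) ->
  (forall i j, th V i j = th W (f i) (f j)) -> taft_iso V W.
Proof.
move=> fK f'K eqg eqh.
have eqf a b : (a == f b) = (f' a == b).
  by apply/eqP/eqP => [->|<-]; rewrite ?fK ?f'K.
pose P := \matrix_(a, b) (a == f b)%:R : 'M[K]_(tdim W, tdim V).
have mulP (X : 'M[K]_(tdim V)) (Y : 'M[K]_(tdim W)) :
    (forall i j, X i j = Y (f i) (f j)) -> P *m X = Y *m P.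
  move=> eqX; apply/matrixP => a b; rewrite !mxE.
  rewrite (bigD1 (f' a)) //= big1 => [|i ne_i]; last first.
    by rewrite mxE eqf eq_sym (negbTE ne_i) mul0r.
  rewrite (bigD1 (f b)) //= [in RHS]big1 => [|i ne_i]; last first.
    by rewrite mxE (negbTE ne_i) mulr0.
  by rewrite !mxE eqf !eqxx mul1r mulr1 eqX f'K.
exists P, P^T; split; try exact: mulP.
  apply/matrixP => a b; rewrite !mxE (bigD1 (f' a)) //= big1 => [|i ne_i].
    by rewrite !mxE !eqf eqxx mul1r addr0 eq_sym (inj_eq (can_inj f'K)).
  by rewrite mxE eqf eq_sym (negbTE ne_i) mul0r.
apply/matrixP => a b; rewrite !mxE (bigD1 (f a)) //= big1 => [|i ne_i].
  by rewrite !mxE eqxx mul1r addr0 (inj_eq (can_inj fK)).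
by rewrite !mxE (negbTE ne_i) mul0r.
Qed.

End TaftModOps.

(* [taft_triv] is the counit; on a tensor product g acts by g (x) g and h by
   1 (x) h + h (x) g, with [*t] the Kronecker product of matrices. *)
Section TaftTensor.
Variables (K : fieldType) (n d : nat) (q : K) (hq : d.-primitive_root q).
Local Notation tmod := (taft_mod n d q).

Definition taft_triv : tmod := TaftMod (taft_triv_rel n q (prim_order_gt0 hq)).
Definition taft_tens (V W : tmod) : tmod := TaftMod (taft_tens_rel hq V W).

Lemma taft_tens_isol (V V' W : tmod) :
  taft_iso V V' -> taft_iso (taft_tens V W) (taft_tens V' W).
Proof.
case=> P [P' [PP' P'P Pg Ph]]; exists (P *t 1), (P' *t 1).
by split=> /=; rewrite ?(mulmxDl, mulmxDr) !tensmx_mul ?Pg ?Ph ?PP' ?P'P ?mul1mx ?mulmx1 ?tensmx11.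
Qed.

Lemma taft_tens_isor (V W W' : tmod) :
  taft_iso W W' -> taft_iso (taft_tens V W) (taft_tens V W').
Proof.
case=> P [P' [PP' P'P Pg Ph]]; exists (1 *t P), (1 *t P').
by split=> /=; rewrite ?(mulmxDl, mulmxDr) !tensmx_mul ?Pg ?Ph ?PP' ?P'P ?mul1mx ?mulmx1 ?tensmx11.
Qed.

Lemma taft_tens1V (V : tmod) : taft_iso (taft_tens taft_triv V) V.
Proof.
apply: (@taft_iso_bij _ _ _ _ (taft_tens taft_triv V) V
  (fun i => (mxtens_unindex i).2) (fun j => mxtens_index (ord0, j))).
- by move=> i; case: (mxtens_indexP i) => i0 i1; rewrite mxtens_indexK /= (ord1 i0).
- by move=> j; rewrite mxtens_indexK.
- move=> i j; case: (mxtens_indexP i) => i0 i1; case: (mxtens_indexP j) => j0 j1.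
  by rewrite !mxtens_indexK /= tensmxE !ord1 mxE mul1r.
- move=> i j; case: (mxtens_indexP i) => i0 i1; case: (mxtens_indexP j) => j0 j1.
  by rewrite !mxtens_indexK /= tens0mx addr0 tensmxE !ord1 mxE mul1r.
Qed.

Lemma taft_tensV1 (V : tmod) : taft_iso (taft_tens V taft_triv) V.
Proof.
apply: (@taft_iso_bij _ _ _ _ (taft_tens V taft_triv) V
  (fun i => (mxtens_unindex i).1) (fun j => mxtens_index (j, ord0))).
- by move=> i; case: (mxtens_indexP i) => i0 i1; rewrite mxtens_indexK /= (ord1 i1).
- by move=> j; rewrite mxtens_indexK.
- move=> i j; case: (mxtens_indexP i) => i0 i1; case: (mxtens_indexP j) => j0 j1.
  by rewrite !mxtens_indexK /= tensmxE !ord1 mxE mulr1.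
- move=> i j; case: (mxtens_indexP i) => i0 i1; case: (mxtens_indexP j) => j0 j1.
  by rewrite !mxtens_indexK /= tensmx0 add0r tensmxE !ord1 mxE mulr1.
Qed.

Lemma taft_tensA (U V W : tmod) :
  taft_iso (taft_tens U (taft_tens V W)) (taft_tens (taft_tens U V) W).
Proof.
pose f (i : 'I_(tdim (taft_tens U (taft_tens V W)))) :
    'I_(tdim (taft_tens (taft_tens U V) W)) :=
  let: (a, bc) := mxtens_unindex i in let: (b, c) := mxtens_unindex bc in
  mxtens_index (mxtens_index (a, b), c).
pose f' (i : 'I_(tdim (taft_tens (taft_tens U V) W))) :
    'I_(tdim (taft_tens U (taft_tens V W))) :=
  let: (ab, c) := mxtens_unindex i in let: (a, b) := mxtens_unindex ab in
  mxtens_index (a, mxtens_index (b, c)).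
have fE a b c : f (mxtens_index (a, mxtens_index (b, c))) =
    mxtens_index (mxtens_index (a, b), c) by rewrite /f !mxtens_indexK.
have f'E a b c : f' (mxtens_index (mxtens_index (a, b), c)) =
    mxtens_index (a, mxtens_index (b, c)) by rewrite /f' !mxtens_indexK.
apply: (@taft_iso_bij _ _ _ _ _ _ f f').
- move=> i; case: (mxtens_indexP i) => a bc; case: (mxtens_indexP bc) => b c.
  by rewrite fE f'E.
- move=> i; case: (mxtens_indexP i) => ab c; case: (mxtens_indexP ab) => a b.
  by rewrite f'E fE.
- move=> i j; case: (mxtens_indexP i) => a bc; case: (mxtens_indexP bc) => b c.
  case: (mxtens_indexP j) => a' bc'; case: (mxtens_indexP bc') => b' c'.
  by rewrite !fE /= !tensmxE mulrA.
- move=> i j; case: (mxtens_indexP i) => a bc; case: (mxtens_indexP bc) => b c.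
  case: (mxtens_indexP j) => a' bc'; case: (mxtens_indexP bc') => b' c'.
  rewrite !fE /= -tensmx11.
  by do 6!rewrite ?[in LHS]mxE ?[in RHS]mxE ?tensmxE ?mxtens_indexK /=; ring.
Qed.

End TaftTensor.

Section TaftTensor2.
Variables (K : fieldType) (n d : nat) (q : K) (hq : d.-primitive_root q).
Local Notation tmod := (taft_mod n d q).
Local Notation taft_tens := (taft_tens hq).

Lemma taft_tensDl (U V W : tmod) :
  taft_iso (taft_tens (taft_sum U V) W)
           (taft_sum (taft_tens U W) (taft_tens V W)).
Proof.
pose f (i : 'I_(tdim (taft_tens (taft_sum U V) W))) :
    'I_(tdim (taft_sum (taft_tens U W) (taft_tens V W))) :=
  let: (ab, c) := mxtens_unindex i in
  match fintype.split ab with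
  | inl a => lshift _ (mxtens_index (a, c))
  | inr b => rshift _ (mxtens_index (b, c))
  end.
pose f' (i : 'I_(tdim (taft_sum (taft_tens U W) (taft_tens V W)))) :
    'I_(tdim (taft_tens (taft_sum U V) W)) :=
  match fintype.split i with
  | inl ac => let: (a, c) := mxtens_unindex ac in mxtens_index (lshift _ a, c)
  | inr bc => let: (b, c) := mxtens_unindex bc in mxtens_index (rshift _ b, c)
  end.
have sl N M (i : 'I_N) : fintype.split (lshift M i) = inl i by exact: (unsplitK (inl i)).
have sr N M (i : 'I_M) : fintype.split (rshift N i) = inr i by exact: (unsplitK (inr i)).
have fl a c : f (mxtens_index (lshift _ a, c)) = lshift _ (mxtens_index (a, c)).
  by rewrite /f mxtens_indexK sl.
have fr b c : f (mxtens_index (rshift _ b, c)) = rshift _ (mxtens_index (b, c)).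
  by rewrite /f mxtens_indexK sr.
have f'l a c : f' (lshift _ (mxtens_index (a, c))) = mxtens_index (lshift _ a, c).
  by rewrite /f' sl mxtens_indexK.
have f'r b c : f' (rshift _ (mxtens_index (b, c))) = mxtens_index (rshift _ b, c).
  by rewrite /f' sr mxtens_indexK.
apply: (@taft_iso_bij _ _ _ _ _ _ f f').
- move=> i; case: (mxtens_indexP i) => ab c.
  by case: (split_ordP ab) => [a|b] ->; rewrite (fl, fr) (f'l, f'r).
- move=> i; case: (split_ordP i) => [ac|bc] ->.
    by case: (mxtens_indexP ac) => a c; rewrite f'l fl.
  by case: (mxtens_indexP bc) => b c; rewrite f'r fr.
- move=> i j; case: (mxtens_indexP i) => ab c; case: (mxtens_indexP j) => ab' c'.
  by case: (split_ordP ab) => [a|b] ->; case: (split_ordP ab') => [a'|b'] ->;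
    rewrite !(fl, fr) /= ?(block_mxEul, block_mxEur, block_mxEdl, block_mxEdr)
      !tensmxE ?(block_mxEul, block_mxEur, block_mxEdl, block_mxEdr) ?mxE ?mul0r.
- move=> i j; case: (mxtens_indexP i) => ab c; case: (mxtens_indexP j) => ab' c'.
  by case: (split_ordP ab) => [a|b] ->; case: (split_ordP ab') => [a'|b'] ->;
    rewrite !(fl, fr) /= ?(block_mxEul, block_mxEur, block_mxEdl, block_mxEdr)
      [LHS]mxE ?[RHS]mxE !tensmxE
      ?(block_mxEul, block_mxEur, block_mxEdl, block_mxEdr) ?mxE
      ?(inj_eq (@lshift_inj _ _)) ?(inj_eq (@rshift_inj _ _))
      ?eq_lrshift ?eq_rlshift ?mul0r ?addr0.
Qed.

Lemma taft_tensDr (U V W : tmod) :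
  taft_iso (taft_tens U (taft_sum V W))
           (taft_sum (taft_tens U V) (taft_tens U W)).
Proof.
pose f (i : 'I_(tdim (taft_tens U (taft_sum V W)))) :
    'I_(tdim (taft_sum (taft_tens U V) (taft_tens U W))) :=
  let: (c, ab) := mxtens_unindex i in
  match fintype.split ab with
  | inl a => lshift _ (mxtens_index (c, a))
  | inr b => rshift _ (mxtens_index (c, b))
  end.
pose f' (i : 'I_(tdim (taft_sum (taft_tens U V) (taft_tens U W)))) :
    'I_(tdim (taft_tens U (taft_sum V W))) :=
  match fintype.split i with
  | inl ac => let: (c, a) := mxtens_unindex ac in mxtens_index (c, lshift _ a)
  | inr bc => let: (c, b) := mxtens_unindex bc in mxtens_index (c, rshift _ b)
  end.
have sl N M (i : 'I_N) : fintype.split (lshift M i) = inl i by exact: (unsplitK (inl i)).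
have sr N M (i : 'I_M) : fintype.split (rshift N i) = inr i by exact: (unsplitK (inr i)).
have fl c a : f (mxtens_index (c, lshift _ a)) = lshift _ (mxtens_index (c, a)).
  by rewrite /f mxtens_indexK sl.
have fr c b : f (mxtens_index (c, rshift _ b)) = rshift _ (mxtens_index (c, b)).
  by rewrite /f mxtens_indexK sr.
have f'l c a : f' (lshift _ (mxtens_index (c, a))) = mxtens_index (c, lshift _ a).
  by rewrite /f' sl mxtens_indexK.
have f'r c b : f' (rshift _ (mxtens_index (c, b))) = mxtens_index (c, rshift _ b).
  by rewrite /f' sr mxtens_indexK.
apply: (@taft_iso_bij _ _ _ _ _ _ f f').
- move=> i; case: (mxtens_indexP i) => c ab.
  by case: (split_ordP ab) => [a|b] ->; rewrite (fl, fr) (f'l, f'r).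
- move=> i; case: (split_ordP i) => [ac|bc] ->.
    by case: (mxtens_indexP ac) => c a; rewrite f'l fl.
  by case: (mxtens_indexP bc) => c b; rewrite f'r fr.
- move=> i j; case: (mxtens_indexP i) => c ab; case: (mxtens_indexP j) => c' ab'.
  by case: (split_ordP ab) => [a|b] ->; case: (split_ordP ab') => [a'|b'] ->;
    rewrite !(fl, fr) /= ?(block_mxEul, block_mxEur, block_mxEdl, block_mxEdr)
      !tensmxE ?(block_mxEul, block_mxEur, block_mxEdl, block_mxEdr) ?mxE ?mulr0.
- move=> i j; case: (mxtens_indexP i) => c ab; case: (mxtens_indexP j) => c' ab'.
  by case: (split_ordP ab) => [a|b] ->; case: (split_ordP ab') => [a'|b'] ->;
    rewrite !(fl, fr) /= ?(block_mxEul, block_mxEur, block_mxEdl, block_mxEdr)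
      [LHS]mxE ?[RHS]mxE !tensmxE
      ?(block_mxEul, block_mxEur, block_mxEdl, block_mxEdr) ?mxE
      ?mulr0 ?addr0.
Qed.

End TaftTensor2.


Section FreeLinear.
Variables (R : comNzRingType) (X : choiceType).
Implicit Types D E : {freeg X / R}.

Lemma freeg_add_ind (P : {freeg X / R} -> Prop) :
  P 0 -> (forall D E, P D -> P E -> P (D + E)) ->
  (forall c x, P << c *g x >>) -> forall D, P D.
Proof. by move=> P0 PD PU D; rewrite -(freeg_sumE D); elim/big_ind: _. Qed.

Lemma freegZU c b x : c *: << b *g x >> = << c * b *g x >> :> {freeg X / R}.
Proof. by apply/eqP/freeg_eqP => y; rewrite coeffZ !coeffU mulrA. Qed.

Section Lift.
Variables (M : lmodType R) (f : X -> M).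

Lemma fglift_zmod : zmod_morphism (fglift f). Proof. exact: lift_is_additive. Qed.

Lemma fglift_scale : scalable (fglift f).
Proof.
pose g : {additive {freeg X / R} -> M} := HB.pack (fglift f)
  (GRing.isZmodMorphism.Build {freeg X / R} M (fglift f) fglift_zmod).
have g0 : fglift f 0 = 0 := raddf0 g.
have gD : {morph fglift f : D E / D + E} := raddfD g.
move=> c; elim/freeg_add_ind => [|D E hD hE|b x].
- by rewrite scaler0 g0 scaler0.
- by rewrite scalerDr !gD hD hE scalerDr.
- by rewrite freegZU !liftU scalerA.
Qed.

HB.instance Definition _ :=
  GRing.isZmodMorphism.Build {freeg X / R} M (fglift f) fglift_zmod.
HB.instance Definition _ :=
  GRing.isScalable.Build R {freeg X / R} M *:%R (fglift f) fglift_scale.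

Lemma fgliftU x : fglift f << x >> = f x.
Proof. by rewrite liftU scale1r. Qed.

End Lift.

Lemma freeg_lin_ind (P : {freeg X / R} -> Prop) :
  P 0 -> (forall D E, P D -> P E -> P (D + E)) ->
  (forall c D, P D -> P (c *: D)) -> (forall x, P << x >>) -> forall D, P D.
Proof.
move=> P0 PD PZ PU; apply: freeg_add_ind => // c x.
by rewrite -[c]mulr1 -freegZU; exact: PZ.
Qed.

Variable op : X -> X -> X.

Definition freeg_mul D E : {freeg X / R} :=
  fglift (fun x => fglift (fun y => << op x y >> : {freeg X / R}) E) D.

Lemma freeg_mulU x y : freeg_mul << x >> << y >> = << op x y >>.
Proof. by rewrite /freeg_mul !fgliftU. Qed.

Lemma freeg_mulDl D D' E : freeg_mul (D + D') E = freeg_mul D E + freeg_mul D' E.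
Proof. exact: linearD. Qed.

Lemma freeg_mulZl c D E : freeg_mul (c *: D) E = c *: freeg_mul D E.
Proof. exact: linearZ. Qed.

Lemma freeg_mul0l E : freeg_mul 0 E = 0.
Proof. exact: linear0. Qed.

Lemma freeg_mul0r D : freeg_mul D 0 = 0.
Proof.
elim/freeg_lin_ind: D => [|D E hD hE|c D hD|x].
- exact: freeg_mul0l.
- by rewrite freeg_mulDl hD hE addr0.
- by rewrite freeg_mulZl hD scaler0.
- by rewrite /freeg_mul fgliftU linear0.
Qed.

Lemma freeg_mulDr D E E' : freeg_mul D (E + E') = freeg_mul D E + freeg_mul D E'.
Proof.
elim/freeg_lin_ind: D => [|D D' hD hD'|c D hD|x].
- by rewrite !freeg_mul0l addr0.
- by rewrite !freeg_mulDl hD hD' addrACA.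
- by rewrite !freeg_mulZl hD scalerDr.
- by rewrite /freeg_mul !fgliftU linearD.
Qed.

Lemma freeg_mulZr c D E : freeg_mul D (c *: E) = c *: freeg_mul D E.
Proof.
elim/freeg_lin_ind: D => [|D D' hD hD'|b D hD|x].
- by rewrite !freeg_mul0l scaler0.
- by rewrite !freeg_mulDl hD hD' scalerDr.
- by rewrite !freeg_mulZl hD !scalerA mulrC.
- by rewrite /freeg_mul !fgliftU linearZ.
Qed.

Lemma freeg_mulNl D E : freeg_mul (- D) E = - freeg_mul D E.
Proof. by rewrite -scaleN1r freeg_mulZl scaleN1r. Qed.

Lemma freeg_mulNr D E : freeg_mul D (- E) = - freeg_mul D E.
Proof. by rewrite -scaleN1r freeg_mulZr scaleN1r. Qed.

End FreeLinear.

Section Green.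
Variables (R : comNzRingType) (K : fieldType) (n d : nat) (q : K).
Variable hq : d.-primitive_root q.
Local Notation tmod := (taft_mod n d q).
Local Notation free := {freeg tmod / R}.
Local Notation fmul := (freeg_mul (taft_tens hq)).

(* The Green ring with coefficients extended to R: the free R-module on the
   modules, modulo the R-submodule generated by [V] - [W] for V, W isomorphic
   and [V (+) W] - [V] - [W].  R = int gives r(H), R = complex numbers gives
   C (x)_Z r(H), as extension of scalars preserves presentations. *)
Inductive green_relator : free -> Prop :=
| green_relator_iso (V W : tmod) :
    taft_iso V W -> green_relator (<< V >> - << W >>)
| green_relator_sum (V W : tmod) :
    green_relator (<< taft_sum V W >> - (<< V >> + << W >>)).

Definition submod_pred (S : free -> Prop) : Prop :=
  [/\ S 0, forall x y, S x -> S y -> S (x + y) & forall c x, S x -> S (c *: x)].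

Definition green_ker : {pred free} := fun x =>
  `[< forall S, submod_pred S -> (forall r, green_relator r -> S r) -> S x >].

Lemma green_kerP x : reflect
  (forall S, submod_pred S -> (forall r, green_relator r -> S r) -> S x)
  (x \in green_ker).
Proof. exact: asboolP. Qed.

Lemma green_ker_ind (P : free -> Prop) : submod_pred P ->
  (forall r, green_relator r -> P r) -> forall x, x \in green_ker -> P x.
Proof. by move=> P1 P2 x /green_kerP; exact. Qed.

Lemma green_ker_submod : submod_pred (fun x => x \in green_ker).
Proof.
split=> [|x y /green_kerP hx /green_kerP hy|c x /green_kerP hx]; apply/green_kerP.
- by move=> S [].
- by move=> S hS hr; have [_ hD _] := hS; apply: hD; [exact: hx|exact: hy].
- by move=> S hS hr; have [_ _ hZ] := hS; apply: hZ; exact: hx.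
Qed.

Lemma green_ker_relator r : green_relator r -> r \in green_ker.
Proof. by move=> hr; apply/green_kerP => S _; exact. Qed.

Lemma green_kerD x y : x \in green_ker -> y \in green_ker -> x + y \in green_ker.
Proof. by case: green_ker_submod => _ h _; exact: h. Qed.

Lemma green_kerZ c x : x \in green_ker -> c *: x \in green_ker.
Proof. by case: green_ker_submod => _ _; exact. Qed.

Lemma green_ker_zmod : zmod_closed green_ker.
Proof.
have [h0 hD hZ] := green_ker_submod.
by split=> // x y hx hy; apply: hD => //; rewrite -scaleN1r; exact: hZ.
Qed.

HB.instance Definition _ := GRing.isZmodClosed.Build free green_ker green_ker_zmod.

Lemma green_ker_iso V W : taft_iso V W -> << V >> - << W >> \in green_ker.
Proof. by move=> h; exact/green_ker_relator/green_relator_iso. Qed.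

Lemma green_ker_mulr x y : x \in green_ker -> fmul x y \in green_ker.
Proof.
have [h0 hD hZ] := green_ker_submod; move=> hx; elim/freeg_lin_ind: y.
- by rewrite freeg_mul0r.
- by move=> D E hD' hE; rewrite freeg_mulDr hD.
- by move=> c D hD'; rewrite freeg_mulZr hZ.
move=> U; elim/green_ker_ind: x / hx.
  split=> [|x y hx hy|c x hx]; first by rewrite freeg_mul0l.
    by rewrite freeg_mulDl hD.
  by rewrite freeg_mulZl hZ.
move=> _ [V W hVW|V W]; rewrite !(freeg_mulDl, freeg_mulNl, freeg_mulU).
  exact/green_ker_iso/taft_tens_isol.
rewrite -(subrK << taft_sum (taft_tens hq V U) (taft_tens hq W U) >> << _ >>).
rewrite -addrA hD //; first exact/green_ker_iso/taft_tensDl.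
exact/green_ker_relator/green_relator_sum.
Qed.

Lemma green_ker_mull x y : y \in green_ker -> fmul x y \in green_ker.
Proof.
have [h0 hD hZ] := green_ker_submod; move=> hy; elim/freeg_lin_ind: x.
- by rewrite freeg_mul0l.
- by move=> D E hD' hE; rewrite freeg_mulDl hD.
- by move=> c D hD'; rewrite freeg_mulZl hZ.
move=> U; elim/green_ker_ind: y / hy.
  split=> [|x y hx hy|c x hx]; first by rewrite freeg_mul0r.
    by rewrite freeg_mulDr hD.
  by rewrite freeg_mulZr hZ.
move=> _ [V W hVW|V W]; rewrite !(freeg_mulDr, freeg_mulNr, freeg_mulU).
  exact/green_ker_iso/taft_tens_isor.
rewrite -(subrK << taft_sum (taft_tens hq U V) (taft_tens hq U W) >> << _ >>).
rewrite -addrA hD //; first exact/green_ker_iso/taft_tensDr.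
exact/green_ker_relator/green_relator_sum.
Qed.

Lemma green_ker_mulA x y z : fmul x (fmul y z) - fmul (fmul x y) z \in green_ker.
Proof.
have [h0 hD hZ] := green_ker_submod.
elim/freeg_lin_ind: x => [|x x' hx hx'|c x hx|U].
- by rewrite !freeg_mul0l subr0.
- by rewrite !freeg_mulDl opprD addrACA hD.
- by rewrite !freeg_mulZl -scalerBr hZ.
elim/freeg_lin_ind: y => [|y y' hy hy'|c y hy|V].
- by rewrite freeg_mul0r !freeg_mul0l freeg_mul0r subr0.
- by rewrite !(freeg_mulDl, freeg_mulDr) opprD addrACA hD.
- by rewrite !(freeg_mulZl, freeg_mulZr) -scalerBr hZ.
elim/freeg_lin_ind: z => [|z z' hz hz'|c z hz|W].
- by rewrite !freeg_mul0r subr0.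
- by rewrite !freeg_mulDr opprD addrACA hD.
- by rewrite !freeg_mulZr -scalerBr hZ.
by rewrite !freeg_mulU; exact/green_ker_iso/taft_tensA.
Qed.

Lemma green_ker_mul1 x : fmul << taft_triv n hq >> x - x \in green_ker.
Proof.
have [h0 hD hZ] := green_ker_submod.
elim/freeg_lin_ind: x => [|x x' hx hx'|c x hx|U].
- by rewrite freeg_mul0r subr0.
- by rewrite freeg_mulDr opprD addrACA hD.
- by rewrite freeg_mulZr -scalerBr hZ.
by rewrite freeg_mulU; exact/green_ker_iso/taft_tens1V.
Qed.

Lemma green_ker_mulr1 x : fmul x << taft_triv n hq >> - x \in green_ker.
Proof.
have [h0 hD hZ] := green_ker_submod.
elim/freeg_lin_ind: x => [|x x' hx hx'|c x hx|U].
- by rewrite freeg_mul0l subr0.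
- by rewrite freeg_mulDl opprD addrACA hD.
- by rewrite freeg_mulZl -scalerBr hZ.
by rewrite freeg_mulU; exact/green_ker_iso/taft_tensV1.
Qed.

Lemma taft_iso_dim (V W : tmod) : taft_iso V W -> tdim V = tdim W.
Proof.
case=> P [P' [PP' P'P _ _]]; apply/eqP; rewrite eqn_leq.
apply/andP; split.
  have := mulmx1_min_rank (A := 1%:M) (etrans (congr1 (mulmx^~ P) (mulmx1 P')) P'P).
  by rewrite mxrank1.
have := mulmx1_min_rank (A := 1%:M) (etrans (congr1 (mulmx^~ P') (mulmx1 P)) PP').
by rewrite mxrank1.
Qed.

Lemma green_ker1 : << taft_triv n hq >> \notin green_ker.
Proof.
pose f : free -> R^o := fglift (fun V : tmod => (tdim V)%:R : R^o).
have f0 x : x \in green_ker -> f x = 0.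
  move=> hx; elim/green_ker_ind: x / hx.
    split; first exact: linear0.
      by move=> x y hx hy; rewrite /f linearD /= -/(f x) -/(f y) hx hy addr0.
    by move=> c x hx; rewrite /f linearZ /= -/(f x) hx scaler0.
  move=> _ [V W /taft_iso_dim eVW|V W].
    by rewrite /f linearB /= !fgliftU eVW subrr.
  by rewrite /f linearB linearD /= !fgliftU natrD subrr.
by apply/negP => /f0 /eqP; rewrite /f fgliftU /= oner_eq0.
Qed.

(* The product of [green] depends on [hq] (tensor products of modules are
   modules), so [hq] has to be a parameter of the type for the ring structure
   to be inferred from it. *)
Definition green : Type := let _ := hq in Quotient.quot green_ker.

HB.instance Definition _ := GRing.Zmodule.copy green (Quotient.quot green_ker).

Local Notation pi := (\pi_(Quotient.quot green_ker)%qT : free -> green).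

Lemma green_piP x y : reflect (pi x = pi y) (x - y \in green_ker).
Proof. by rewrite Quotient.idealrBE; exact: eqP. Qed.

Lemma green_piK (x : green) : pi (repr x) = x. Proof. exact: reprK. Qed.

Lemma green_ind (P : green -> Prop) : (forall x, P (pi x)) -> forall x, P x.
Proof. by move=> h x; rewrite -(green_piK x). Qed.

Lemma green_piD x y : pi (x + y) = pi x + pi y. Proof. exact: raddfD. Qed.

Definition green_mul (x y : green) : green := pi (fmul (repr x) (repr y)).
Definition green_scale (c : R) (x : green) : green := pi (c *: repr x).
Definition green_one : green := pi << taft_triv n hq >>.

Lemma green_repr_pi x : repr (pi x) - x \in green_ker.
Proof. by apply/green_piP; rewrite green_piK. Qed.

Lemma green_mulE x y : green_mul (pi x) (pi y) = pi (fmul x y).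
Proof.
apply/green_piP; set x' := repr _; set y' := repr _.
rewrite -(subrK (fmul x y') (fmul x' y')) -addrA green_kerD //.
  by rewrite -freeg_mulNl -freeg_mulDl green_ker_mulr // green_repr_pi.
by rewrite -freeg_mulNr -freeg_mulDr green_ker_mull // green_repr_pi.
Qed.

Lemma green_scaleE c x : green_scale c (pi x) = pi (c *: x).
Proof. by apply/green_piP; rewrite -scalerBr green_kerZ // green_repr_pi. Qed.

Lemma green_mulA : associative green_mul.
Proof.
elim/green_ind=> x; elim/green_ind=> y; elim/green_ind=> z.
by rewrite !green_mulE; apply/green_piP; exact: green_ker_mulA.
Qed.

Lemma green_mul1 : left_id green_one green_mul.
Proof.
by elim/green_ind=> x; rewrite green_mulE; apply/green_piP; exact: green_ker_mul1.
Qed.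

Lemma green_mulr1 : right_id green_one green_mul.
Proof.
by elim/green_ind=> x; rewrite green_mulE; apply/green_piP; exact: green_ker_mulr1.
Qed.

Lemma green_mulDl : left_distributive green_mul +%R.
Proof.
elim/green_ind=> x; elim/green_ind=> y; elim/green_ind=> z.
by rewrite -green_piD !green_mulE freeg_mulDl green_piD.
Qed.

Lemma green_mulDr : right_distributive green_mul +%R.
Proof.
elim/green_ind=> x; elim/green_ind=> y; elim/green_ind=> z.
by rewrite -green_piD !green_mulE freeg_mulDr green_piD.
Qed.

Lemma green_one_neq0 : green_one != 0.
Proof.
apply/eqP => h; have : green_one = pi 0 by rewrite h raddf0.
by move/green_piP; rewrite subr0; apply/negP; exact: green_ker1.
Qed.

HB.instance Definition _ := GRing.Zmodule_isNzRing.Build green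
  green_mulA green_mul1 green_mulr1 green_mulDl green_mulDr green_one_neq0.

Lemma green_scaleA a b x : green_scale a (green_scale b x) = green_scale (a * b) x.
Proof. by elim/green_ind: x => x; rewrite !green_scaleE scalerA. Qed.

Lemma green_scale1 : left_id 1 green_scale.
Proof. by elim/green_ind=> x; rewrite green_scaleE scale1r. Qed.

Lemma green_scaleDr : right_distributive green_scale +%R.
Proof.
move=> c; elim/green_ind=> x; elim/green_ind=> y.
by rewrite -green_piD !green_scaleE scalerDr green_piD.
Qed.

Lemma green_scaleDl x : {morph green_scale^~ x : a b / a + b}.
Proof.
by move=> a b; elim/green_ind: x => x; rewrite !green_scaleE scalerDl green_piD.
Qed.

HB.instance Definition _ := GRing.Zmodule_isLmodule.Build R green
  green_scaleA green_scale1 green_scaleDr green_scaleDl.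

Lemma green_scaleAl (c : R) (x y : green) : c *: (x * y) = (c *: x) * y.
Proof.
elim/green_ind: x => x; elim/green_ind: y => y.
by rewrite -[RHS]/(green_mul (green_scale c _) _) -[LHS]/(green_scale c (green_mul _ _))
   !(green_scaleE, green_mulE) freeg_mulZl.
Qed.

HB.instance Definition _ := GRing.Lmodule_isLalgebra.Build R green green_scaleAl.

Lemma green_scaleAr (c : R) (x y : green) : c *: (x * y) = x * (c *: y).
Proof.
elim/green_ind: x => x; elim/green_ind: y => y.
by rewrite -[RHS]/(green_mul _ (green_scale c _)) -[LHS]/(green_scale c (green_mul _ _))
   !(green_scaleE, green_mulE) freeg_mulZr.
Qed.

HB.instance Definition _ := GRing.Lalgebra_isAlgebra.Build R green green_scaleAr.

Definition green_class (V : tmod) : green := pi << V >>.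

End Green.

Arguments green R {K} n {d q} hq.
Arguments green_class R {K n d q} hq V.

Local Open Scope classical_set_scope.
Local Open Scope ring_scope.

Section Indecomposables.
Variables (K : fieldType) (n d : nat) (q omega : K).
Hypotheses (hd : (2 <= d)%N) (hdn : (d %| n)%N).
Hypotheses (hq : d.-primitive_root q) (homega : n.-primitive_root omega).

(* Columns are vectors: column j of [taft_ind_g] (resp. [taft_ind_h]) holds the
   coordinates of g v_j = omega^i q^(-j) v_j (resp. h v_j = v_(j+1)). *)
Definition taft_ind_g (l : nat) (i : int) : 'M[K]_l :=
  \matrix_(a, b) (omega ^ i * q ^- b *+ (a == b)).

Definition taft_ind_h (l : nat) : 'M[K]_l := \matrix_(a, b) (a == b.+1 :> nat)%:R.

Lemma taft_ind_gE l i : taft_ind_g l i = diag_mx (\row_j (omega ^ i * q ^- j)).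
Proof.
by apply/matrixP => a b; rewrite !mxE eq_sym; case: eqP => // ->.
Qed.

Lemma taft_ind_hX l k : taft_ind_h l ^+ k = \matrix_(a, b) (a == (b + k)%N :> nat)%:R.
Proof.
elim: k => [|k IHk].
  by rewrite expr0; apply/matrixP => a b; rewrite !mxE addn0.
rewrite exprSr IHk -mulmxE; apply/matrixP => a b; rewrite !mxE.
under eq_bigr => c _ do rewrite !mxE.
have [lt_b|ge_b] := ltnP b.+1 l.
  rewrite (bigD1 (Ordinal lt_b)) //= eqxx mulr1 big1 ?addr0 => [|c ne_c].
    by rewrite addSnnS.
  by rewrite -val_eqE /= in ne_c; rewrite (negbTE ne_c) mulr0.
rewrite big1 => [|c _].
  by rewrite ltn_eqF // (leq_trans (ltn_ord a)) // (leq_trans ge_b) // addnS ltnS leq_addr.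
rewrite [(c : nat) == _]ltn_eqF ?mulr0 //; exact: leq_trans (ltn_ord c) ge_b.
Qed.

Lemma taft_ind_rel l i : (1 <= l <= d)%N ->
  taft_rel n d q (taft_ind_g l i) (taft_ind_h l).
Proof.
case/andP=> _ le_ld.
have q0 : q != 0.
  apply: contra_eq_neq (prim_expr_order hq) => ->.
  by rewrite expr0n gtn_eqF ?(prim_order_gt0 hq) // eq_sym oner_eq0.
have qn1 : q ^+ n = 1 by apply/eqP; rewrite -(prim_order_dvd hq).
apply/and3P; split; apply/eqP.
- have gX k : taft_ind_g l i ^+ k = diag_mx (\row_j (omega ^ i * q ^- j) ^+ k).
    elim: k => [|k IHk]; first by apply/matrixP => a b; rewrite !mxE.
    rewrite exprS IHk -mulmxE taft_ind_gE mulmx_diag; congr diag_mx.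
    by apply/rowP => j; rewrite !mxE exprS.
  rewrite gX; apply/matrixP => a b; rewrite !mxE; congr (_ *+ _).
  rewrite exprMn exprVn exprAC qn1 expr1n invr1 mulr1.
  by rewrite exprnP exprzAC -exprnP (prim_expr_order homega) exp1rz.
- rewrite taft_ind_hX; apply/matrixP => a b; rewrite !mxE ltn_eqF //.
  by rewrite (leq_trans (ltn_ord a)) // (leq_trans le_ld) // leq_addl.
apply/matrixP => a b; rewrite taft_ind_gE mul_mx_diag mul_diag_mx !mxE.
have [->|] := eqVneq (a : nat) b.+1; last by rewrite !(mul0r, mulr0).
by rewrite mul1r mulr1 exprS invfM mulrCA mulVKf.
Qed.

Definition taft_ind (l : nat) (i : int) (hl : (1 <= l <= d)%N) : taft_mod n d q :=
  TaftMod (taft_ind_rel i hl).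

Lemma taft_ind1_subproof : (1 <= 1 <= d)%N. Proof. exact: ltnW. Qed.
Lemma taft_ind2_subproof : (1 <= 2 <= d)%N. Proof. exact: hd. Qed.

Definition green_y (C : comNzRingType) : green C n hq :=
  green_class C hq (taft_ind (-1) taft_ind1_subproof).
Definition green_z (C : comNzRingType) : green C n hq :=
  green_class C hq (taft_ind 0 taft_ind2_subproof).

End Indecomposables.

(* F acts on an A-module through c%:A. *)
Section ModuleNotions.
Variables (F : fieldType) (A : algType F).

Definition is_basis (V : lmodType A) (N : nat) (v : 'I_N -> V) : Prop :=
  forall w : V, exists! c : 'rV[F]_N, w = \sum_i (c 0 i)%:A *: v i.

Definition fin_dim (V : lmodType A) : Prop :=
  exists (N : nat) (v : 'I_N -> V), is_basis v.

Definition mod_iso (V W : lmodType A) : Prop :=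
  exists f : {linear V -> W}, bijective f.

Definition indecomposable (V : lmodType A) : Prop :=
  (exists v : V, v != 0) /\
  forall U W : lmodType A, mod_iso V (U * W)%type ->
    (forall u : U, u = 0) \/ (forall w : W, w = 0).

Definition projective (P : lmodType A) : Prop :=
  forall (U W : lmodType A) (p : {linear U -> W}) (f : {linear P -> W}),
    (forall w, exists u, p u = w) ->
    exists g : {linear P -> U}, forall x, p (g x) = f x.

(* [M i] is the isomorphism type "being a copy of the i-th module": the types
   M i, i in J, are realized, consist of finite dimensional indecomposables, are
   pairwise distinct, and exhaust the finite dimensional indecomposables. *)
Definition complete_list (I : Type) (J : set I) (M : I -> lmodType A -> Prop) : Prop :=
  [/\ forall i, J i -> exists V, M i V,
      forall i V, J i -> M i V -> fin_dim V /\ indecomposable V,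
      forall i j V W, J i -> J j -> M i V -> M j W -> (mod_iso V W <-> i = j)
    & forall V, fin_dim V -> indecomposable V -> exists2 i, J i & M i V].

Definition two_sided_ideal (B : set A) : Prop :=
  [/\ B 0, forall x y, B x -> B y -> B (x + y)
    & forall a x, B x -> B (a * x) /\ B (x * a)].

Definition ideal_dsum (B B1 B2 : set A) : Prop :=
  [/\ two_sided_ideal B1, two_sided_ideal B2, B = [set x + y | x in B1 & y in B2]
    & B1 `&` B2 = [set 0]].

(* Direct factors of A as an algebra are its two-sided ideals with a
   complementary two-sided ideal; a direct decomposition of such a factor as an
   algebra is a decomposition into two-sided ideals of A. *)
Definition is_block (B : set A) : Prop :=
  [/\ exists B' : set A, ideal_dsum setT B B',
      B <> [set 0]
    & forall B1 B2, ideal_dsum B B1 B2 -> B1 = [set 0] \/ B2 = [set 0]].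

Definition has_dim (B : set A) (N : nat) : Prop :=
  exists2 v : 'I_N -> A, (forall i, B (v i)) &
    forall x, B x -> exists! c : 'rV[F]_N, x = \sum_i c 0 i *: v i.

End ModuleNotions.

(* [s k] is the chosen square root of omega_k^m. *)
Section List.
Variables (R : realType) (n d : nat) (s : nat -> R[i]).
Local Notation C := R[i].

Definition omegaC (k : nat) : C :=
  (cos (2 * k%:R * pi / n%:R) +i* sin (2 * k%:R * pi / n%:R))%C.

Definition sigmaC (k j : nat) : C := 2 * s k * ((cos (pi * j%:R / d%:R))%:C)%C.

Definition frakT : set (C * C) :=
  [set p | exists k, [/\ (k < n)%N, (d %| k)%N & p = (omegaC k, 2)]] `|`
  [set p | exists k j, [/\ (k < n)%N, (1 <= j <= d.-1)%N & p = (omegaC k, sigmaC k j)]].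

Definition list_index : set (C * C + nat) :=
  [set x | match x with
           | inl p => frakT p
           | inr k => (k < n)%N /\ ~~ (d %| k)%N
           end].

Variables (A : algType C) (y z : A).

Definition is_Cmod (lambda mu : C) (V : lmodType A) : Prop :=
  exists v : V, [/\ is_basis (fun _ : 'I_1 => v),
    y *: v = lambda%:A *: v & z *: v = mu%:A *: v].

Definition is_Vmod (k : nat) (V : lmodType A) : Prop :=
  exists v1 v2 : V,
    [/\ is_basis (fun i : 'I_2 => if i == ord0 then v1 else v2),
        y *: v1 = (omegaC k)%:A *: v1 /\ y *: v2 = (omegaC k)%:A *: v2,
        z *: v1 = (1 + omegaC k ^+ (n %/ d))%:A *: v1
      & z *: v2 = v1 + (1 + omegaC k ^+ (n %/ d))%:A *: v2].

Definition list_mod (x : C * C + nat) (V : lmodType A) : Prop :=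
  match x with
  | inl (lambda, mu) => is_Cmod lambda mu V
  | inr k => is_Vmod k V
  end.

End List.

(* Main.v *)
(* Every module of the generalized Taft algebra splits into chains M(l,i):
   if h^l = 0 <> h^(l-1), pick eigenvectors v of g and phi of its transpose with
   phi h^(l-1) v = 1; then phi h^a h^b v = 0 unless a + b = l - 1, so the chain of v is a
   direct summand.  Explicit chains in M(2,0) (x) M(l,i) give the relations
   y^n = 1 and (z - 1 - y^m) F_d(y^m, z) = 0, and the ranks of h^j on the eigenspaces of g
   show that the y^i F_l(y^m, z) are linearly independent.
   On the omega_k-eigenspace of y the element z therefore has minimal polynomial
   (z - 1 - omega_k^m) F_d(omega_k^m, z), whose roots 1 + omega_k^m and sigma_{k,j} are
   simple if d | k, while otherwise 1 + omega_k^m is one of the sigma_{k,j} and is a double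
   root.  The Chinese remainder theorem turns these roots into orthogonal idempotents E
   with E A = C E or E A = C E + C N, where N^2 = 0 and, by the dimension count, N <> 0;
   modules and blocks are read off from these local summands. *)
Require Import Defs.
From HB Require Import structures.
From mathcomp Require Import all_boot all_order all_algebra.
From mathcomp Require Import mxtens complex ring lra.
From mathcomp Require Import boolp classical_sets functions cardinality.
From mathcomp Require Import reals trigo.
From mathcomp Require Import freeg.

Set Implicit Arguments.
Unset Strict Implicit.
Unset Printing Implicit Defensive.

Import Order.TTheory GRing.Theory Num.Theory.
Local Open Scope classical_set_scope.
Local Open Scope ring_scope.

(** * Classes in the Green algebra *)

(** Elements of the Green algebra are cosets of formal sums of modules, without a normal form.
    Relations between them come from explicit isomorphisms, but independence and nonvanishing have
    to be tested against additive isomorphism invariants, here differences of ranks. This decides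
    how a double root is treated: the relations only bound the algebra from above and cannot show
    that N is nonzero. The bound from below is a family of nd independent elements; the E and the
    candidate N together are nd spanning elements, hence independent, and none of them vanishes. The
    double root itself is trigonometric. With theta = pi k / d one has 1 + omega_k^m = 2 cos(theta)
    exp(i theta), and exp(i theta) is a square root of omega_k^m. If d divides k, then cos(theta) is
    1 or -1, a value that no cos(pi j / d) with 0 < j < d attains; otherwise it is such a cosine up
    to sign. Modules and blocks depend only on the local summands, so they are classified for an
    arbitrary commutative algebra with such E and N. *)

Lemma idempotent_mx_factor (K : fieldType) N (e : 'M[K]_N) : e *m e = e ->
  exists r (B : 'M[K]_(N, r)) (D : 'M[K]_(r, N)), B *m D = e /\ D *m B = 1%:M.
Proof.
move=> ee; have eBD : col_base e *m row_base e = e by exact: mulmx_base.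
exists (\rank e), (col_base e), (row_base e); split=> //.
(* The factors have full rank, so they may be cancelled from B D B D = B D. *)
apply: (row_full_inj (col_base_full e)); apply: (row_free_inj (row_base_free e)).
by rewrite mulmx1 (mulmxA (col_base e)) eBD -mulmxA eBD ee.
Qed.

Section GreenClass.
Variables (R : comNzRingType) (K : fieldType) (n d : nat) (q : K).
Variable hq : d.-primitive_root q.
Local Notation tmod := (taft_mod n d q).
Local Notation A := (green R n hq).
Local Notation cl := (@green_class R K n d q hq).

Lemma green_class_iso (V W : tmod) : taft_iso V W -> cl V = cl W.
Proof. by move=> h; apply/green_piP; exact: green_ker_iso. Qed.

Lemma green_class_sum (V W : tmod) : cl (taft_sum V W) = cl V + cl W.
Proof.
rewrite /green_class -green_piD; apply/green_piP.
exact/green_ker_relator/green_relator_sum.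
Qed.

Lemma green_class_tens (V W : tmod) : cl V * cl W = cl (taft_tens hq V W).
Proof. by rewrite -[LHS]/(green_mul _ _) green_mulE freeg_mulU. Qed.

Lemma green_class_triv : cl (taft_triv n hq) = 1.
Proof. by []. Qed.

Lemma green_class_ind (P : A -> Prop) : P 0 -> (forall a b, P a -> P b -> P (a + b)) ->
  (forall c a, P a -> P (c *: a)) -> (forall V, P (cl V)) -> forall a, P a.
Proof.
move=> P0 PD PZ Pcl; elim/green_ind=> x; elim/freeg_lin_ind: x.
- by rewrite raddf0.
- by move=> D E hD hE; rewrite green_piD; exact: PD.
- by move=> c D hD; rewrite -green_scaleE; exact: PZ.
- exact: Pcl.
Qed.

Lemma taft_iso_square (V W : tmod) (P : 'M[K]_(tdim W, tdim V)) :
  tdim V = tdim W -> row_full P ->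
  P *m tg V = tg W *m P -> P *m th V = th W *m P -> taft_iso V W.
Proof.
move=> eVW fullP Pg Ph; exists P, (pinvmx P); split=> //.
- by rewrite mulmxVp // /row_free (eqP fullP) eVW.
- exact: mulVpmx.
Qed.

(** A zero module is isomorphic to its own double, so [V] = 2 [V]. *)
Lemma green_class0 (V : tmod) : tdim V = 0%N -> cl V = 0.
Proof.
move=> V0; have eV : taft_iso (taft_sum V V) V.
  exists 0, 0; split=> /=; apply/matrixP=> i j; exfalso;
    by [case: i => i; rewrite /= ?V0 | case: j => j; rewrite /= ?V0].
have := green_class_iso eV; rewrite green_class_sum => /eqP.
by rewrite -subr_eq0 addrK => /eqP.
Qed.

(** M is a retract of V, so e = 1 - Q P is an idempotent endomorphism. Its rank factorization e = B
    D turns the image of e into a module with matrices D g B and D h B. *)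
Lemma green_class_split (V M : tmod)
    (Q : 'M[K]_(tdim V, tdim M)) (P : 'M[K]_(tdim M, tdim V)) :
  tg V *m Q = Q *m tg M -> th V *m Q = Q *m th M ->
  P *m tg V = tg M *m P -> P *m th V = th M *m P -> P *m Q = 1%:M ->
  exists2 W : tmod, (tdim W + tdim M = tdim V)%N & cl V = cl M + cl W.
Proof.
move=> gQ hQ Pg Ph PQ; pose e := 1%:M - Q *m P.
have Pe : P *m e = 0 by rewrite mulmxBr mulmx1 mulmxA PQ mul1mx subrr.
have eQ : e *m Q = 0 by rewrite mulmxBl mul1mx -mulmxA PQ mulmx1 subrr.
have ee : e *m e = e by rewrite {2}/e mulmxBr mulmx1 mulmxA eQ mul0mx subr0.
have eg : e *m tg V = tg V *m e.
  by rewrite mulmxBl mulmxBr mul1mx mulmx1 mulmxA gQ -!mulmxA Pg.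
have eh : e *m th V = th V *m e.
  by rewrite mulmxBl mulmxBr mul1mx mulmx1 mulmxA hQ -!mulmxA Ph.
have [r [B [D [eBD DB]]]] := idempotent_mx_factor ee.
have eB : e *m B = B by rewrite -eBD -mulmxA DB mulmx1.
have De : D *m e = D by rewrite -eBD mulmxA DB mul1mx.
have PB : P *m B = 0 by rewrite -eB mulmxA Pe mul0mx.
have DQ : D *m Q = 0 by rewrite -De -mulmxA eQ mulmx0.
have DXB (X Y : 'M[K]_(tdim V)) : e *m X = X *m e ->
    (D *m X *m B) *m (D *m Y *m B) = D *m (X *m Y) *m B.
  move=> eX; rewrite !mulmxA -(mulmxA _ B) eBD -(mulmxA D X) -eX.
  by rewrite (mulmxA D e) De.
have DXBX (X : 'M[K]_(tdim V)) k : e *m X = X *m e ->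
    (D *m X *m B) ^+ k = D *m (X ^+ k) *m B.
  move=> eX; elim: k => [|k IHk]; first by rewrite !expr0 mulmx1 DB.
  by rewrite !exprS IHk -!mulmxE DXB.
have /and3P[/eqP g1 /eqP h0 /eqP hg] := tmodP V.
have rel : taft_rel n d q (D *m tg V *m B) (D *m th V *m B).
  apply/and3P; split; apply/eqP.
  - by rewrite DXBX // g1 mulmx1 DB.
  - by rewrite DXBX // h0 mulmx0 mul0mx.
  - by rewrite !DXB // hg -scalemxAr -scalemxAl.
have iso : taft_iso (taft_sum M (TaftMod rel)) V.
  exists (row_mx Q B), (col_mx P D); split.
  - by rewrite mul_row_col eBD addrC subrK.
  - by rewrite mul_col_row PQ PB DQ DB -scalar_mx_block.
  - rewrite /= mul_row_block !mulmx0 addr0 add0r mul_mx_row gQ; congr row_mx.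
    by rewrite !mulmxA eBD eg -mulmxA eB.
  - rewrite /= mul_row_block !mulmx0 addr0 add0r mul_mx_row hQ; congr row_mx.
    by rewrite !mulmxA eBD eh -mulmxA eB.
exists (TaftMod rel).
  exact: etrans (addnC _ _) (taft_iso_dim iso).
by rewrite -green_class_sum (green_class_iso iso).
Qed.

End GreenClass.

(** * Eigenprojections of an element of finite order *)

Section RootsOfUnity.
Variables (F : fieldType) (n : nat) (zeta : F).
Hypothesis hzeta : n.-primitive_root zeta.

Lemma prim_root_neq0 : zeta != 0.
Proof. by rewrite (prim_root_eq0 hzeta) -lt0n (prim_order_gt0 hzeta). Qed.

Lemma prim_root_inv : n.-primitive_root zeta^-1.
Proof.
apply/andP; split; first exact: prim_order_gt0 hzeta.
apply/forallP=> i; rewrite unity_rootE exprVn invr_eq1 -unity_rootE.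
by have /andP[_ /forallP] := hzeta; exact.
Qed.

Lemma prim_root_sum k :
  \sum_(j < n) (zeta ^+ k) ^+ j = (n %| k)%:R * n%:R.
Proof.
case: (boolP (n %| k)%N) => [/dvdnP[c ->]|ndvd].
  rewrite mulnC exprM (prim_expr_order hzeta) expr1n mul1r.
  by under eq_bigr do rewrite expr1n; rewrite sumr_const card_ord.
apply/eqP; rewrite mul0r.
have : (zeta ^+ k - 1) * (\sum_(j < n) (zeta ^+ k) ^+ j) == 0.
  by rewrite -subrX1 exprAC (prim_expr_order hzeta) expr1n subrr.
by rewrite mulf_eq0 subr_eq0 -(prim_order_dvd hzeta) (negbTE ndvd).
Qed.

Variables (A : algType F) (y : A).
Hypothesis yn1 : y ^+ n = 1.

(** The discrete Fourier idempotent of the zeta^k-eigenspace of y. The algebra is arbitrary because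
    the projection is used both for g in a matrix algebra and for y in the Green algebra. *)
Definition eigproj (k : nat) : A :=
  n%:R^-1 *: \sum_(j < n) (zeta ^- k *: y) ^+ j.

Lemma eigproj_comm a k : GRing.comm y a -> GRing.comm (eigproj k) a.
Proof.
move=> ya; rewrite /GRing.comm /eigproj -scalerAl -scalerAr mulr_suml mulr_sumr.
congr (_ *: _); apply: eq_bigr => j _; apply/commr_sym/commrX.
by rewrite /GRing.comm -scalerAl -scalerAr ya.
Qed.

(** For x = zeta^-k y the geometric sum gives (x - 1) (1 + x + ... + x^(n-1)) = x^n - 1 = 0. *)
Lemma mul_eigproj k : y * eigproj k = zeta ^+ k *: eigproj k.
Proof.
have zk0 : zeta ^+ k != 0 by rewrite expf_neq0 // prim_root_neq0.
apply: (scalerI (invr_neq0 zk0)).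
rewrite scalerA mulVf // scale1r scalerAl /eigproj -scalerAr.
congr (_ *: _); apply/eqP; rewrite -subr_eq0 -[X in _ - X]mul1r -mulrBl -subrX1.
by rewrite exprZn yn1 exprVn exprAC (prim_expr_order hzeta) expr1n invr1 scale1r subrr.
Qed.

Lemma sum_eigproj : \sum_(k < n) eigproj k = 1.
Proof.
have n0 := prim_root_natf_neq0 hzeta.
rewrite -scaler_sumr exchange_big /=.
have n_gt0 := prim_order_gt0 hzeta.
rewrite (bigD1 (Ordinal n_gt0)) //= [X in _ + X]big1 => [|j j0].
  under eq_bigr do rewrite /= expr0.
  by rewrite sumr_const card_ord addr0 -scaler_nat scalerA mulVf // scale1r.
under eq_bigr do rewrite exprZn.
rewrite -scaler_suml.
under eq_bigr do rewrite -exprVn exprAC.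
have -> : \sum_(i < n) (zeta^-1 ^+ j) ^+ i = (\sum_(i < n) (zeta ^+ (n - j)) ^+ i).
  apply: eq_bigr => i _; congr (_ ^+ _).
  have lejn : (j <= n)%N by exact/ltnW.
  apply/(mulIf (expf_neq0 j prim_root_neq0)).
  by rewrite -exprMn mulVf ?prim_root_neq0 // expr1n -exprD subnK // (prim_expr_order hzeta).
rewrite prim_root_sum gtnNdvd ?mul0r ?scale0r ?subn_gt0 // ltn_subrL n_gt0 andbT lt0n.
by apply: contra_neq j0 => j0; apply/val_inj.
Qed.

(** Powers of zeta^-k y act on a as powers of zeta^(l-k), whose sum is n or 0; l - k is written l +
    (n - k) to stay in the naturals. With another projection as a, this is orthogonality. *)
Lemma mul_eigproj_eigvec (a : A) (k l : nat) : (k < n)%N -> (l < n)%N ->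
  y * a = zeta ^+ l *: a -> eigproj k * a = if k == l then a else 0.
Proof.
move=> ltkn ltln ya.
have yja j : (zeta ^- k *: y) ^+ j * a = (zeta ^+ (l + (n - k))) ^+ j *: a.
  elim: j => [|j IHj]; first by rewrite !expr0 mul1r scale1r.
  rewrite exprS -mulrA IHj -scalerAr -scalerAl ya !scalerA exprSr exprD.
  congr (_ *: _); rewrite -mulrA [X in _ * X]mulrC; congr (_ * (_ * _)).
  apply/(mulIf (expf_neq0 k prim_root_neq0)).
  rewrite mulVf ?expf_neq0 ?prim_root_neq0 // -exprD subnK ?(prim_expr_order hzeta) //.
  exact: ltnW.
rewrite /eigproj -scalerAl mulr_suml; under eq_bigr do rewrite yja.
rewrite -scaler_suml prim_root_sum scalerA.
have -> : (n %| l + (n - k))%N = (k == l).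
  rewrite (prim_order_dvd hzeta) exprD.
  have -> : (k == l) = (zeta ^+ k == zeta ^+ l).
    by rewrite (eq_prim_root_expr hzeta) !modn_small.
  have e : zeta ^+ (n - k) * zeta ^+ k = 1.
    by rewrite -exprD subnK ?(prim_expr_order hzeta) // ltnW.
  apply/eqP/eqP => [h|<-]; last by rewrite mulrC.
  by rewrite -[LHS]mul1r -h -mulrA e mulr1.
case: eqP => _; last by rewrite mul0r mulr0 scale0r.
by rewrite mul1r mulVf ?scale1r // (prim_root_natf_neq0 hzeta).
Qed.

End RootsOfUnity.

(** * Decomposition into chain modules *)

Section ChainModules.
Variables (K : fieldType) (n d : nat) (q omega : K).
Hypotheses (hdn : (d %| n)%N) (hq : d.-primitive_root q).
Hypothesis homega : n.-primitive_root omega.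

Local Notation ind_g l i := (taft_ind_g q omega l (- i%:Z)).
Local Notation ind_h l := (taft_ind_h K l).

Lemma taft_ind_g_entry l i a b :
  ind_g l i a b = omega^-1 ^+ i * q ^- b *+ (a == b).
Proof. by rewrite mxE -exprz_inv -exprnP. Qed.

Lemma mulmx_taft_ind_g N l i (Q : 'M[K]_(N, l)) x j :
  (Q *m ind_g l i) x j = Q x j * (omega^-1 ^+ i * q ^- j).
Proof.
rewrite mxE (bigD1 j) //= big1 ?addr0 => [|b ne_b]; rewrite taft_ind_g_entry.
  by rewrite eqxx.
by rewrite (negbTE ne_b) mulr0.
Qed.

Lemma taft_ind_g_mulmx N l i (P : 'M[K]_(l, N)) j x :
  (ind_g l i *m P) j x = (omega^-1 ^+ i * q ^- j) * P j x.
Proof.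
rewrite mxE (bigD1 j) //= big1 ?addr0 => [|b ne_b]; rewrite taft_ind_g_entry.
  by rewrite eqxx.
by rewrite eq_sym (negbTE ne_b) mul0r.
Qed.

Lemma mulmx_taft_ind_h N l (f : nat -> 'I_N -> K) : (forall x, f l x = 0) ->
  \matrix_(x < N, j < l) f j x *m ind_h l = \matrix_(x < N, j < l) f j.+1 x.
Proof.
move=> fl; apply/matrixP=> x j; rewrite !mxE.
under eq_bigr do rewrite !mxE.
have [lt_j|ge_j] := ltnP j.+1 l.
  rewrite (bigD1 (Ordinal lt_j)) //= eqxx mulr1 big1 ?addr0 // => a ne_a.
  by rewrite -val_eqE /= in ne_a; rewrite (negbTE ne_a) mulr0.
have -> : j.+1 = l by apply/eqP; rewrite eqn_leq ge_j ltn_ord.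
by rewrite fl big1 // => a _; rewrite ltn_eqF ?mulr0.
Qed.

Lemma taft_ind_h_mulmx N l (f : nat -> 'I_N -> K) :
  ind_h l *m \matrix_(j < l, x < N) f j x =
  \matrix_(j < l, x < N) (if (j : nat) is j'.+1 then f j' x else 0).
Proof.
apply/matrixP=> j x; rewrite !mxE; under eq_bigr do rewrite !mxE.
case: j => [[|j] lt_j] /=; first by rewrite big1 // => a _; rewrite mul0r.
rewrite (bigD1 (Ordinal (ltnW lt_j))) //= eqxx mul1r big1 ?addr0 // => a ne_a.
by rewrite -val_eqE /= in ne_a; rewrite eqSS eq_sym (negbTE ne_a) mul0r.
Qed.

Lemma chain_rel l i : (l <= d)%N -> taft_rel n d q (ind_g l i) (ind_h l).
Proof.
case: l => [_|l lel]; last exact: (taft_ind_rel hdn hq homega).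
by apply/and3P; split; apply/eqP/matrixP; case.
Qed.

Definition taft_chain l i (hl : (l <= d)%N) : taft_mod n d q := TaftMod (chain_rel i hl).

Lemma taft_ind_chain l i (hl : (1 <= l <= d)%N) (hl' : (l <= d)%N) :
  taft_ind hdn hq homega (- i%:Z) hl = taft_chain i hl'.
Proof. by congr TaftMod; exact: eq_irrelevance. Qed.

(** Inserting the eigenprojections of G on both sides of H^(l-1) <> 0 leaves a nonzero entry, which
    provides v and phi. Moving G through H^j costs q^j, so phi H^j v <> 0 forces z^k = q^j z^k'. As
    q^0, ..., q^(d-1) are distinct and l <= d, only j = l - 1 is possible below l. *)
Lemma chain_summand N (G H : 'M[K]_N.+1) : taft_rel n d q G H ->
  exists l i, [/\ (0 < l <= d)%N, (i < n)%N &
    exists (Q : 'M_(N.+1, l)) (P : 'M_(l, N.+1)),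
    [/\ G *m Q = Q *m ind_g l i, H *m Q = Q *m ind_h l,
        P *m G = ind_g l i *m P, P *m H = ind_h l *m P & P *m Q = 1%:M]].
Proof.
case/and3P=> /eqP Gn1 /eqP Hd0 /eqP HG.
have exl : exists k, H ^+ k == 0 by exists d; rewrite Hd0.
case: (ex_minnP exl) => l /eqP Hl0 minl.
have l_gt0 : (0 < l)%N by case: l Hl0 {minl} => // /eqP; rewrite expr0 oner_eq0.
have le_ld : (l <= d)%N by apply: minl; rewrite Hd0.
have Hl1 : H ^+ l.-1 != 0.
  by apply/negP=> /minl; rewrite leqNgt ltn_predL l_gt0.
have hz := prim_root_inv homega; set z := omega^-1 in hz *.
have q0 := prim_root_neq0 hq; have z0 := prim_root_neq0 hz.
have [e [Ge eG e1]] : exists e : nat -> 'M[K]_N.+1,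
    [/\ forall k, G *m e k = z ^+ k *: e k, forall k, e k *m G = z ^+ k *: e k
      & \sum_(k < n) e k = 1].
  exists (eigproj n z G); split=> [k|k|]; last exact: sum_eigproj.
    exact: mul_eigproj.
  by rewrite -mul_eigproj //; exact: eigproj_comm.
have [[k k'] /= /matrix0Pn[a [b]]] : exists p : 'I_n * 'I_n,
    e p.2 *m H ^+ l.-1 *m e p.1 != 0.
  apply/existsP; apply: contraNT Hl1 => /existsPn h.
  rewrite -[_ ^+ _]mulr1 -[_ ^+ _]mul1r -e1 -mulmxE.
  rewrite mulmx_suml mulmx_suml big1 // => k' _; rewrite mulmx_sumr big1 // => k _.
  by apply/eqP; have := h (k, k'); rewrite negbK.
set c := (_ *m _) a b => c0.
have [v [phi [Gv phiG phiv]]] : exists (v : 'cV[K]_N.+1) (phi : 'rV[K]_N.+1),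
    [/\ G *m v = z ^+ k *: v, phi *m G = z ^+ k' *: phi
      & (phi *m H ^+ l.-1 *m v) 0 0 = 1].
  exists (col b (e k)), (c^-1 *: row a (e k')); split.
  - by rewrite !colE mulmxA Ge scalemxAl.
  - by rewrite -scalemxAl !rowE -mulmxA eG -scalemxAr !scalerA mulrC.
  rewrite -!scalemxAl mxE colE mulmxA -!row_mul -colE.
  by rewrite [X in _ * X]mxE [X in _ * X]mxE -/c mulVf.
have HjG j : H ^+ j *m G = q ^+ j *: (G *m H ^+ j).
  elim: j => [|j IHj]; first by rewrite !expr0 scale1r mul1mx mulmx1.
  rewrite {1}exprSr -mulmxE -mulmxA HG -scalemxAr (mulmxA _ G) IHj -scalemxAl scalerA.
  by rewrite -exprS -mulmxA mulmxE -exprSr.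
pose s j : K := (phi *m H ^+ j *m v) 0 0.
have s1 : s l.-1 = 1 by [].
have sE j : z ^+ k * s j = q ^+ j * z ^+ k' * s j.
  transitivity ((phi *m (H ^+ j *m G) *m v) 0 0).
    by rewrite -!mulmxA Gv -!scalemxAr mxE mulmxA.
  by rewrite HjG -scalemxAr mulmxA phiG -!scalemxAl scalerA mxE.
have zkk' : z ^+ k = q ^+ l.-1 * z ^+ k' by have := sE l.-1; rewrite s1 !mulr1.
have s0 j : j != l.-1 -> s j = 0.
  move=> ne_j; case: (ltnP j l) => [ltjl|lejl]; last first.
    by rewrite /s -(subnKC lejl) exprD Hl0 mul0r mulmx0 mul0mx mxE.
  apply/eqP; apply: contraNT ne_j => /mulIf /(_ _ _ (sE j)).
  rewrite zkk' => /(mulIf (expf_neq0 k' z0)) /eqP.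
  by rewrite (eq_prim_root_expr hq) !modn_small // ?(leq_trans _ le_ld) // 1?eq_sym // prednK.
exists l, k; split; rewrite ?l_gt0 ?le_ld //.
(* The columns are H^j v and the rows phi H^(l-1-j). The reversed exponent makes the entries of the
   product s (l-1-i+j), which is 1 exactly for i = j. *)
exists (\matrix_(x < N.+1, j < l) (H ^+ j *m v) x 0).
exists (\matrix_(j < l, x < N.+1) (phi *m H ^+ (l.-1 - j)) 0 x); split.
- apply/matrixP=> x j; rewrite mulmx_taft_ind_g mxE.
  under eq_bigr do rewrite [X in _ * X]mxE.
  transitivity ((G *m (H ^+ j *m v)) x 0); first by rewrite [RHS]mxE.
  rewrite mulmxA; have := HjG j => /(congr1 (fun X => q ^- j *: X)).
  rewrite scalerA mulVf ?expf_neq0 // scale1r => <-.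
  rewrite -scalemxAl -mulmxA Gv -scalemxAr scalerA !mxE mulrC.
  by rewrite [z ^+ _ * _]mulrC.
- rewrite (@mulmx_taft_ind_h _ _ (fun j x => (H ^+ j *m v) x 0)) => [|x]; last first.
    by rewrite Hl0 mul0mx mxE.
  apply/matrixP=> x j; rewrite [LHS]mxE [RHS]mxE exprS -mulmxE -mulmxA [RHS]mxE.
  by apply: eq_bigr => y _; rewrite [X in _ * X]mxE.
- apply/matrixP=> j x; rewrite taft_ind_g_mulmx mxE.
  under eq_bigr do rewrite mxE.
  transitivity ((phi *m H ^+ (l.-1 - j) *m G) 0 x); first by rewrite [RHS]mxE.
  rewrite -mulmxA HjG -scalemxAr mulmxA phiG -scalemxAl scalerA mxE [in RHS]mxE zkk'.
  congr (_ * _); rewrite mulrAC; congr (_ * _).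
  have lejl : (j <= l.-1)%N by rewrite -ltnS prednK.
  by rewrite -{2}(subnK lejl) exprD mulfK // expf_neq0.
- rewrite (@taft_ind_h_mulmx _ _ (fun j x => (phi *m H ^+ (l.-1 - j)) 0 x)).
  apply/matrixP=> j x; rewrite [RHS]mxE [LHS]mxE.
  transitivity ((phi *m (H ^+ (l.-1 - j) * H)) 0 x).
    rewrite -mulmxE mulmxA [RHS]mxE.
    by apply: eq_bigr => y _; rewrite [X in X * _]mxE.
  rewrite -exprSr.
  case: j => [[|j] ltj] /=; first by rewrite subn0 prednK // Hl0 mulmx0 mxE.
  by rewrite subnSK // -ltnS prednK.
- apply/matrixP=> i j; rewrite [LHS]mxE.
  transitivity (s (l.-1 - i + j)%N).
    rewrite /s exprD -mulmxE mulmxA -mulmxA [RHS]mxE.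
    by apply: eq_bigr => y _; rewrite mxE [X in _ * X]mxE.
  have lei : (i <= l.-1)%N by rewrite -ltnS prednK.
  rewrite mxE; case: eqP => [->|ne_ij]; first by rewrite subnK // -ltnS prednK.
  rewrite s0 //; apply/eqP=> eij; apply: ne_ij; apply/val_inj => /=.
  by apply/eqP; rewrite -(eqn_add2l (l.-1 - i)) eij subnK.
Qed.

End ChainModules.

Arguments taft_chain {K n d q omega} hdn hq homega l i hl.

(** * Tensor products with M(2,0) *)

Lemma sum_mxtens (V : nmodType) p r (F : 'I_(p * r) -> V) :
  \sum_t F t = \sum_(a < p) \sum_(b < r) F (mxtens_index (a, b)).
Proof.
rewrite pair_bigA (reindex (@mxtens_index p r)); first by apply: eq_bigr; case.
by exists (@mxtens_unindex p r) => ? _; rewrite ?mxtens_indexK ?mxtens_unindexK.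
Qed.

Lemma sum_succ (K : pzRingType) l (F : nat -> K) (b : 'I_l) :
  \sum_(b' < l) (b == b'.+1 :> nat)%:R * F b' = if (b : nat) is b'.+1 then F b' else 0.
Proof.
case: b => [[|b] ltb] /=; first by rewrite big1 // => c _; rewrite mul0r.
rewrite (bigD1 (Ordinal (ltnW ltb))) //= eqxx mul1r big1 ?addr0 // => c ne_c.
by rewrite -val_eqE /= in ne_c; rewrite eqSS eq_sym (negbTE ne_c) mul0r.
Qed.

Lemma sum_mul_eq (K : pzRingType) l (F : 'I_l -> K) (b : 'I_l) :
  \sum_b' F b' * (b' == b :> nat)%:R = F b.
Proof.
rewrite (bigD1 b) //= eqxx mulr1 big1 ?addr0 // => c ne_c.
by rewrite -val_eqE in ne_c; rewrite (negbTE ne_c) mulr0.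
Qed.

Section GreenChains.
Variables (R : comNzRingType) (K : fieldType) (n d : nat) (q omega : K).
Hypotheses (hd : (2 <= d)%N) (hdn : (d %| n)%N).
Hypotheses (hq : d.-primitive_root q) (homega : n.-primitive_root omega).
Hypothesis homegaq : omega ^+ (n %/ d) = q.

Local Notation A := (green R n hq).
Local Notation cl := (@green_class R K n d q hq).
Local Notation chain := (taft_chain hdn hq homega).
Local Notation m := (n %/ d)%N.

(** Strong induction on the dimension, splitting off one chain at a time. *)
Lemma green_chain_ind (P : A -> Prop) : P 0 -> (forall a b, P a -> P b -> P (a + b)) ->
  (forall c a, P a -> P (c *: a)) ->
  (forall l i hl, (0 < l)%N -> (i < n)%N -> P (cl (chain l i hl))) -> forall a, P a.
Proof.
move=> P0 PD PZ Pchain; apply: green_class_ind => // V.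
have [N] := ubnP (tdim V); elim: N V => // N IHN V ltVN.
case V0: (tdim V) => [|N']; first by rewrite green_class0.
case: V V0 ltVN => N1 G H rel /= eN; move: G H rel; rewrite eN => G H rel ltN.
have [l [i [/andP[l_gt0 le_ld] ltin [Q [S [gQ hQ Sg Sh SQ]]]]]] :=
  chain_summand hq homega rel.
have [W eW ->] := @green_class_split R K n d q hq (TaftMod rel) (chain l i le_ld)
  Q S gQ hQ Sg Sh SQ.
apply: PD; first exact: Pchain.
apply: IHN; rewrite -ltnS (leq_trans _ ltN) // ltnS -[X in (_ < X)%N]eW /=.
by rewrite -[X in (X < _)%N]addn0 ltn_add2l.
Qed.

Lemma chain_class_eq l i i' hl hl' : omega^-1 ^+ i = omega^-1 ^+ i' ->
  cl (chain l i hl) = cl (chain l i' hl').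
Proof.
move=> e; apply: green_class_iso.
apply: (@taft_iso_bij _ _ _ _ (chain l i hl) (chain l i' hl') id id) => // a b /=.
by rewrite !taft_ind_g_entry e.
Qed.

Lemma chain_class0 i hl : cl (chain 0 i hl) = 0.
Proof. exact: green_class0. Qed.

Lemma chain_class1 i hl : (n %| i)%N -> cl (chain 1 i hl) = 1.
Proof.
move=> /dvdnP[c ->]; rewrite -(green_class_triv R); apply: green_class_iso.
apply: (@taft_iso_bij _ _ _ _ (chain 1 _ hl) (taft_triv n hq) id id) => // a b /=; last by rewrite !mxE !ord1.
rewrite taft_ind_g_entry !ord1 expr0 invr1 mulr1 mulnC exprM.
by rewrite (prim_expr_order (prim_root_inv homega)) expr1n mxE.
Qed.

Lemma chain1_mul l i j h1 hl : cl (chain 1 j h1) * cl (chain l i hl) = cl (chain l (j + i) hl).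
Proof.
rewrite green_class_tens; apply: green_class_iso.
apply: (@taft_iso_bij _ _ _ _ (taft_tens hq (chain 1 j h1) (chain l i hl))
  (chain l (j + i) hl)
  (fun i => (mxtens_unindex i).2) (fun j => mxtens_index (ord0, j))).
- by move=> t; case: (mxtens_indexP t) => a b; rewrite mxtens_indexK /= (ord1 a).
- by move=> b; rewrite mxtens_indexK.
- move=> t u; case: (mxtens_indexP t) => a b; case: (mxtens_indexP u) => a' b'.
  rewrite !mxtens_indexK /= tensmxE !ord1 !taft_ind_g_entry eqxx expr0 invr1 mulr1n mulr1.
  by rewrite mulrnAr mulrA -exprD.
- move=> t u; case: (mxtens_indexP t) => a b; case: (mxtens_indexP u) => a' b'.
  rewrite !mxtens_indexK /= [LHS]mxE !tensmxE !ord1 [X in X * _]mxE [X in _ + X * _]mxE.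
  by rewrite mul1r mul0r addr0.
Qed.

Section Tensor2.
Variables (l i : nat) (h2 : (2 <= d)%N) (hl : (l <= d)%N).
Let T : taft_mod n d q := taft_tens hq (chain 2 0 h2) (chain l i hl).
Let c := omega^-1 ^+ i.

Definition tens2_mx l1 (f : nat -> nat -> nat -> K) : 'M[K]_(2 * l, l1) :=
  \matrix_(t, k) f k (mxtens_unindex t).1 (mxtens_unindex t).2.

(** Read f k a b as the coordinate of vector k on u_a v_b. The hypotheses say that only coordinates
    of weight omega^-i1 q^-k occur, that h sends vector k to vector k + 1 (the term 1 (x) h shifts
    b, while h (x) g sends u_0 v_b to c q^-b u_1 v_b), and that vector l1 is zero. *)
Lemma tens2_mxP l1 i1 (f : nat -> nat -> nat -> K) :
  (forall k a b, (a < 2)%N -> f k a b = 0 \/ q ^- (a + b) * c = omega^-1 ^+ i1 * q ^- k) ->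
  (forall k a b, (a < 2)%N -> (if b is b'.+1 then f k a b' else 0) +
     (if a is 0 then 0 else c * q ^- b * f k 0%N b) = f k.+1 a b) ->
  (forall a b, (a < 2)%N -> (b < l)%N -> f l1 a b = 0) ->
  tg T *m tens2_mx l1 f = tens2_mx l1 f *m taft_ind_g q omega l1 (- i1%:Z) /\
  th T *m tens2_mx l1 f = tens2_mx l1 f *m taft_ind_h K l1.
Proof.
move=> fw fh f0; split.
  apply/matrixP=> t k; case: (mxtens_indexP t) => a b.
  rewrite mulmx_taft_ind_g mxE sum_mxtens.
  rewrite (bigD1 a) //= [X in _ + X]big1 ?addr0 => [|a' ne_a]; last first.
    rewrite big1 // => b' _; rewrite tensmxE !taft_ind_g_entry eq_sym (negbTE ne_a).
    by rewrite !mul0r.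
  rewrite (bigD1 b) //= big1 ?addr0 => [|b' ne_b]; last first.
    rewrite tensmxE !taft_ind_g_entry [b == b']eq_sym (negbTE ne_b).
    by rewrite mulr0 mul0r.
  rewrite tensmxE !taft_ind_g_entry !eqxx !mulr1n expr0 mul1r !mxE mxtens_indexK /=.
  case: (fw k a b (ltn_ord a)) => [->|e]; first by rewrite mul0r mulr0.
  by rewrite -e mulrC exprD invfM -/c; ring.
rewrite (@mulmx_taft_ind_h _ _ _ (fun k t => f k (mxtens_unindex t).1 (mxtens_unindex t).2)).
  apply/matrixP=> t k; case: (mxtens_indexP t) => a b.
  rewrite [RHS]mxE mxtens_indexK /= -fh // mulmxDl [LHS]mxE; congr (_ + _).
    rewrite mxE sum_mxtens (bigD1 a) //= [X in _ + X]big1 ?addr0 => [|a' ne_a].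
      rewrite -(sum_succ (fun b => f k a b)); apply: eq_bigr => b' _.
      by rewrite tensmxE !mxE mxtens_indexK /= eqxx mul1r.
    rewrite big1 // => b' _; rewrite tensmxE mxE eq_sym (negbTE ne_a).
    by rewrite !mul0r.
  rewrite mxE sum_mxtens !big_ord_recl big_ord0 addr0 /=.
  rewrite [X in _ + X]big1 ?addr0 => [|b' _]; last first.
    by rewrite tensmxE mxE ltn_eqF ?mul0r.
  rewrite (bigD1 b) //= big1 ?addr0 => [|b' ne_b]; last first.
    rewrite tensmxE taft_ind_g_entry [b == b']eq_sym (negbTE ne_b).
    by rewrite mulr0 mul0r.
  rewrite tensmxE taft_ind_g_entry !mxE mxtens_indexK /= eqxx.
  by case: (a) => [[|[|a']] lta] //=; rewrite ?mul0r // mul1r.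
move=> t; exact: f0.
Qed.

(** The last hypothesis says that no nonzero row vector (U0, U1) annihilates all columns of both
    chains. As l1 + l2 = 2 l, the matrix formed by the two chains is square, hence invertible. *)
Lemma tens2_class l1 l2 i1 i2 h1 h2' (f1 f2 : nat -> nat -> nat -> K) :
  (l1 + l2 = 2 * l)%N ->
  tg T *m tens2_mx l1 f1 = tens2_mx l1 f1 *m taft_ind_g q omega l1 (- i1%:Z) /\
  th T *m tens2_mx l1 f1 = tens2_mx l1 f1 *m taft_ind_h K l1 ->
  tg T *m tens2_mx l2 f2 = tens2_mx l2 f2 *m taft_ind_g q omega l2 (- i2%:Z) /\
  th T *m tens2_mx l2 f2 = tens2_mx l2 f2 *m taft_ind_h K l2 ->
  (forall U0 U1 : 'I_l -> K,
     (forall k, (k < l1)%N -> \sum_b (U0 b * f1 k 0%N b + U1 b * f1 k 1%N b) = 0) ->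
     (forall k, (k < l2)%N -> \sum_b (U0 b * f2 k 0%N b + U1 b * f2 k 1%N b) = 0) ->
     forall b, U0 b = 0 /\ U1 b = 0) ->
  cl (chain 2 0 h2) * cl (chain l i hl) = cl (chain l1 i1 h1) + cl (chain l2 i2 h2').
Proof.
move=> dims [g1 e1] [g2 e2] inj; rewrite green_class_tens -green_class_sum.
apply/esym/green_class_iso.
have tdimT : tdim (taft_sum (chain l1 i1 h1) (chain l2 i2 h2')) = tdim T by [].
apply: (@taft_iso_square _ _ _ _ (taft_sum (chain l1 i1 h1) (chain l2 i2 h2')) T
  (row_mx (tens2_mx l1 f1) (tens2_mx l2 f2))) => //.
- have : row_free (row_mx (tens2_mx l1 f1) (tens2_mx l2 f2)).
    apply: inj_row_free => u; rewrite mul_mx_row => /eqP.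
    rewrite row_mx_eq0 => /andP[/eqP u1 /eqP u2].
    have uE l' f k : (k < l')%N -> u *m tens2_mx l' f = 0 ->
        \sum_b (u 0 (mxtens_index (ord0, b)) * f k 0%N b +
               u 0 (mxtens_index (ord_max, b)) * f k 1%N b) = 0.
      move=> ltk /rowP/(_ (Ordinal ltk)); rewrite !mxE sum_mxtens !big_ord_recl big_ord0 addr0.
      move=> e0; rewrite -[RHS]e0 big_split /=; congr (_ + _).
        by apply: eq_bigr => b _; rewrite mxE mxtens_indexK.
      apply: eq_bigr => b _; rewrite mxE mxtens_indexK /=; congr (u _ _ * _).
      by congr (mxtens_index (_, _)); apply/val_inj.
    have uv := inj _ _ (fun k hk => uE l1 f1 k hk u1) (fun k hk => uE l2 f2 k hk u2).
    apply/rowP=> t; case: (mxtens_indexP t) => a b; rewrite [RHS]mxE.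
    have [u0 u1'] := uv b; case: a => [[|[|a]] lta] //.
      by rewrite -[RHS]u0; congr (u _ (mxtens_index (_, _))); apply/val_inj.
    by rewrite -[RHS]u1'; congr (u _ (mxtens_index (_, _))); apply/val_inj.
  by rewrite /row_free /row_full => /eqP ->; apply/eqP/esym.
- by rewrite /= mul_row_block !mulmx0 addr0 add0r mul_mx_row -g1 -g2.
- by rewrite /= mul_row_block !mulmx0 addr0 add0r mul_mx_row -e1 -e2.
Qed.

(** c times the q-integer of k at q^-1; it is the coefficient of u_1 v_(k-1) in h^k (u_0 v_0). *)
Definition qsum k : K := \sum_(j < k) c * q ^- j.

(** By (q^-1 - 1) [qsum k] = c (q^-k - 1). The zero at k = d is what distinguishes the product with
    a chain of length l = d: there h^l kills u_0 v_0, whereas for 0 < l < d it does not. *)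
Lemma qsum_eq0 k : (0 < k)%N -> (qsum k == 0) = (d %| k)%N.
Proof.
move=> k_gt0.
have c0 : c != 0 by rewrite expf_neq0 // (prim_root_neq0 (prim_root_inv homega)).
have hq' := prim_root_inv hq.
have q1 : q^-1 - 1 != 0.
  rewrite subr_eq0 -[q^-1]expr1 -(prim_order_dvd hq').
  by apply/negP=> /(dvdn_leq (ltn0Sn 0)); rewrite leqNgt hd.
rewrite (prim_order_dvd hq') -[RHS]subr_eq0 subrX1 mulf_eq0 (negbTE q1) /=.
rewrite /qsum -mulr_sumr mulf_eq0 (negbTE c0) /=.
by under eq_bigr do rewrite -exprVn.
Qed.

(* With u_0, u_1 the basis of M(2,0) and v_b that of the second factor, these are
   the coordinates on u_a v_b of h^k x for x = u_0 v_0, for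
   x = u_0 v_1 + (qsum 1 - qsum l) u_1 v_0, whose coefficient makes h^(l-1) x = 0,
   and for x = u_1 v_0. *)
Definition top_chain (k a b : nat) : K :=
  if a is 0 then (b == k)%:R else qsum k * (b.+1 == k)%:R.

Definition low_chain (k a b : nat) : K :=
  if a is 0 then (b == k.+1)%:R else (qsum k.+1 - qsum l) * (b == k)%:R.

Definition right_chain (k a b : nat) : K :=
  if a is 0 then 0 else (b == k)%:R.

Lemma top_chainS k a b : (a < 2)%N ->
  (if b is b'.+1 then top_chain k a b' else 0) +
  (if a is 0 then 0 else c * q ^- b * top_chain k 0 b) = top_chain k.+1 a b.
Proof.
case: a => [|[|a]] // _; rewrite /top_chain.
  by case: b => [|b]; rewrite addr0.
rewrite eqSS /qsum big_ord_recr /= -/(qsum k) mulrDl.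
case: eqP => [->|ne]; last first.
  case: b ne => [|b] ne; rewrite !mulr0 ?addr0 //; case: eqP => // e; exact: mulr0.
case: k => [|k]; first by rewrite /qsum big_ord0 mul0r.
by rewrite eqxx.
Qed.

Lemma low_chainS k a b : (a < 2)%N ->
  (if b is b'.+1 then low_chain k a b' else 0) +
  (if a is 0 then 0 else c * q ^- b * low_chain k 0 b) = low_chain k.+1 a b.
Proof.
case: a => [|[|a]] // _; rewrite /low_chain.
  by case: b => [|b]; rewrite addr0.
case: b => [|b]; first by rewrite !mulr0 addr0.
rewrite eqSS [in RHS]/qsum big_ord_recr /= -/(qsum k.+1).
by case: eqP => [->|_]; rewrite ?mulr0 ?addr0 // !mulr1 addrAC.
Qed.

Lemma right_chainS k a b : (a < 2)%N ->
  (if b is b'.+1 then right_chain k a b' else 0) +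
  (if a is 0 then 0 else c * q ^- b * right_chain k 0 b) = right_chain k.+1 a b.
Proof.
by case: a => [|[|a]] // _; rewrite /right_chain; case: b => [|b];
  rewrite ?mulr0 addr0.
Qed.

End Tensor2.

(** The summands are generated by u_0 v_0 and by a correction of u_0 v_1. The latter has weight
    omega^-i q^-1 = omega^-(i+m), whence the shift by m. *)
Lemma chain2_mul l i h2 hl hl1 hl2 : (0 < l < d)%N ->
  cl (chain 2 0 h2) * cl (chain l i hl) =
  cl (chain l.+1 i hl1) + cl (chain l.-1 (i + m) hl2).
Proof.
case/andP=> l_gt0 ltld.
have wt : omega^-1 ^+ (i + m) = omega^-1 ^+ i * q^-1.
  by rewrite exprD [X in _ * X]exprVn homegaq.
have lemaxl : (l <= d)%N := ltnW ltld.
apply: (@tens2_class l i h2 hl l.+1 l.-1 i (i + m) hl1 hl2 (top_chain i) (low_chain l i)).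
- by rewrite addSn -addnS prednK // mul2n addnn.
- apply: tens2_mxP.
  + move=> k [|[|a]] // b _; rewrite /top_chain; case: eqP => [<-|_];
      rewrite ?mulr0; [right|left|right|left] => //; exact: mulrC.
  + by move=> *; exact: top_chainS.
  + move=> [|[|a]] // b _ ltb; rewrite /top_chain; first by rewrite ltn_eqF // ltnW.
    by rewrite eqSS ltn_eqF ?mulr0.
- apply: tens2_mxP.
  + move=> k [|[|a]] // b _; rewrite /low_chain; case: eqP => [->|_];
      rewrite ?mulr0; [right|left|right|left] => //;
      by rewrite wt ?add0n ?add1n exprS invfM mulrC mulrA.
  + by move=> *; exact: low_chainS.
  + move=> [|[|a]] // b _ ltb; rewrite /low_chain prednK //; first by rewrite ltn_eqF.
    by rewrite subrr mul0r.
move=> U0 U1 e1 e2.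
have Sl0 : qsum i l != 0 by rewrite qsum_eq0 // gtnNdvd.
(* Vector b + 1 of the top chain minus vector b of the low chain is [qsum i l] u_1 v_b, and this
   coefficient is nonzero as 0 < l < d. For b = l - 1 the top vector alone has this form. *)
have U10 b : U1 b = 0.
  have e0 : qsum i l * U1 b = 0; last first.
    by move/eqP: e0; rewrite mulf_eq0 (negbTE Sl0) => /eqP.
  have := e1 b.+1 (ltn_ord b); rewrite big_split /=.
  under [X in _ + X]eq_bigr do rewrite eqSS mulrA.
  rewrite sum_mul_eq.
  have [ltb|geb] := ltnP b l.-1; last first.
    have eb : b.+1 = l by apply/eqP; rewrite eqn_leq ltn_ord; move: geb; rewrite -ltnS prednK.
    rewrite big1 ?add0r ?eb => [|b' _]; first by rewrite mulrC.
    by rewrite ltn_eqF ?mulr0.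
  have := e2 b ltb; rewrite big_split /=.
  under [X in _ + X]eq_bigr do rewrite mulrA.
  rewrite sum_mul_eq => h1 /eqP; rewrite -h1 => /eqP h.
  have : \sum_(b0 < l) U0 b0 * (b0 == b.+1 :> nat)%:R = - (U1 b * (qsum i b.+1 - qsum i l)).
    by apply/eqP; rewrite -addr_eq0 h1.
  move=> e3; move: h; rewrite h1 e3 mulrBr opprB => /eqP.
  by rewrite subrK mulrC => /eqP.
move=> b; split=> //.
have := e1 b (ltnW (ltn_ord b)); rewrite big_split /= sum_mul_eq big1 ?addr0 // => b' _.
by rewrite U10 mul0r.
Qed.

(** Since [qsum i d] = 0, the chain of u_0 v_0 stops at length d, and u_1 v_0 generates a
    complementary chain of length d. Its weight omega^-i q^-1 again shifts the exponent by m. *)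
Lemma chain2_mul_max i h2 hl hl1 hl2 :
  cl (chain 2 0 h2) * cl (chain d i hl) = cl (chain d i hl1) + cl (chain d (i + m) hl2).
Proof.
have wt : omega^-1 ^+ (i + m) = omega^-1 ^+ i * q^-1.
  by rewrite exprD [X in _ * X]exprVn homegaq.
have d_gt0 := prim_order_gt0 hq.
apply: (@tens2_class d i h2 hl d d i (i + m) hl1 hl2 (top_chain i) right_chain).
- by rewrite mul2n addnn.
- apply: tens2_mxP.
  + move=> k [|[|a]] // b _; rewrite /top_chain; case: eqP => [<-|_];
      rewrite ?mulr0; [right|left|right|left] => //; exact: mulrC.
  + by move=> *; exact: top_chainS.
  + move=> [|[|a]] // b _ ltb; rewrite /top_chain; first by rewrite ltn_eqF.
    by have /eqP -> : qsum i d == 0; rewrite ?mul0r // qsum_eq0.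
- apply: tens2_mxP.
  + move=> k [|[|a]] // b _; rewrite /right_chain; first by left.
    case: eqP => [->|_]; [right|left] => //.
    by rewrite wt exprS invfM mulrC mulrA.
  + by move=> *; exact: right_chainS.
  + by move=> [|[|a]] // b _ ltb; rewrite /right_chain // ltn_eqF.
move=> U0 U1 e1 e2.
have U10 b : U1 b = 0.
  have := e2 b (ltn_ord b); rewrite big_split /= sum_mul_eq big1 ?add0r // => b' _.
  exact: mulr0.
move=> b; split=> //.
have := e1 b (ltn_ord b); rewrite big_split /= sum_mul_eq big1 ?addr0 // => b' _.
by rewrite U10 mul0r.
Qed.

End GreenChains.

(** * Presentation and basis of the Green algebra *)

(** The polynomials F_s(y, z), which are Dickson polynomials of the second kind, as a function on
    any ring: they are evaluated in the Green algebra, in polynomial rings and at complex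
    numbers. *)
Fixpoint dickson (B : pzRingType) (y z : B) (s : nat) : B :=
  match s with
  | 0 => 0
  | s1.+1 => match s1 with 0 => 1 | s2.+1 => z * dickson y z s1 - y * dickson y z s2 end
  end.

Lemma dickson_comm (B : pzRingType) (y z b : B) s :
  GRing.comm b y -> GRing.comm b z -> GRing.comm b (dickson y z s).
Proof.
(* The recursion has depth two, so the induction carries two consecutive terms. *)
move=> hy hz; suff: GRing.comm b (dickson y z s) /\ GRing.comm b (dickson y z s.+1) by case.
elim: s => [|s [IH1 IH2]]; first by split; [exact: commr0 | exact: commr1].
by split=> //=; apply: commrB; apply: commrM.
Qed.

Section GreenAlgebra.
Variables (R : comNzRingType) (K : fieldType) (n d : nat) (q omega : K).
Hypotheses (hd : (2 <= d)%N) (hdn : (d %| n)%N).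
Hypotheses (hq : d.-primitive_root q) (homega : n.-primitive_root omega).
Hypothesis homegaq : omega ^+ (n %/ d) = q.

Local Notation A := (green R n hq).
Local Notation cl := (@green_class R K n d q hq).
Local Notation chain := (taft_chain hdn hq homega).
Local Notation m := (n %/ d)%N.
Local Notation y := (green_y hd hdn hq homega R).
Local Notation z := (green_z hd hdn hq homega R).
Local Notation F := (dickson (y ^+ m) z).

Lemma green_yE h1 : y = cl (chain 1 1 h1).
Proof. by congr green_class; exact: (taft_ind_chain hdn hq homega 1). Qed.

Lemma green_zE : z = cl (chain 2 0 hd).
Proof. by congr green_class; exact: (taft_ind_chain hdn hq homega 0). Qed.

Let d_gt0 : (0 < d)%N := ltnW hd.

Lemma green_yX i : y ^+ i = cl (chain 1 i d_gt0).
Proof.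
elim: i => [|i IHi]; first by rewrite expr0 chain_class1.
by rewrite exprS IHi (green_yE d_gt0) chain1_mul.
Qed.

Lemma green_yn : y ^+ n = 1.
Proof. by rewrite green_yX chain_class1. Qed.

Lemma green_yz : y * z = z * y.
Proof.
rewrite (green_yE d_gt0) green_zE chain1_mul.
by rewrite (chain2_mul R hd hdn hq homega homegaq 1 hd d_gt0 hd (leq0n d)) // chain_class0 addr0.
Qed.

(** Multiplication by y^i only shifts the weight, and for weight 0 the product with M(2,0) is the
    recursion of F. *)
Lemma chain_class l i hl : cl (chain l i hl) = y ^+ i * F l.
Proof.
have yi l' j h : cl (chain l' j h) = y ^+ j * cl (chain l' 0 h).
  by rewrite green_yX chain1_mul; apply: chain_class_eq; rewrite addn0.
rewrite yi; congr (_ * _).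
have [M] := ubnP l; elim: M l hl => // M IHM [|[|l]] hl ltlM.
- by rewrite chain_class0.
- by rewrite chain_class1.
have lel1 : (l.+1 <= d)%N by exact: ltnW.
have lel0 : (l <= d)%N by exact: ltnW.
have := chain2_mul R hd hdn hq homega homegaq 0 hd lel1 hl lel0 hl.
rewrite -green_zE /= (yi l) => h.
rewrite -[LHS](addrK (y ^+ m * cl (chain l 0 lel0))) -h !IHM //; exact: ltnW.
Qed.

Lemma green_rel : z * F d = F d + y ^+ m * F d.
Proof.
have := chain2_mul_max R hd hdn hq homega homegaq 0 hd (leqnn d) (leqnn d) (leqnn d).
by rewrite -green_zE !chain_class expr0 !mul1r.
Qed.

Lemma green_span_ind (P : A -> Prop) : P 0 -> (forall a b, P a -> P b -> P (a + b)) ->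
  (forall c a, P a -> P (c *: a)) ->
  (forall i l, (i < n)%N -> (l < d)%N -> P (y ^+ i * F l.+1)) -> forall a, P a.
Proof.
move=> P0 PD PZ PF; apply: (@green_chain_ind _ _ _ _ _ _ hdn hq homega) => // -[|l] i hl // _ ltin.
by rewrite chain_class; exact: PF.
Qed.

(** The Taft algebra is not cocommutative, so the flip of tensor factors is not a module map.
    Commutativity is instead read off the spanning elements y^i F_l, once y and z are known to
    commute. *)
Lemma green_mulC (a b : A) : a * b = b * a.
Proof.
have comm_all c : GRing.comm c y -> GRing.comm c z -> forall a, GRing.comm c a.
  move=> cy cz; apply: green_span_ind => [|u v cu cv|k u cu|i l _ _].
  - exact: commr0.
  - exact: commrD.
  - by rewrite /GRing.comm -scalerAl -scalerAr cu.
  - apply: commrM; first exact: commrX.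
    by apply: dickson_comm => //; exact: commrX.
by apply: (comm_all _); apply/commr_sym; apply: (comm_all _) => //; rewrite /GRing.comm ?green_yz.
Qed.

End GreenAlgebra.

(** * Rank functionals and linear independence *)

Section RankFunctionals.
Variables (K : fieldType) (n d : nat) (q omega : K).
Hypothesis hdn : (d %| n)%N.
Hypotheses (hq : d.-primitive_root q) (homega : n.-primitive_root omega).
Hypothesis homegaq : omega ^+ (n %/ d) = q.

Local Notation tmod := (taft_mod n d q).
Local Notation chain := (taft_chain hdn hq homega).
Local Notation m := (n %/ d)%N.
Let zeta := omega^-1.
Let hz : n.-primitive_root zeta := prim_root_inv homega.

(* h^j composed with the projection onto the zeta^i-eigenspace of g. *)
Definition rank_mx N (G H : 'M[K]_N) j i : 'M[K]_N :=
  H ^+ j *m (n%:R^-1 *: \sum_(k < n) (zeta ^- i *: G) ^+ k).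

Definition taft_rank (j i : nat) (V : tmod) : nat := \rank (rank_mx (tg V) (th V) j i).

Lemma taft_rank_iso j i V W : taft_iso V W -> taft_rank j i V = taft_rank j i W.
Proof.
case=> P [P' [PP' P'P Pg Ph]].
have PX k (X : 'M_(tdim V)) (Y : 'M_(tdim W)) : P *m X = Y *m P -> P *m X ^+ k = Y ^+ k *m P.
  move=> e; elim: k => [|k IHk]; first by rewrite !expr0 mulmx1 mul1mx.
  by rewrite !exprS -!mulmxE mulmxA e -!mulmxA IHk.
have Prk : P *m rank_mx (tg V) (th V) j i = rank_mx (tg W) (th W) j i *m P.
  rewrite /rank_mx mulmxA (PX _ _ _ Ph) -!mulmxA; congr (_ *m _).
  rewrite -scalemxAr -scalemxAl mulmx_sumr mulmx_suml; congr (_ *: _).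
  by apply: eq_bigr => k _; apply: PX; rewrite -scalemxAr -scalemxAl Pg.
have e1 : rank_mx (tg V) (th V) j i = P' *m rank_mx (tg W) (th W) j i *m P.
  by rewrite -mulmxA -Prk mulmxA P'P mul1mx.
have e2 : rank_mx (tg W) (th W) j i = P *m rank_mx (tg V) (th V) j i *m P'.
  by rewrite Prk -mulmxA PP' mulmx1.
apply/eqP; rewrite eqn_leq; apply/andP; split.
  by rewrite /taft_rank e1 (leq_trans (mxrankM_maxl _ _)) // mxrankM_maxr.
by rewrite /taft_rank e2 (leq_trans (mxrankM_maxl _ _)) // mxrankM_maxr.
Qed.

Lemma taft_rank_sum j i V W :
  taft_rank j i (taft_sum V W) = (taft_rank j i V + taft_rank j i W)%N.
Proof.
rewrite /taft_rank -rank_diag_block_mx; congr mxrank.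
rewrite /rank_mx /= block_diagX.
under eq_bigr do rewrite scale_block_mx !scaler0 block_diagX.
have -> : \sum_(k < n) block_mx ((zeta ^- i *: tg V) ^+ k) 0 0 ((zeta ^- i *: tg W) ^+ k)
   = block_mx (\sum_(k < n) (zeta ^- i *: tg V) ^+ k) 0 0
       (\sum_(k < n) (zeta ^- i *: tg W) ^+ k).
  elim/big_rec3: _ => [|k A B C _ ->]; first by rewrite block_mx0.
  by rewrite add_block_mx !addr0.
by rewrite scale_block_mx !scaler0 mulmx_block !(mulmx0, mul0mx, addr0, add0r).
Qed.

(** The basis vector v_b has weight zeta^(i' + m b) and survives h^j exactly when b + j < l. The
    weights along a chain are distinct because l <= d, so the matrix is zero or an elementary
    matrix. *)
Lemma taft_rank_chain j i l i' hl :
  taft_rank j i (chain l i' hl) =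
  (\sum_(b < l) ((b + j < l) && (zeta ^+ (i' + m * b) == zeta ^+ i)))%N.
Proof.
have z0 : zeta != 0 := prim_root_neq0 hz.
have zm b : zeta ^+ (i' + m * b) = zeta ^+ i' * q ^- b.
  by rewrite exprD exprM [zeta ^+ m]exprVn homegaq exprVn.
pose G := taft_ind_g q omega l (- i'%:Z).
have GE : (n%:R^-1 *: \sum_(k < n) (zeta ^- i *: G) ^+ k) =
    \matrix_(a, b) ((a == b) && (zeta ^+ (i' + m * b) == zeta ^+ i))%:R.
  apply/matrixP=> a b; rewrite !mxE summxE.
  have GX k : (zeta ^- i *: G) ^+ k =
      \matrix_(a, b) ((zeta ^- i * (zeta ^+ i' * q ^- b)) ^+ k *+ (a == b)).
    elim: k => [|k IHk]; first by rewrite expr0; apply/matrixP=> a' b'; rewrite !mxE.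
    apply/matrixP=> a' b'; rewrite exprSr -mulmxE IHk -scalemxAr mxE mulmx_taft_ind_g.
    by rewrite !mxE mulrnAl mulrnAr exprSr mulrCA.
  under eq_bigr do rewrite GX mxE.
  case: eqVneq => [ab|_] /=; last by rewrite big1 ?mulr0 // => k _; rewrite mulr0n.
  have wi : zeta ^+ (n - i %% n) * zeta ^+ i = 1.
    rewrite -(prim_expr_mod hz i) -exprD subnK ?(prim_expr_order hz) //.
    by rewrite ltnW // ltn_pmod // (prim_order_gt0 hz).
  have -> : zeta ^- i * (zeta ^+ i' * q ^- b) = zeta ^+ (i' + m * b + (n - (i %% n))).
    rewrite exprD zm mulrC; congr (_ * _).
    by apply/(mulIf (expf_neq0 i z0)); rewrite mulVf ?expf_neq0.
  rewrite (prim_root_sum hz) mulrC mulfK ?(prim_root_natf_neq0 hz) //; congr (_%:R).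
  rewrite (prim_order_dvd hz) -(inj_eq (mulIf (expf_neq0 i z0))) exprD -mulrA wi.
  by rewrite mulr1 mul1r.
rewrite /taft_rank /rank_mx /= GE taft_ind_hX.
pose cond (b : 'I_l) := (b + j < l)%N && (zeta ^+ (i' + m * b) == zeta ^+ i).
have [b0 cb0|noc] := pickP cond; last first.
  rewrite big1 => [|b _]; last by have := noc b; rewrite /cond => ->.
  apply/eqP; rewrite mxrank_eq0; apply/eqP/matrixP=> a b; rewrite !mxE.
  apply: big1 => c _; rewrite !mxE.
  case: eqP => [ac|]; last by rewrite mul0r.
  case: eqP => [ec|]; last by rewrite mulr0.
  have := noc b; rewrite /cond -ec -ac ltn_ord /= => ->; exact: mulr0.
have uniq_b b : cond b -> b = b0.
  case/andP=> _ /eqP eb; case/andP: cb0 => _ /eqP; rewrite -eb !zm.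
  move/(mulfI (expf_neq0 i' z0))/invr_inj/eqP.
  rewrite (eq_prim_root_expr hq) !modn_small ?(leq_trans (ltn_ord _)) // => /eqP eb0.
  by apply/val_inj; rewrite /= eb0.
have /andP[ltb0 eb0] := cb0.
rewrite (bigD1 b0) //= ltb0 eb0 big1 ?addn0 => [|b ne_b]; last first.
  by case: (boolP (cond b)) => [/uniq_b e|/negbTE]; [rewrite e eqxx in ne_b | rewrite /cond => ->].
rewrite (_ : _ *m _ = delta_mx (Ordinal ltb0) b0) ?mxrank_delta //.
apply/matrixP=> a b; rewrite !mxE (bigD1 b) //= big1 ?addr0 => [|c ne_c].
  rewrite !mxE eqxx /= -natrM mulnb; congr (nat_of_bool _)%:R.
  have [->|ne_b] := eqVneq b b0; first by rewrite eb0 !andbT. 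
  rewrite andbF; apply/negP=> /andP[/eqP eab eb]; case/eqP: ne_b.
  by apply: uniq_b; rewrite /cond -eab ltn_ord.
by rewrite !mxE (negbTE ne_c) mulr0.
Qed.

(* The difference of the two ranks detects the chains whose generator has weight
   zeta^(i+m) and whose length exceeds j. *)
Lemma taft_rankS j i l i' hl :
  taft_rank j (i + m) (chain l i' hl) =
  (((j < l) && (zeta ^+ i' == zeta ^+ (i + m))) + taft_rank j.+1 i (chain l i' hl))%N.
Proof.
rewrite !taft_rank_chain; case: l hl => [|l] hl; first by rewrite !big_ord0.
rewrite big_ord_recl add0n muln0 addn0; congr (_ + _)%N.
rewrite [RHS]big_ord_recr /= [X in (_ + nat_of_bool (X && _))%N](_ : _ = false) ?addn0; last first.
  by rewrite addnS ltnS ltnNge leq_addr.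
apply: eq_bigr => b _; rewrite addnS ltnS addSn; congr (nat_of_bool (_ && _)).
rewrite /bump /= add1n mulnS addnA (addnC i') -addnA (addnC i m) !exprD.
by rewrite (inj_eq (mulfI _)) // expf_neq0 // (prim_root_neq0 hz).
Qed.

End RankFunctionals.

(** The universal property of the quotient: every additive isomorphism invariant extends to a linear
    functional, which can then separate elements. *)
Lemma green_lift (R : comNzRingType) (K : fieldType) (n d : nat) (q : K)
    (hq : d.-primitive_root q) (phi : taft_mod n d q -> R) :
  (forall V W, taft_iso V W -> phi V = phi W) ->
  (forall V W, phi (taft_sum V W) = phi V + phi W) ->
  exists f : green R n hq -> R, [/\ f 0 = 0, forall a b, f (a + b) = f a + f b,
    forall c a, f (c *: a) = c * f a & forall V, f (green_class R hq V) = phi V].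
Proof.
move=> phi_iso phi_sum; pose g := fglift (phi : _ -> R^o).
have g0 x : x \in @green_ker R K n d q -> g x = 0.
  move=> hx; elim/green_ker_ind: x / hx.
    split; first exact: linear0.
      by move=> x y hx hy; rewrite /g linearD /= -/(g x) -/(g y) hx hy addr0.
    by move=> c x hx; rewrite /g linearZ /= -/(g x) hx scaler0.
  move=> _ [V W /phi_iso eVW|V W].
    by rewrite /g linearB /= !fgliftU eVW subrr.
  by rewrite /g linearB linearD /= !fgliftU phi_sum subrr.
have gE (x y : {freeg (taft_mod n d q) / R}) : x - y \in @green_ker R K n d q -> g x = g y.
  by move/g0 => /eqP; rewrite /g linearB /= subr_eq0 => /eqP.
exists (fun a => g (repr a)); split.
- by apply: g0; rewrite -[repr _]subr0 -(raddf0 \pi_(Quotient.quot (@green_ker R K n d q))%qT) (green_repr_pi hq).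
- move=> a b; rewrite -[RHS](linearD g); apply: gE.
  by apply/(green_piP hq); rewrite green_piD !green_piK.
- move=> c a; transitivity (g (c *: repr a)); last by rewrite /g linearZ.
  apply: gE.
  by apply/(green_piP hq); rewrite -green_scaleE !green_piK.
- move=> V; rewrite -(fgliftU (phi : _ -> R^o) V); apply: gE; exact: green_repr_pi.
Qed.

Section GreenFree.
Variables (R : comNzRingType) (K : fieldType) (n d : nat) (q omega : K).
Hypotheses (hd : (2 <= d)%N) (hdn : (d %| n)%N).
Hypotheses (hq : d.-primitive_root q) (homega : n.-primitive_root omega).
Hypothesis homegaq : omega ^+ (n %/ d) = q.

Local Notation y := (green_y hd hdn hq homega R).
Local Notation z := (green_z hd hdn hq homega R).
Local Notation m := (n %/ d)%N.

(** The rank of h^j at weight i minus the rank of h^(j+1) at weight i - m is 1 on y^i F_(l+1) if j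
    <= l, and 0 on all other basis elements. Hence all tail sums of c i vanish, and c i l is the
    difference of two consecutive tails. *)
Lemma green_free (c : 'I_n -> 'I_d -> R) :
  \sum_i \sum_l c i l *: (y ^+ i * dickson (y ^+ m) z l.+1) = 0 ->
  forall i l, c i l = 0.
Proof.
move=> c0; have hz := prim_root_inv homega.
have n_gt0 := prim_order_gt0 hz.
pose zeta := omega^-1.
have D0 (j : nat) (i : 'I_n) : \sum_(l : 'I_d | (j <= l)%N) c i l = 0.
  (* A natural number congruent to i - m modulo n. *)
  pose k := (i + (n - m))%N.
  have km : zeta ^+ (k + m) = zeta ^+ i.
    by rewrite /k -addnA subnK ?leq_div // exprD (prim_expr_order hz) mulr1.
  pose phi (V : taft_mod n d q) : R := (taft_rank omega j (k + m) V)%:R - (taft_rank omega j.+1 k V)%:R.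
  have [V W h|V W|f [f0 fD fZ fcl]] := @green_lift R K n d q hq phi.
  - by rewrite /phi !(taft_rank_iso omega _ _ h).
  - by rewrite /phi !taft_rank_sum !natrD opprD addrACA.
  have fsum (I : finType) (P : pred I) (F : I -> green R n hq) :
      f (\sum_(i | P i) F i) = \sum_(i | P i) f (F i) by exact: big_morph.
  move/(congr1 f): c0; rewrite f0 fsum (bigD1 i) //= [X in _ + X]big1 ?addr0.
    rewrite fsum => e; rewrite big_mkcond -[RHS]e; apply: eq_bigr => l _.
    rewrite fZ -(chain_class R hd hdn hq homega homegaq i (ltn_ord l)) fcl /phi.
    rewrite taft_rankS // natrD addrK km eqxx andbT ltnS.
    by case: ifP => _; rewrite ?mulr1 ?mulr0.
  move=> i' ne_i; rewrite fsum big1 // => l _.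
  rewrite fZ -(chain_class R hd hdn hq homega homegaq i' (ltn_ord l)) fcl /phi.
  rewrite taft_rankS // natrD addrK km (eq_prim_root_expr hz) !modn_small //.
  by rewrite -val_eqE in ne_i; rewrite (negbTE ne_i) andbF mulr0.
move=> i l; have := D0 l i; rewrite (bigD1 l) //=.
rewrite (eq_bigl (fun l' : 'I_d => l < l')%N) ?D0 ?addr0 // => l'.
by rewrite ltn_neqAle eq_sym andbC.
Qed.

End GreenFree.

(** * Modules and blocks of a sum of local algebras *)

Section Submodule.
Variables (A : nzRingType) (V : lmodType A) (S : V -> Prop).
Hypotheses (S0 : S 0) (SD : forall u v, S u -> S v -> S (u + v)).
Hypothesis SZ : forall a v, S v -> S (a *: v).

Definition submodule_pred : {pred V} := fun v => `[< S v >].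

Lemma submodule_pred_closed : submod_closed submodule_pred.
Proof.
split; first exact/asboolP.
by move=> a u v /asboolP Su /asboolP Sv; apply/asboolP/SD => //; exact: SZ.
Qed.

HB.instance Definition _ := GRing.isSubmodClosed.Build A V submodule_pred
  submodule_pred_closed.

Definition submodule := {v : V | v \in submodule_pred}.
HB.instance Definition _ := SubChoice.on submodule.
HB.instance Definition _ := [SubChoice_isSubLmodule of submodule by <:].

(** [indecomposable] quantifies over module types, so a summand given as a predicate has to be
    realized as a type; its embedding is all that is needed later. *)
Lemma submodule_exists : exists (U : lmodType A) (i : {linear U -> V}),
  injective i /\ forall v, S v <-> exists u, i u = v.
Proof.
exists submodule, (val : {linear submodule -> V}); split; first exact: val_inj.
move=> v; split=> [/asboolP Sv|[u <-]]; first by exists (exist _ v Sv).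
exact/asboolP/(valP u).
Qed.

End Submodule.

Section LinearMaps.
Variable A : nzRingType.

Lemma linear_exists (U V : lmodType A) (f : U -> V) : linear f ->
  exists g : {linear U -> V}, g =1 f.
Proof.
move=> hf; pose H := GRing.isLinear.Build A U V *:%R f hf.
by exists (HB.pack_for {linear U -> V} f H).
Qed.

Lemma mod_iso_bij (U V : lmodType A) (f : {linear U -> V}) : bijective f ->
  exists2 g : {linear V -> U}, cancel f g & cancel g f.
Proof.
case=> g fK gK; have [g' g'E] := linear_exists (can2_linear fK gK).
by exists g' => x; rewrite g'E.
Qed.

End LinearMaps.

Section Bases.
Variables (F : fieldType) (A : algType F).

Lemma mod_iso_sym (V W : lmodType A) : mod_iso V W -> mod_iso W V.
Proof. by case=> f /mod_iso_bij[g fK gK]; exists g; exists f. Qed.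

Lemma alg_scaleC (V : lmodType A) (c : F) (a : A) (v : V) :
  c%:A *: (a *: v) = a *: (c%:A *: v).
Proof. by rewrite !scalerA mulr_algl mulr_algr. Qed.

Lemma alg_scaleM (V : lmodType A) (a b : F) (v : V) :
  (a * b)%:A *: v = a%:A *: (b%:A *: v).
Proof. by rewrite scalerA mulr_algl scalerA. Qed.

Lemma alg_scaleA (V : lmodType A) (c : F) (a : A) (v : V) :
  (c *: a) *: v = c%:A *: (a *: v).
Proof. by rewrite scalerA mulr_algl. Qed.

(** V is the direct sum of the image and the kernel of pi, and one of them must vanish. Apart from V
    <> 0, this is how indecomposability is exploited below. *)
Lemma idempotent_indecomposable (V : lmodType A) (pi : {linear V -> V}) :
  indecomposable V -> (forall v, pi (pi v) = pi v) ->
  (forall v, pi v = 0) \/ (forall v, pi v = v).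
Proof.
case=> _ indV pipi.
have [||a v h|U [iU [iU_inj hU]]] := @submodule_exists A V (fun v => pi v = v).
- exact: linear0.
- by move=> u v hu hv; rewrite linearD hu hv.
- by rewrite linearZ /= h.
have [||a v h|W [iW [iW_inj hW]]] := @submodule_exists A V (fun v => pi v = 0).
- exact: linear0.
- by move=> u v hu hv; rewrite linearD hu hv addr0.
- by rewrite linearZ /= h scaler0.
have piU u : pi (iU u) = iU u by apply/hU; exists u.
have piW w : pi (iW w) = 0 by apply/hW; exists w.
have [g gE] : exists g : {linear (U * W)%type -> V}, forall p, g p = iU p.1 + iW p.2.
  apply: (linear_exists (f := fun p : U * W => iU p.1 + iW p.2)) => a p r /=.
  by rewrite !linearP scalerDr addrACA.
have g_inj : injective g.
  move=> p r epr; apply/eqP; rewrite -subr_eq0; apply/eqP.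
  have : g (p - r) = 0 by rewrite linearB /= epr subrr.
  case: (p - r) => u w; rewrite gE /= => e.
  have /eqP := congr1 pi e; rewrite linearD /= piU piW linear0 addr0 => /eqP u0.
  move: e; rewrite u0 add0r => w0.
  by congr pair; [apply: iU_inj | apply: iW_inj]; rewrite ?u0 ?w0 linear0.
have g_surj v : exists p, g p = v.
  have [u hu] := (hU (pi v)).1 (pipi v).
  have [|w hw] := (hW (v - pi v)).1; first by rewrite linearB /= pipi subrr.
  by exists (u, w); rewrite gE /= hu hw addrC subrK.
have [g' g'K] := choice g_surj.
have bij_g : bijective g by exists g' => // p; apply: g_inj; rewrite g'K.
have := indV U W (mod_iso_sym (ex_intro _ g bij_g)).
case=> h0; [left|right] => v.
  by have [u <-] := (hU (pi v)).1 (pipi v); rewrite (h0 u) linear0.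
have [|w hw] := (hW (v - pi v)).1; first by rewrite linearB /= pipi subrr.
by apply/esym/eqP; rewrite -subr_eq0 -hw (h0 w) linear0.
Qed.

Lemma basis_coord (V : lmodType A) M (v : 'I_M -> V) : is_basis v ->
  exists co : V -> 'rV[F]_M,
    [/\ forall w, w = \sum_i (co w 0 i)%:A *: v i,
        forall c : 'rV[F]_M, co (\sum_i (c 0 i)%:A *: v i) = c,
        forall u w, co (u + w) = co u + co w,
        forall c w, co (c%:A *: w) = c *: co w
      & forall i, co (v i) = delta_mx 0 i].
Proof.
move=> bv; have [co coE] := choice bv.
have co1 w : w = \sum_i (co w 0 i)%:A *: v i by case: (coE w).
have co2 (c : 'rV[F]_M) : co (\sum_i (c 0 i)%:A *: v i) = c.
  by case: (coE (\sum_i (c 0 i)%:A *: v i)) => _; exact.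
exists co; split=> // [u w|c w|i].
- rewrite -[RHS]co2; congr co; rewrite {1}(co1 u) {1}(co1 w) -big_split /=.
  by apply: eq_bigr => i _; rewrite mxE !scalerDl.
- rewrite -[RHS]co2; congr co; rewrite {1}(co1 w) scaler_sumr.
  by apply: eq_bigr => i _; rewrite mxE scalerA mulr_algl scalerA.
- rewrite -[RHS]co2; congr co; rewrite (bigD1 i) //= big1 ?addr0 => [|j ne_j].
    by rewrite mxE !eqxx !scale1r.
  by rewrite mxE (negbTE ne_j) andbF !scale0r.
Qed.

Lemma is_basis_free_span (V : lmodType A) M (v : 'I_M -> V) :
  (forall w, exists c : 'I_M -> F, w = \sum_i (c i)%:A *: v i) ->
  (forall c : 'I_M -> F, \sum_i (c i)%:A *: v i = 0 -> forall i, c i = 0) -> is_basis v.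
Proof.
move=> span free w; have [c ->] := span w.
exists (\row_i c i); split=> [|c' e].
  by apply: eq_bigr => i _; rewrite mxE.
apply/rowP=> i; rewrite mxE; apply/eqP; rewrite -subr_eq0; apply/eqP; move: i.
apply: free; under eq_bigr do rewrite !scalerBl.
by rewrite sumrB e subrr.
Qed.

End Bases.

Lemma card_image_pred (T : finType) (U : Type) (P : {pred T}) (f : T -> U) :
  {in P &, injective f} -> ([set f x | x in [set x | x \in P]] #= `I_#|P|)%card.
Proof.
move=> f_inj; have fi : {in [set x | x \in P] &, injective f}.
  by move=> x x'; rewrite !inE => Px Px'; apply: f_inj.
apply: card_eq_trans (inj_card_eq fi) _.
have -> : [set x | x \in P] = [set enum_val i | i in [set: 'I_#|P|]].
  rewrite eqEsubset; split=> [x /= Px|x [i _ <-]]; last exact: enum_valP.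
  by exists (enum_rank_in Px x); rewrite ?enum_rankK_in.
apply: card_eq_trans (inj_card_eq _) _; first by move=> i j _ _; exact: enum_val_inj.
by rewrite card_eq_sym card_II.
Qed.

Section LocalSummands.
Variables (F : fieldType) (A : algType F) (X : finType) (E N : X -> A).
Hypothesis A_comm : forall a b : A, a * b = b * a.
Hypothesis EE : forall x x', E x * E x' = if x == x' then E x else 0.
Hypothesis E_sum : \sum_x E x = 1.
Hypothesis E_neq0 : forall x, E x != 0.
Hypothesis EN : forall x, E x * N x = N x.
Hypothesis NN : forall x, N x * N x = 0.
Hypothesis EN_span : forall a, exists alpha nu : X -> F,
  a = \sum_x (alpha x *: E x + nu x *: N x).

Definition primary (x : X) (V : lmodType A) : Prop := forall v : V, E x *: v = v.

(* [line_mod] and [plane_mod] are C_{lambda,mu} and V(k), described by the local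
   summand acting on them; see [line_modP] and [plane_modP]. *)
Definition line_mod (x : X) (V : lmodType A) : Prop :=
  primary x V /\ exists v : V, is_basis (fun _ : 'I_1 => v) /\ N x *: v = 0.

Definition plane_mod (x : X) (V : lmodType A) : Prop :=
  primary x V /\
  exists v : V, is_basis (fun i : 'I_2 => if i == ord0 then N x *: v else v).

Lemma NE x x' : N x' * E x = if x' == x then N x else 0.
Proof.
rewrite -(EN x') -mulrA (A_comm (N x')) mulrA EE.
by case: eqP => [->|_]; [exact: EN | exact: mul0r].
Qed.

Lemma summand_coord a x : exists alpha nu : F, a * E x = alpha *: E x + nu *: N x.
Proof.
have [alpha [nu ->]] := EN_span a; exists (alpha x), (nu x).
rewrite mulr_suml (bigD1 x) //= big1 ?addr0 => [|x' ne_x].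
  by rewrite mulrDl -!scalerAl EE NE eqxx.
by rewrite mulrDl -!scalerAl EE NE (negbTE ne_x) !scaler0 addr0.
Qed.

(** On vectors fixed by E x, every a acts as alpha + nu N x, so F-linearity and compatibility with N
    x suffice. Only the values of f, not all of W, must be fixed by E x: liftings take values in
    arbitrary modules. *)
Lemma linear_into_summand x (V W : lmodType A) (f : V -> W) :
  primary x V -> (forall v, E x *: f v = f v) ->
  (forall u v, f (u + v) = f u + f v) -> (forall c v, f (c%:A *: v) = c%:A *: f v) ->
  (forall v, f (N x *: v) = N x *: f v) -> exists g : {linear V -> W}, g =1 f.
Proof.
move=> pV pf fD fZ fN; apply: linear_exists => a u v; rewrite fD; congr (_ + _).
have [alpha [nu e]] := summand_coord a x.
have act (T : lmodType A) (t : T) : E x *: t = t ->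
    a *: t = alpha%:A *: t + nu%:A *: (N x *: t).
  move=> pt; rewrite -{1}pt scalerA e scalerDl.
  by rewrite (alg_scaleA alpha) (alg_scaleA nu) pt.
by rewrite !act // fD !fZ fN.
Qed.

Lemma primary_linear x (V W : lmodType A) (f : V -> W) : primary x V -> primary x W ->
  (forall u v, f (u + v) = f u + f v) -> (forall c v, f (c%:A *: v) = c%:A *: f v) ->
  (forall v, f (N x *: v) = N x *: f v) -> exists g : {linear V -> W}, g =1 f.
Proof. by move=> pV pW; apply: linear_into_summand pV _ => v; exact: pW. Qed.

(** By commutativity each E x acts as an idempotent endomorphism, hence as 0 or as 1. Not all act as
    0, because they sum to 1. *)
Lemma indecomposable_primary (V : lmodType A) : indecomposable V ->
  exists x, primary x V.
Proof.
move=> indV; have [[v0 v0_neq0] _] := indV; apply: contrapT => noX.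
have Ev0 x (v : V) : E x *: v = 0.
  have [pi piE] : exists pi : {linear V -> V}, forall v, pi v = E x *: v.
    apply: (linear_exists (f := fun v : V => E x *: v)) => a u w.
    by rewrite scalerDr !scalerA A_comm.
  have [w|h|h] := idempotent_indecomposable (pi := pi) indV.
  - by rewrite !piE scalerA EE eqxx.
  - by rewrite -piE.
  - by case: noX; exists x => w; rewrite -piE.
by case/eqP: v0_neq0; rewrite -[v0]scale1r -E_sum scaler_suml big1.
Qed.

(** A nonzero direct summand of V must be all of V. If N x acts as zero, any basis line is one.
    Otherwise the span of w and N w with N w <> 0 is one, because F[N]/(N^2) is self-injective: from
    a linear form phi with phi (N w) = 1 one gets the projection t -> phi (N t) w + (phi t - phi w
    phi (N t)) N w. *)
Lemma primary_decomposition (V : lmodType A) : fin_dim V -> indecomposable V ->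
  exists x, line_mod x V \/ plane_mod x V.
Proof.
case=> M [b bb] indV; have [x pV] := indecomposable_primary indV.
have [[v0 v0_neq0] _] := indV; exists x.
have [co [co1 co2 coD coZ coB]] := basis_coord bb.
have co0 : co 0 = 0 by have := coZ 0 0; rewrite !scale0r.
have coi (u : V) : u != 0 -> exists i, co u 0 i != 0.
  move=> u0; apply: contrapT => h; case/eqP: u0; rewrite (co1 u) big1 // => i _.
  have [->|ci] := eqVneq (co u 0 i) 0; first by rewrite !scale0r.
  by case: h; exists i.
have [N0|/existsNP[w /eqP Nw]] := pselect (forall v : V, N x *: v = 0);
  [left|right]; split=> //.
  have [i _] := coi _ v0_neq0; exists (b i); split=> //.
  have bi0 : b i != 0.
    apply/eqP=> e; have := coB i; rewrite e => /matrixP/(_ 0 i).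
    by rewrite co0 !mxE !eqxx => /eqP; rewrite eq_sym oner_eq0.
  have [|||pi piE] := @primary_linear x V V (fun w => (co w 0 i)%:A *: b i) pV pV.
  - by move=> u v; rewrite coD mxE !scalerDl.
  - by move=> c v; rewrite coZ mxE scalerA mulr_algl scalerA.
  - by move=> v; rewrite !N0 co0 mxE !scale0r.
  have pibi : pi (b i) = b i by rewrite piE coB mxE !eqxx !scale1r.
  have [v|h|h] := idempotent_indecomposable (pi := pi) indV.
  - by rewrite !piE coZ coB !mxE !eqxx mulr1.
  - by case/eqP: bi0; rewrite -pibi h.
  apply: is_basis_free_span => [w|c].
    by exists (fun=> co w 0 i); rewrite big_ord1 -{1}(h w) piE.
  rewrite big_ord1 => /(congr1 co); rewrite coZ coB => /matrixP/(_ 0 i).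
  by rewrite co0 !mxE !eqxx mulr1 => c0 j; rewrite ord1.
have [i coi0] := coi _ Nw.
pose phi t := co t 0 i / co (N x *: w) 0 i.
have phiD u v : phi (u + v) = phi u + phi v by rewrite /phi coD mxE mulrDl.
have phiZ c v : phi (c%:A *: v) = c * phi v by rewrite /phi coZ mxE mulrA.
have phi1 : phi (N x *: w) = 1 by rewrite /phi divff.
have phi0 : phi 0 = 0 by have := phiZ 0 0; rewrite !scale0r mul0r.
have NNv (v : V) : N x *: (N x *: v) = 0 by rewrite scalerA NN scale0r.
(* (g0, g1) are the coordinates of a projection onto the span of w and N w. *)
pose g0 t := phi (N x *: t); pose g1 t := phi t - phi w * g0 t.
have g0D u v : g0 (u + v) = g0 u + g0 v by rewrite /g0 scalerDr phiD.
have g0Z c v : g0 (c%:A *: v) = c * g0 v by rewrite /g0 -alg_scaleC phiZ.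
have g1D u v : g1 (u + v) = g1 u + g1 v by rewrite /g1 phiD g0D; ring.
have g1Z c v : g1 (c%:A *: v) = c * g1 v by rewrite /g1 phiZ g0Z; ring.
have g0N v : g0 (N x *: v) = 0 by rewrite /g0 NNv.
have g1N v : g1 (N x *: v) = g0 v by rewrite /g1 g0N mulr0 subr0.
have g0w : g0 w = 1 by [].
have g1w : g1 w = 0 by rewrite /g1 g0w mulr1 subrr.
have [|||pi piE] := @primary_linear x V V
    (fun t => (g0 t)%:A *: w + (g1 t)%:A *: (N x *: w)) pV pV.
- by move=> u v; rewrite g0D g1D !scalerDl addrACA.
- by move=> c v; rewrite g0Z g1Z scalerDr !alg_scaleM.
- move=> v; rewrite g0N g1N scale0r scale0r add0r scalerDr.
  by rewrite -[in RHS]alg_scaleC -[in RHS]alg_scaleC NNv scaler0 addr0.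
have piw : pi w = w by rewrite piE g0w g1w scale1r scale1r !scale0r addr0.
have piNw : pi (N x *: w) = N x *: w by rewrite linearZ /= piw.
have [v|h|h] := idempotent_indecomposable (pi := pi) indV.
- rewrite {1}(piE v) linearD /= linearZ /= piw linearZ /= piNw.
  by rewrite -piE.
- by case/eqP: Nw; rewrite -piw h scaler0.
exists w; apply: is_basis_free_span => [v|c].
  exists (fun i => if i == ord0 then g1 v else g0 v).
  by rewrite !big_ord_recl big_ord0 addr0 /= addrC -piE h.
rewrite !big_ord_recl big_ord0 addr0 /= => e.
have c1 : c (fintype.lift ord0 ord0) = 0.
  have := congr1 g0 e; rewrite g0D !g0Z g0N g0w mulr0 add0r mulr1 => ->.
  by have := g0Z 0 0; rewrite scale0r scale0r mul0r.
have c0 : c ord0 = 0.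
  have := congr1 g1 e; rewrite g1D !g1Z g1N g0w g1w mulr0 addr0 mulr1 => ->.
  by have := g1Z 0 0; rewrite scale0r scale0r mul0r.
by move=> j; case: (unliftP ord0 j) => [k|] ->; rewrite ?ord1.
Qed.

Lemma N_neq0_plane x V : plane_mod x V -> N x != 0.
Proof.
case=> pV [v bv]; apply/eqP=> N0.
have [co [_ co2 _ _ coB]] := basis_coord bv.
have := coB ord0; rewrite /= N0 scale0r.
have <- : \sum_(i < 2) ((0 : 'rV[F]_2) 0 i)%:A *: (if i == ord0 then N x *: v else v) = 0.
  by rewrite big1 // => i _; rewrite mxE !scale0r.
rewrite co2 => /matrixP/(_ 0 ord0); rewrite !mxE eqxx => /eqP.
by rewrite eq_sym oner_eq0.
Qed.

(** As N x squares to 0, every nonzero module contains a nonzero vector killed by N x. Two nonzero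
    factors would give two independent ones, but they all lie on the line of u0. *)
Lemma socle_line_indecomposable x (V : lmodType A) (u0 : V) : u0 != 0 ->
  (forall v : V, N x *: v = 0 -> exists c : F, v = c%:A *: u0) -> indecomposable V.
Proof.
move=> u0_neq0 soc; split; first by exists u0.
move=> U W [f /mod_iso_bij[g fK gK]].
have ker_nz (T : lmodType A) (t : T) : t != 0 -> exists2 t' : T, t' != 0 & N x *: t' = 0.
  move=> t0; have [Nt|Nt] := eqVneq (N x *: t) 0; first by exists t.
  by exists (N x *: t) => //; rewrite scalerA NN scale0r.
apply: contrapT => /not_orP[/existsNP[u /eqP/ker_nz[u' u'0 Nu']] /existsNP[w /eqP/ker_nz[w' w'0 Nw']]].
have [c1 e1] : exists c : F, g (u', 0) = c%:A *: u0.
  apply: soc; rewrite -linearZ (_ : _ *: _ = 0) ?linear0 //.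
  by congr pair; rewrite ?scaler0.
have [c2 e2] : exists c : F, g (0, w') = c%:A *: u0.
  apply: soc; rewrite -linearZ (_ : _ *: _ = 0) ?linear0 //.
  by congr pair; rewrite ?scaler0.
have f1 : (u', 0) = c1%:A *: f u0 by rewrite -linearZ -e1 gK.
have f2 : (0, w') = c2%:A *: f u0 by rewrite -linearZ -e2 gK.
have c10 : c1 != 0.
  by move: (u'0); apply: contraNneq => c10; move: (f1); rewrite c10 scale0r scale0r => /(congr1 fst)/= ->.
have c20 : c2 != 0.
  by move: (w'0); apply: contraNneq => c20; move: (f2); rewrite c20 scale0r scale0r => /(congr1 snd)/= ->.
case/eqP: u'0.
have -> : u' = (c1%:A *: f u0).1 by rewrite -f1.
have -> : f u0 = c2^-1%:A *: (0, w').
  by rewrite f2 -alg_scaleM mulVf // scale1r scale1r.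
by rewrite /= !scaler0.
Qed.

Lemma basis1_coord (V : lmodType A) (v : V) : is_basis (fun _ : 'I_1 => v) ->
  v != 0 /\ forall w, exists c : F, w = c%:A *: v.
Proof.
move=> bv; have [co [co1 co2 coD coZ coB]] := basis_coord bv; split.
  apply/eqP=> v0; have /= e := coB 0; have := coZ 0 v.
  by rewrite v0 !scale0r -v0 e => /matrixP/(_ 0 0)/eqP; rewrite !mxE eqxx oner_eq0.
by move=> w; exists (co w 0 0); rewrite {1}(co1 w) big_ord1.
Qed.

Lemma basis2_coord (V : lmodType A) (v1 v2 : V) :
  is_basis (fun i : 'I_2 => if i == ord0 then v1 else v2) ->
  exists c1 c2 : V -> F,
  [/\ forall w, w = (c1 w)%:A *: v1 + (c2 w)%:A *: v2,
      (forall u w, c1 (u + w) = c1 u + c1 w) /\ (forall u w, c2 (u + w) = c2 u + c2 w),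
      (forall a w, c1 (a%:A *: w) = a * c1 w) /\ (forall a w, c2 (a%:A *: w) = a * c2 w),
      c1 v1 = 1 /\ c2 v1 = 0 & c1 v2 = 0 /\ c2 v2 = 1].
Proof.
move=> bv; have [co [co1 co2 coD coZ coB]] := basis_coord bv.
exists (fun w => co w 0 ord0), (fun w => co w 0 (fintype.lift ord0 ord0)); split.
- by move=> w; rewrite {1}(co1 w) !big_ord_recl big_ord0 addr0.
- by split=> u w; rewrite coD mxE.
- by split=> u w; rewrite coZ mxE.
- by have /= -> := coB ord0; rewrite !mxE.
- by have /= -> := coB (fintype.lift ord0 ord0); rewrite !mxE.
Qed.

Lemma line_mod_indecomposable x (V : lmodType A) : line_mod x V -> fin_dim V /\ indecomposable V.
Proof.
case=> _ [v [bv _]]; split; first by exists 1%N; exists (fun=> v).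
have [v0 vspan] := basis1_coord bv.
by apply: (socle_line_indecomposable (x := x) v0) => w _; exact: vspan.
Qed.

Lemma plane_mod_indecomposable x (V : lmodType A) : plane_mod x V -> fin_dim V /\ indecomposable V.
Proof.
case=> _ [v bv]; split; first by eexists; eexists; exact: bv.
have [c1 [c2 [cE _ [c1Z c2Z] [c11 c21] _]]] := basis2_coord bv.
apply: (socle_line_indecomposable (x := x) (u0 := N x *: v)) => [|w].
  apply/eqP=> v0; have := c1Z 0 (N x *: v).
  by rewrite c11 mul0r v0 scaler0 -v0 c11 => /eqP; rewrite oner_eq0.
rewrite {1}(cE w) scalerDr -!alg_scaleC scalerA NN scale0r scaler0 add0r => e.
exists (c1 w); have c2w : c2 w = 0.
  by have := congr1 c1 e; rewrite c1Z c11 mulr1 => ->; have := c1Z 0 0; rewrite mul0r !scale0r.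
by rewrite {1}(cE w) c2w !scale0r addr0.
Qed.

Lemma mod_iso_same_action x M (V W : lmodType A) (v : 'I_M -> V) (w : 'I_M -> W) :
  primary x V -> primary x W -> is_basis v -> is_basis w ->
  (forall i, exists c : 'I_M -> F, N x *: v i = \sum_j (c j)%:A *: v j /\
    N x *: w i = \sum_j (c j)%:A *: w j) -> mod_iso V W.
Proof.
move=> pV pW bv bw hN.
have [cv [cv1 cv2 cvD cvZ cvB]] := basis_coord bv.
have [cw [cw1 cw2 cwD cwZ cwB]] := basis_coord bw.
pose f t := \sum_i (cv t 0 i)%:A *: w i.
have fD t u : f (t + u) = f t + f u.
  by rewrite /f -big_split /=; apply: eq_bigr => i _; rewrite cvD mxE !scalerDl.
have fZ c t : f (c%:A *: t) = c%:A *: f t.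
  rewrite /f scaler_sumr; apply: eq_bigr => i _.
  by rewrite cvZ mxE [RHS]scalerA mulr_algl scalerA.
have f0 : f 0 = 0 by have := fZ 0 0; rewrite !scale0r.
have fS (c : 'I_M -> F) (t : 'I_M -> V) :
    f (\sum_i (c i)%:A *: t i) = \sum_i (c i)%:A *: f (t i).
  by rewrite (big_morph f fD f0); apply: eq_bigr => i _; rewrite fZ.
have fv i : f (v i) = w i.
  rewrite /f cvB (bigD1 i) //= big1 ?addr0 => [|j ne_j].
    by rewrite mxE !eqxx !scale1r.
  by rewrite mxE (negbTE ne_j) andbF !scale0r.
have [//|//||g gE] := @primary_linear x V W f pV pW.
  move=> t; rewrite {1}(cv1 t) scaler_sumr.
  under eq_bigr do rewrite -alg_scaleC.
  rewrite (fS (cv t 0)) /f scaler_sumr; apply: eq_bigr => i _.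
  rewrite -[RHS]alg_scaleC -/(f _); congr (_ *: _).
  by have [c [-> ->]] := hN i; rewrite fS; apply: eq_bigr => j _; rewrite fv.
exists g; exists (fun u => \sum_i (cw u 0 i)%:A *: v i) => t; rewrite ?gE.
  by rewrite /f cw2 -cv1.
by rewrite (fS (cw t 0)) [RHS]cw1; apply: eq_bigr => i _; rewrite fv.
Qed.

Lemma mod_iso_primary x x' (V W : lmodType A) : mod_iso V W ->
  primary x V -> primary x' W -> (exists v : V, v != 0) -> x = x'.
Proof.
case=> f /mod_iso_bij[g fK gK] pV pW [v v0]; apply: contraNeq v0 => ne_x.
by rewrite -(fK v) -(pV v) linearZ -(pW (f v)) /= scalerA EE (negbTE ne_x) scale0r linear0.
Qed.

Lemma line_mod_iso x x' (V W : lmodType A) : line_mod x V -> line_mod x' W ->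
  (mod_iso V W <-> x = x').
Proof.
move=> lV lW; split=> [iso|exx].
  have [_ [nzV _]] := line_mod_indecomposable lV.
  by apply: (mod_iso_primary iso _ _ nzV); [case: lV | case: lW].
case: lV lW => pV [v [bv Nv]]; rewrite -exx => -[pW [w [bw Nw]]].
apply: (mod_iso_same_action pV pW bv bw) => i; exists (fun=> 0).
by rewrite !big_ord1 !scale0r.
Qed.

Lemma plane_mod_iso x x' (V W : lmodType A) : plane_mod x V -> plane_mod x' W ->
  (mod_iso V W <-> x = x').
Proof.
move=> lV lW; split=> [iso|exx].
  have [_ [nzV _]] := plane_mod_indecomposable lV.
  by apply: (mod_iso_primary iso _ _ nzV); [case: lV | case: lW].
case: lV lW => pV [v bv]; rewrite -exx => -[pW [w bw]].
apply: (mod_iso_same_action pV pW bv bw) => i.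
exists (fun j => if (j == ord0) && (i != ord0) then 1 else 0).
rewrite !big_ord_recl !big_ord0 /=; case: eqP => _ /=; rewrite !scale0r !addr0.
  by rewrite !scalerA NN !scale0r.
by rewrite !scale1r.
Qed.

Lemma line_plane_not_iso x x' (V W : lmodType A) : line_mod x V -> plane_mod x' W ->
  ~ mod_iso V W.
Proof.
move=> lV lW iso.
have [_ [nzV _]] := line_mod_indecomposable lV.
have exx : x = x' by apply: (mod_iso_primary iso _ _ nzV); [case: lV | case: lW].
case: lV lW iso => pV [v [bv Nv]]; rewrite -exx => -[pW [w bw]] [f /mod_iso_bij[g fK gK]].
have [c1 [c2 [_ _ [c1Z _] [c11 _] _]]] := basis2_coord bw.
have [_ vspan] := basis1_coord bv; have [c e] := vspan (g w).
have Nw : N x *: w = 0.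
  by rewrite -(gK w) -linearZ e /= -alg_scaleC Nv scaler0 linear0.
have := c1Z 0 (N x *: w); rewrite c11 mul0r scale0r scale0r -Nw c11.
by move/eqP; rewrite oner_eq0.
Qed.

Lemma summand_free x (a b : F) : a *: E x + b *: N x = 0 -> a = 0 /\ b *: N x = 0.
Proof.
move=> e; suff a0 : a = 0 by move: e; rewrite a0 scale0r add0r.
have [N0|N0] := eqVneq (N x) 0.
  move/eqP: e; rewrite N0 scaler0 addr0 scaler_eq0 (negbTE (E_neq0 x)) orbF.
  by move/eqP.
have /eqP := congr1 (fun c => c * N x) e.
rewrite mulrDl -!scalerAl EN NN scaler0 addr0 mul0r scaler_eq0 (negbTE N0) orbF.
by move/eqP.
Qed.

(** The module is the socle of the ideal A E, namely the line of N when N <> 0 and that of E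
    otherwise. *)
Lemma line_mod_exists x : exists V : lmodType A, line_mod x V.
Proof.
pose S (a : A^o) := (a : A) * E x = a /\ (a : A) * N x = 0.
have [||a b [h1 h2]|U [i [i_inj hi]]] := @submodule_exists A A^o S.
- by split; rewrite mul0r.
- by move=> a b [h1 h2] [h3 h4]; split; rewrite mulrDl ?h1 ?h3 // h2 h4 addr0.
- by split; rewrite -[a *: b]/(a * b : A) -mulrA ?h1 // h2 mulr0.
pose v0 : A := if N x == 0 then E x else N x.
have v0_neq0 : v0 != 0 by rewrite /v0; case: ifPn.
have [u0 iu0] : exists u, i u = v0.
  apply/hi; rewrite /S /v0; case: eqP => [->|_]; split.
  - by rewrite EE eqxx.
  - exact: mulr0.
  - by rewrite NE eqxx.
  - exact: NN.
have iA (a : A) u : i (a *: u) = a * i u by rewrite linearZ.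
exists U; split.
  move=> u; apply: i_inj; rewrite iA A_comm.
  by have [] : S (i u) by apply/hi; exists u.
exists u0; split; last first.
  apply: i_inj; rewrite iA linear0 iu0 /v0; case: eqP => [->|_]; [exact: mul0r | exact: NN].
apply: is_basis_free_span => [w|c].
  have [h1 h2] : S (i w) by apply/hi; exists w.
  have [al [nu e]] := summand_coord (i w) x; rewrite h1 in e.
  have [N0|N0] := eqVneq (N x) 0.
    exists (fun=> al); rewrite big_ord1; apply: i_inj.
    by rewrite iA iu0 e /v0 N0 eqxx scaler0 addr0 mulr_algl.
  exists (fun=> nu); rewrite big_ord1; apply: i_inj.
  rewrite iA iu0 e /v0 (negbTE N0) mulr_algl.
  move: h2; rewrite e mulrDl -!scalerAl EN NN scaler0 addr0 => /eqP.
  by rewrite scaler_eq0 (negbTE N0) orbF => /eqP ->; rewrite scale0r add0r.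
rewrite big_ord1 => /(congr1 i); rewrite iA linear0 iu0 mulr_algl => /eqP.
by rewrite scaler_eq0 (negbTE v0_neq0) orbF => /eqP c0 j; rewrite ord1.
Qed.

(** The module is the ideal A E itself, with basis N, E. *)
Lemma plane_mod_exists x : N x != 0 -> exists V : lmodType A, plane_mod x V.
Proof.
move=> N0; pose S (a : A^o) := (a : A) * E x = a.
have [||a b h1|U [i [i_inj hi]]] := @submodule_exists A A^o S.
- exact: mul0r.
- by move=> a b h1 h3; rewrite /S mulrDl h1 h3.
- by rewrite /S -[a *: b]/(a * b : A) -mulrA h1.
have [u iu] : exists u, i u = E x by apply/hi; rewrite /S EE eqxx.
have iA (a : A) v : i (a *: v) = a * i v by rewrite linearZ.
exists U; split.
  by move=> v; apply: i_inj; rewrite iA A_comm; apply/hi; exists v.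
exists u; apply: is_basis_free_span => [w|c].
  have h1 : S (i w) by apply/hi; exists w.
  have [al [nu e]] := summand_coord (i w) x; rewrite h1 in e.
  exists (fun j => if j == ord0 then nu else al).
  rewrite !big_ord_recl big_ord0 addr0 /=; apply: i_inj.
  by rewrite e linearD !iA iu NE eqxx !mulr_algl addrC.
rewrite !big_ord_recl big_ord0 addr0 /= => /(congr1 i).
rewrite linearD linear0 !iA iu NE eqxx !mulr_algl addrC => /summand_free[c1 /eqP].
rewrite scaler_eq0 (negbTE N0) orbF => /eqP c0 j.
by case: (unliftP ord0 j) => [k|] ->; rewrite ?ord1.
Qed.

Lemma summand_lift x (U V W : lmodType A) (p : {linear U -> W}) (f : {linear V -> W}) :
  primary x V -> forall v, (forall w, exists u, p u = w) ->
  exists2 u, p u = f v & E x *: u = u.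
Proof.
move=> pV v p_surj; have [u0 pu0] := p_surj (f v).
by exists (E x *: u0); [rewrite linearZ /= pu0 -linearZ /= pV | rewrite scalerA EE eqxx].
Qed.

(** V is free of rank one over A E, a direct factor of A: a preimage u of f v can be chosen with E u
    = u, and v -> u, N v -> N u defines the lifting. *)
Lemma plane_mod_projective x (V : lmodType A) : plane_mod x V -> projective V.
Proof.
case=> pV [v bv] U W p f p_surj.
have [c1 [c2 [cE [c1D c2D] [c1Z c2Z] [c11 c21] [c12 c22]]]] := basis2_coord bv.
have [u pu Eu] := summand_lift f pV v p_surj.
have cN w : c1 (N x *: w) = c2 w /\ c2 (N x *: w) = 0.
  have -> : N x *: w = (c2 w)%:A *: (N x *: v).
    rewrite {1}(cE w) scalerDr -!alg_scaleC (scalerA (N x)) NN scale0r scaler0.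
    by rewrite add0r.
  by rewrite c1Z c2Z c11 c21 mulr1 mulr0.
have [||||g gE] := @linear_into_summand x V U
    (fun w => (c2 w)%:A *: u + (c1 w)%:A *: (N x *: u)) pV.
- by move=> w; rewrite scalerDr -!alg_scaleC (scalerA (E x)) EN Eu.
- by move=> w w'; rewrite c1D c2D !scalerDl addrACA.
- by move=> c w; rewrite c1Z c2Z scalerDr !alg_scaleM.
- move=> w; have [-> ->] := cN w; rewrite scale0r scale0r add0r scalerDr.
  by rewrite -!(alg_scaleC _ (N x)) (scalerA (N x)) NN scale0r scaler0 addr0.
exists g => w; rewrite gE.
have -> : f w = f ((c1 w)%:A *: (N x *: v) + (c2 w)%:A *: v) by rewrite -cE.
by rewrite !linearD !linearZ /= addrC pu.
Qed.

(** If N <> 0, the plane of the same x maps onto the line with kernel spanned by N w. A section g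
    would satisfy N (g v) = g (N v) = 0, so g v lies in that kernel, which contradicts v <> 0. *)
Lemma line_mod_projective x (V : lmodType A) : line_mod x V ->
  (projective V <-> N x = 0).
Proof.
case=> pV [v [bv Nv]]; have [co [co1 _ coD coZ coB]] := basis_coord bv.
have coE w : w = (co w 0 0)%:A *: v by rewrite {1}(co1 w) big_ord1.
have Nw (w : V) : N x *: w = 0 by rewrite (coE w) -alg_scaleC Nv scaler0.
have co0 : co 0 = 0 by have := coZ 0 0; rewrite !scale0r.
split=> [projV|N0 U W p f p_surj]; last first.
  have [u pu Eu] := summand_lift f pV v p_surj.
  have [||||g gE] := @linear_into_summand x V U (fun w => (co w 0 0)%:A *: u) pV.
  - by move=> w; rewrite -alg_scaleC Eu.
  - by move=> w w'; rewrite coD mxE !scalerDl.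
  - by move=> c w; rewrite coZ mxE alg_scaleM.
  - by move=> w; rewrite N0 !scale0r co0 mxE !scale0r.
  exists g => w; rewrite gE; have -> : f w = f ((co w 0 0)%:A *: v) by rewrite -coE.
  by rewrite !linearZ /= pu.
apply/eqP; apply: contrapT => /negP N0.
have [W [pW [w bw]]] := plane_mod_exists N0.
have [c1 [c2 [cE [c1D c2D] [c1Z c2Z] [c11 c21] [c12 c22]]]] := basis2_coord bw.
have cN t : N x *: t = (c2 t)%:A *: (N x *: w).
  rewrite {1}(cE t) scalerDr -!alg_scaleC (scalerA (N x)) NN scale0r scaler0.
  by rewrite add0r.
(* The quotient map from the plane, sending w to v and N w to 0. *)
have [|||p pE] := @primary_linear x W V (fun t => (c2 t)%:A *: v) pW pV.
- by move=> t t'; rewrite c2D !scalerDl.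
- by move=> c t; rewrite c2Z alg_scaleM.
- by move=> t; rewrite Nw cN c2Z c21 mulr0 !scale0r.
have [|g gK] := projV W V p idfun.
  move=> u; exists ((co u 0 0)%:A *: w).
  by rewrite pE c2Z c22 mulr1 -coE.
have [v0 _] := basis1_coord bv; case/eqP: v0.
rewrite -[v]/(idfun v) -gK pE; have := cN (g v); rewrite -linearZ Nv /= linear0 => /esym/(congr1 c1).
rewrite c1Z c11 mulr1 => ->; have := c1Z 0 0; rewrite mul0r !scale0r => ->.
by rewrite !scale0r.
Qed.

(** * Blocks of a sum of local algebras *)

Definition block_of (x : X) : set A := [set a | a * E x = a].

Lemma block_of_ideal x : two_sided_ideal (block_of x).
Proof.
split; first exact: mul0r.
- by move=> a b; rewrite /block_of /= => ha hb; rewrite mulrDl ha hb.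
- by move=> a b; rewrite /block_of /= => hb; rewrite (A_comm b) -mulrA hb.
Qed.

Lemma block_of_inj : injective block_of.
Proof.
move=> x x' exx; have : block_of x (E x) by rewrite /block_of /= EE eqxx.
rewrite exx /block_of /= EE; case: eqP => // _ /esym/eqP.
by rewrite (negbTE (E_neq0 x)).
Qed.

(** A local algebra has only trivial idempotents: comparing coefficients gives al^2 = al and (2 al -
    1) nu N = 0, where 2 al - 1 is 1 or -1. *)
Lemma idempotent_summand x (a : A) : a * E x = a -> a * a = a -> a = 0 \/ a = E x.
Proof.
move=> ax aa; have [al [nu e]] := summand_coord a x; rewrite ax in e.
have aaE : a * a = (al * al) *: E x + (al * nu + al * nu) *: N x.
  rewrite {1 2}e mulrDl !mulrDr -!scalerAl -!scalerAr EE EN NE eqxx NN !scaler0 addr0.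
  by rewrite !scalerA -addrA -scalerDl (mulrC nu).
have : (al * al - al) *: E x + (al * nu + al * nu - nu) *: N x = 0.
  by rewrite !scalerBl addrACA -opprD -e -aaE aa subrr.
case/summand_free=> h1 h2.
have /orP[/eqP al0|/eqP al1] : (al == 0) || (al == 1).
- by rewrite -[al == 1]subr_eq0 -mulf_eq0 mulrBr mulr1 h1.
- by left; move: h2; rewrite e al0 !mul0r addr0 sub0r scaleNr scale0r add0r => /eqP;
    rewrite oppr_eq0 => /eqP.
right; move: h2; rewrite e al1 !mul1r addrK => ->; by rewrite scale1r addr0.
Qed.

(** A splitting into ideals decomposes E x into two idempotents, one of which is 0; the
    corresponding ideal then vanishes. *)
Lemma block_of_is_block x : is_block (block_of x).
Proof.
split.
- exists [set a | a * E x = 0]; split.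
  + exact: block_of_ideal.
  + split=> /=; first exact: mul0r.
      by move=> a b ha hb; rewrite mulrDl ha hb addr0.
    by move=> a b hb; rewrite (A_comm b) -mulrA hb mulr0.
  + rewrite eqEsubset; split=> // a _; exists (a * E x).
      by rewrite /block_of /= -mulrA EE eqxx.
    exists (a - a * E x); last by rewrite addrC subrK.
    by rewrite /= mulrBl -mulrA EE eqxx subrr.
  + rewrite eqEsubset; split=> [a [/= h1 h2]|a /= ->]; first by rewrite -h1.
    by rewrite /block_of /= mul0r.
- move=> h; have : block_of x (E x) by rewrite /block_of /= EE eqxx.
  by rewrite h /= => /eqP; apply/negP.
move=> B1 B2 [[B10 B1D B1M] [B20 B2D B2M] B12 I12].
have [b1 Bb1 [b2 Bb2 e]] : [set a + b | a in B1 & b in B2] (E x).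
  by rewrite -B12 /block_of /= EE eqxx.
have inI a : B1 a -> B2 a -> a = 0.
  by move=> h1 h2; have : (B1 `&` B2) a by []; rewrite I12.
have B1x a : B1 a -> a * E x = a.
  move=> h; have : block_of x a by rewrite B12; exists a => //; exists 0; rewrite ?addr0.
  by [].
have B2x a : B2 a -> a * E x = a.
  move=> h; have : block_of x a by rewrite B12; exists 0 => //; exists a; rewrite ?add0r.
  by [].
have b12 : b1 * b2 = 0 by apply: inI; [case: (B1M b2 _ Bb1) | case: (B2M b1 _ Bb2)].
have b11 : b1 * b1 = b1 by rewrite -[RHS]B1x // -e mulrDr b12 addr0.
have [b10|b1E] := idempotent_summand (B1x _ Bb1) b11; [left|right].
  rewrite eqEsubset; split=> [a Ba|a /= -> //]; apply: inI => //.
  by rewrite -(B1x _ Ba) -e b10 add0r; case: (B2M a _ Bb2).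
rewrite eqEsubset; split=> [a Ba|a /= -> //]; apply: inI => //.
by rewrite -(B2x _ Ba) -b1E; case: (B1M a _ Bb1).
Qed.

(** A direct factor B is generated by an idempotent e, and e E x <> 0 for some x. Splitting B by E x
    and 1 - E x leaves only the part at x, and e E x, a nonzero idempotent of the local summand,
    equals E x. *)
Lemma is_blockP (B : set A) : is_block B <-> exists x, B = block_of x.
Proof.
split=> [|[x ->]]; last exact: block_of_is_block.
case=> -[B' [[B0 BD BM] [B'0 B'D B'M] BT I]] Bnz indB.
have [e Be [e' Be' e1]] : [set a + b | a in B & b in B'] 1 by rewrite -BT.
have inI a : B a -> B' a -> a = 0.
  by move=> h1 h2; have : (B `&` B') a by []; rewrite I.
have Bid b : B b -> b * e = b.
  move=> Bb; rewrite -[RHS]mulr1 -e1 mulrDr.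
  have -> : b * e' = 0 by apply: inI; [case: (BM e' _ Bb) | case: (B'M b _ Be')].
  by rewrite addr0.
have [x ex] : exists x, e * E x <> 0.
  apply: contrapT => noX; apply: Bnz; rewrite eqEsubset; split=> [b Bb|b /= -> //].
  rewrite /= -(Bid b Bb) -[e]mulr1 -E_sum mulr_sumr big1 ?mulr0 // => x _.
  by apply: contrapT => h; apply: noX; exists x.
have Bex : B (e * E x) by case: (BM (E x) _ Be).
exists x; rewrite eqEsubset; split=> a.
  move=> Ba; have BE b : B b -> B (b * E x) by move=> Bb; case: (BM (E x) _ Bb).
  have [|h|h] := indB [set b | B b /\ b * E x = b] [set b | B b /\ b * E x = 0].
  - split.
    + split=> /=; first by rewrite mul0r.
        by move=> b c [h1 h2] [h3 h4]; rewrite mulrDl h2 h4; split=> //; exact: BD.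
      move=> b c [h1 h2]; rewrite (A_comm c) -mulrA h2; split=> //; split=> //.
        by case: (BM b _ h1).
      by case: (BM b _ h1).
    + split=> /=; first by rewrite mul0r.
        by move=> b c [h1 h2] [h3 h4]; rewrite mulrDl h2 h4 addr0; split=> //; exact: BD.
      move=> b c [h1 h2]; rewrite (A_comm c) -mulrA h2 mulr0; split=> //; split=> //.
        by case: (BM b _ h1).
      by case: (BM b _ h1).
    + rewrite eqEsubset; split=> [b Bb|b [c [Bc _] [c' [Bc' _] <-]]]; last exact: BD.
      exists (b * E x); first by split; [exact: BE | rewrite -mulrA EE eqxx].
      exists (b - b * E x); last by rewrite addrC subrK.
      split; last by rewrite mulrBl -mulrA EE eqxx subrr.
      by apply: BD => //; rewrite -mulrN; case: (BM (- E x) _ Bb).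
    + rewrite eqEsubset; split=> [b [[_ /= h1] [_ h2]]|b /= ->]; first by rewrite -h1.
      by rewrite !mul0r.
  - case: ex; have : [set b | B b /\ b * E x = b] (e * E x).
      by split=> //; rewrite -mulrA EE eqxx.
    by rewrite h.
  - have : [set b | B b /\ b * E x = 0] (a - a * E x).
      split; last by rewrite mulrBl -mulrA EE eqxx subrr.
      by apply: BD => //; rewrite -mulrN; case: (BM (- E x) _ Ba).
    by rewrite h /= => /eqP; rewrite subr_eq0 eq_sym => /eqP.
rewrite /block_of /= => <-.
have [||h|<-] := @idempotent_summand x (e * E x) => //.
- by rewrite -mulrA EE eqxx.
- by rewrite mulrA -(mulrA e) (A_comm (E x)) !mulrA Bid // -mulrA EE eqxx.
- by case: (BM a _ Bex).
Qed.

Lemma has_dim1_block x : has_dim (block_of x) 1 <-> N x = 0.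
Proof.
have BE : block_of x (E x) by rewrite /block_of /= EE eqxx.
split=> [[v Bv vspan]|N0].
  have coord a : block_of x a -> exists c : F, a = c *: v 0.
    by move=> /vspan[c [-> _]]; exists (c 0 0); rewrite big_ord1.
  have [|c cN] := coord (N x); first by rewrite /block_of /= NE eqxx.
  have [b bE] := coord _ BE.
  have b0 : b != 0.
    by apply: contra_neq (E_neq0 x) => b0; rewrite bE b0 scale0r.
  have : (- c / b) *: E x + 1 *: N x = 0.
    by rewrite bE scalerA mulfVK // scaleNr scale1r cN addNr.
  by case/summand_free=> _; rewrite scale1r.
exists (fun=> E x) => // a; rewrite /block_of /= => ha.
have [al [nu e]] := summand_coord a x; rewrite ha N0 scaler0 addr0 in e.
exists (const_mx al); split=> [|c]; first by rewrite big_ord1 mxE.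
rewrite big_ord1 e => /eqP; rewrite -subr_eq0 -scalerBl scaler_eq0 (negbTE (E_neq0 x)).
by rewrite orbF subr_eq0 => /eqP ->; apply/rowP=> j; rewrite mxE (ord1 j).
Qed.

Lemma has_dim2_block x : has_dim (block_of x) 2 <-> N x <> 0.
Proof.
have BE : block_of x (E x) by rewrite /block_of /= EE eqxx.
split=> [[v Bv vspan] N0|/eqP N0].
  have coord a : block_of x a -> exists c : F, a = c *: E x.
    rewrite /block_of /= => <-; have [al [nu ->]] := summand_coord a x.
    by exists al; rewrite N0 scaler0 addr0.
  have [a ea] := coord _ (Bv ord0); have [b eb] := coord _ (Bv (fintype.lift ord0 ord0)).
  have B0 : block_of x 0 by rewrite /block_of /= mul0r.
  have [c [_ cuniq]] := vspan 0 B0.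
  have c0 : c = 0 by apply: cuniq; rewrite big1 // => i _; rewrite mxE scale0r.
  have lin (u w : F) : u *: v ord0 + w *: v (fintype.lift ord0 ord0) = 0 -> u = 0 /\ w = 0.
    move=> e; have cE : c = \row_i (if i == ord0 then u else w).
      by apply: cuniq; rewrite !big_ord_recl big_ord0 addr0 !mxE /= e.
    by split; [move/rowP: cE => /(_ ord0) | move/rowP: cE => /(_ (fintype.lift ord0 ord0))];
      rewrite c0 !mxE.
  have [|b0 /eqP a0] := lin b (- a); first by rewrite ea eb !scalerA mulrC mulNr scaleNr subrr.
  have [|h _] := lin 1 0; last by move/eqP: h; rewrite oner_eq0.
  by move: a0; rewrite oppr_eq0 ea => /eqP ->; rewrite !scale0r scaler0 addr0.
exists (fun i => if i == ord0 then E x else N x).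
  by move=> i; case: ifP => _ //; rewrite /block_of /= NE eqxx.
move=> a; rewrite /block_of /= => ha.
have [al [nu e]] := summand_coord a x; rewrite ha in e.
exists (\row_i (if i == ord0 then al else nu)); split=> [|c].
  by rewrite !big_ord_recl big_ord0 addr0 !mxE.
rewrite !big_ord_recl big_ord0 addr0 /= e => /eqP.
rewrite -subr_eq0 opprD addrACA -!scalerBl => /eqP/summand_free[/eqP h1 /eqP].
rewrite scaler_eq0 (negbTE N0) orbF => h2; apply/rowP=> j; rewrite mxE.
move: h1 h2; rewrite !subr_eq0 => /eqP -> /eqP ->.
by case: (unliftP ord0 j) => [k|] -> //=; rewrite ?ord1.
Qed.

Definition summand_mod (t : X + X) (V : lmodType A) : Prop :=
  match t with inl x => line_mod x V | inr x => plane_mod x V end.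

Definition summand_index : {pred X + X} :=
  fun t => match t with inl _ => true | inr x => N x != 0 end.

Lemma complete_list_summands (I : Type) (J : set I) (M : I -> lmodType A -> Prop)
    (psi : X + X -> I) :
  (forall t V, t \in summand_index -> (M (psi t) V <-> summand_mod t V)) ->
  J = [set psi t | t in [set t | t \in summand_index]] ->
  {in summand_index &, injective psi} -> complete_list J M.
Proof.
move=> hM -> psi_inj; split.
- move=> _ [t /= it <-].
  have [V hV] : exists V : lmodType A, summand_mod t V.
    by case: t it => x Nx; [exact: line_mod_exists | exact: plane_mod_exists Nx].
  by exists V; apply/hM.
- move=> _ V [t /= it <-] /hM-/(_ it).
  by case: t {it} => x; [exact: line_mod_indecomposable | exact: plane_mod_indecomposable].
- move=> _ _ V W [t /= it <-] [t' /= it' <-] /hM-/(_ it) hV /hM-/(_ it') hW.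
  have -> : (psi t = psi t') <-> t = t' by split=> [/psi_inj|->] //; exact.
  case: t t' {it it'} hV hW => x [x'|x'] /= hV hW.
  + by rewrite (line_mod_iso hV hW); split=> [->|[]].
  + by split=> // /(line_plane_not_iso hV hW).
  + by split=> // /mod_iso_sym/(line_plane_not_iso hW hV).
  + by rewrite (plane_mod_iso hV hW); split=> [->|[]].
move=> V fV iV; have [x [lV|pV]] := primary_decomposition fV iV.
  by exists (psi (inl x)); [exists (inl x) | apply/hM].
have Nx := N_neq0_plane pV.
by exists (psi (inr x)); [exists (inr x) | apply/hM].
Qed.

Lemma card_summand_index : #|summand_index| = (#|X| + #|[pred x | N x != 0%R]|)%N.
Proof.
by rewrite -!sum1_card big_sumType.
Qed.

Lemma block_card (P : {pred X}) (D : set (set A)) :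
  (forall B, D B <-> exists2 x, x \in P & B = block_of x) -> (D #= `I_#|P|)%card.
Proof.
move=> hD; have -> : D = [set block_of x | x in [set x | x \in P]].
  rewrite eqEsubset; split=> B; first by move/hD => [x Px ->]; exists x.
  by case=> x Px <-; apply/hD; exists x.
by apply: card_image_pred => x x' _ _; exact: block_of_inj.
Qed.

Lemma block_dim1_card :
  ([set B : set A | is_block B /\ has_dim B 1] #= `I_#|[pred x | N x == 0%R]|)%card.
Proof.
apply: block_card => B; split=> [[/is_blockP[x ->] /has_dim1_block/eqP h]|[x /eqP h ->]].
  by exists x.
by split; [exact: block_of_is_block | exact/has_dim1_block].
Qed.

Lemma block_dim2_card :
  ([set B : set A | is_block B /\ has_dim B 2] #= `I_#|[pred x | N x != 0%R]|)%card.
Proof.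
apply: block_card => B; split=> [[/is_blockP[x ->] /has_dim2_block/eqP h]|[x /eqP h ->]].
  by exists x.
by split; [exact: block_of_is_block | exact/has_dim2_block].
Qed.

Lemma block_dim (B : set A) : is_block B -> has_dim B 1 \/ has_dim B 2.
Proof.
move=> /is_blockP[x ->]; have [h|h] := pselect (N x = 0).
  by left; exact/has_dim1_block.
by right; exact/has_dim2_block.
Qed.

Variables (y z : A) (lam mu : X -> F).
Hypothesis yE : forall x, y * E x = lam x *: E x.
Hypothesis zE : forall x, z * E x = mu x *: E x + N x.
Hypothesis lam_mu_inj : forall x x', lam x = lam x' -> mu x = mu x' -> x = x'.

(** The pairs (lam, mu) separate the summands. At x' <> x, either lam differs and E x' v = 0 at
    once, or (mu x' - mu x) E x' v + N x' v = 0; applying N x' to this gives N x' v = 0 and then E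
    x' v = 0. The vector w allows for the second basis vector of V(k). *)
Lemma eigvec_summand x (V : lmodType A) (v w : V) : y *: v = (lam x)%:A *: v ->
  z *: v = w + (mu x)%:A *: v -> (forall x', x' != x -> E x' *: w = 0) ->
  [/\ forall x', x' != x -> E x' *: v = 0, E x *: v = v & N x *: v = w].
Proof.
move=> yv zv Ew; have Ev x' : x' != x -> E x' *: v = 0.
  move=> ne_x; have [el|nl] := eqVneq (lam x') (lam x).
    have nm : mu x' - mu x != 0.
      by rewrite subr_eq0; apply: contraNneq ne_x => em; apply/eqP/lam_mu_inj.
    have e1 : (mu x' - mu x)%:A *: (E x' *: v) + N x' *: v = 0.
      rewrite !scalerBl addrAC -alg_scaleA -scalerDl -zE A_comm -scalerA zv.
      by rewrite scalerDr Ew // add0r alg_scaleC subrr.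
    have e2 : N x' *: v = 0.
      have := congr1 (fun t => N x' *: t) e1.
      rewrite scaler0 scalerDr -alg_scaleC (scalerA (N x') (N x')) NN scale0r addr0.
      rewrite (scalerA (N x')) NE eqxx => e3.
      by rewrite -[LHS]scale1r -[1 in LHS]scale1r -(mulVf nm) alg_scaleM e3 scaler0.
    move: e1; rewrite e2 addr0 => e3.
    by rewrite -[LHS]scale1r -[1 in LHS]scale1r -(mulVf nm) alg_scaleM e3 scaler0.
  have nm : lam x' - lam x != 0 by rewrite subr_eq0.
  have e1 : (lam x' - lam x)%:A *: (E x' *: v) = 0.
    rewrite !scalerBl -alg_scaleA -yE A_comm -scalerA yv alg_scaleC; exact: subrr.
  by rewrite -[LHS]scale1r -[1 in LHS]scale1r -(mulVf nm) alg_scaleM e1 scaler0.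
have Exv : E x *: v = v.
  rewrite -[RHS]scale1r -E_sum scaler_suml (bigD1 x) //= big1 ?addr0 //.
split=> //; have : z *: v = (mu x)%:A *: v + N x *: v.
  by rewrite -{1}Exv scalerA zE scalerDl (alg_scaleA (mu x)) Exv.
by rewrite zv addrC => /addrI.
Qed.

Lemma line_modP x (V : lmodType A) : line_mod x V <->
  exists v : V, [/\ is_basis (fun _ : 'I_1 => v), y *: v = (lam x)%:A *: v
    & z *: v = (mu x)%:A *: v].
Proof.
split=> [[pV [v [bv Nv]]]|[v [bv yv zv]]].
  exists v; split=> //.
    by rewrite -{1}(pV v) scalerA yE alg_scaleA pV.
  by rewrite -{1}(pV v) scalerA zE scalerDl Nv addr0 alg_scaleA pV.
have [_ Ev Nv] : [/\ forall x', x' != x -> E x' *: v = 0, E x *: v = v & N x *: v = 0].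
  by apply: eigvec_summand => [||x' _]; rewrite ?add0r ?scaler0.
split; last by exists v.
move=> t; have [_ /(_ t)[c ->]] := basis1_coord bv.
by rewrite -alg_scaleC Ev.
Qed.

Lemma plane_modP x (V : lmodType A) : plane_mod x V <->
  exists v1 v2 : V, [/\ is_basis (fun i : 'I_2 => if i == ord0 then v1 else v2),
    y *: v1 = (lam x)%:A *: v1 /\ y *: v2 = (lam x)%:A *: v2,
    z *: v1 = (mu x)%:A *: v1 & z *: v2 = v1 + (mu x)%:A *: v2].
Proof.
split=> [[pV [v bv]]|[v1 [v2 [bv [yv1 yv2] zv1 zv2]]]].
  have yV (t : V) : y *: t = (lam x)%:A *: t.
    by rewrite -{1}(pV t) scalerA yE alg_scaleA pV.
  have zV (t : V) : z *: t = N x *: t + (mu x)%:A *: t.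
    by rewrite -{1}(pV t) scalerA zE scalerDl alg_scaleA pV addrC.
  by exists (N x *: v), v; split=> //; rewrite zV scalerA NN scale0r add0r.
have [Ev1' Ev1 Nv1] : [/\ forall x', x' != x -> E x' *: v1 = 0, E x *: v1 = v1 & N x *: v1 = 0].
  by apply: eigvec_summand => [||x' _]; rewrite ?add0r ?scaler0.
have [_ Ev2 Nv2] := eigvec_summand yv2 zv2 Ev1'.
split; last by exists v2; rewrite Nv2.
move=> t; have [c1 [c2 [cE _ _ _ _]]] := basis2_coord bv.
by rewrite (cE t) scalerDr -!alg_scaleC Ev1 Ev2.
Qed.

End LocalSummands.

(** * Chinese remainder idempotents *)

Section ChineseRemainder.
Variables (F : fieldType) (I : finType) (p : I -> {poly F}).
Hypothesis p_coprime : forall i j, i != j -> coprimep (p i) (p j).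

Lemma coprimep_prod_neq i (P : pred I) : ~~ P i -> coprimep (p i) (\prod_(j | P j) p j).
Proof.
move=> nPi; elim/big_rec: _ => [|j r Pj cop]; first exact: coprimep1.
by rewrite coprimepMr cop andbT p_coprime //; apply: contraNneq nPi => ->.
Qed.

Lemma prod_coprime_dvdp (r : {poly F}) : (forall i, p i %| r) -> \prod_i p i %| r.
Proof.
move=> pr; have: uniq (index_enum I) by exact: index_enum_uniq.
elim: (index_enum I) => [|i s IHs] /=; first by rewrite big_nil dvd1p.
case/andP=> i_s us; rewrite big_cons Gauss_dvdp ?pr ?IHs //.
rewrite big_seq; elim/big_rec: _ => [|j t js cop]; first exact: coprimep1.
by rewrite coprimepMr cop andbT p_coprime //; apply: contraNneq i_s => ->.
Qed.

(** By Bezout, u i is a multiple of the product of the other factors that is 1 modulo p i.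
    Divisibility replaces equality in a quotient ring, so the statements can be evaluated at z on
    each eigenspace of y. *)
Lemma crt_idempotents : exists u : I -> {poly F},
  [/\ forall i, \prod_j p j %| p i * u i,
      forall i i', \prod_j p j %| u i * u i' - (if i == i' then u i else 0)
    & \prod_j p j %| 1 - \sum_i u i].
Proof.
pose r i := \prod_(j | j != i) p j.
have prod_r i : \prod_j p j = p i * r i by rewrite (bigD1 i).
have bez i : exists v, v.1 * p i + v.2 * r i = 1.
  by apply/Bezout_eq1_coprimepP; apply: coprimep_prod_neq; rewrite eqxx.
have [v vE] := choice bez.
have [u uE] : exists u, forall i, u i = (v i).2 * r i by exists (fun i => (v i).2 * r i).
have u1 i : 1 - u i = (v i).1 * p i by rewrite uE -(vE i) addrK.
have pu i j : i != j -> p i %| u j.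
  by move=> ne; rewrite uE dvdp_mull // /r (bigD1 i) //= dvdp_mulr.
exists u; split=> [i|i i'|].
- by rewrite (prod_r i) uE mulrCA dvdp_mull.
- case: eqP => [<-|/eqP ne].
    have -> : u i * u i - u i = - ((1 - u i) * u i) by ring.
    by rewrite u1 -mulrA dvdpNr dvdp_mull // (prod_r i) uE mulrCA dvdp_mull.
  rewrite subr0; apply: prod_coprime_dvdp => j.
  have [<-|ne_ji] := eqVneq i j; first by rewrite dvdp_mull // pu.
  by rewrite dvdp_mulr // pu // eq_sym.
- apply: prod_coprime_dvdp => i; rewrite (bigD1 i) //= opprD addrA u1.
  rewrite dvdp_subr ?dvdp_mull //.
  by elim/big_rec: _ => [|j t ne IH]; rewrite ?dvdp0 // dvdp_addr // pu // eq_sym.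
Qed.

End ChineseRemainder.

(** The dimension count. Expressing the independent family B through the spanning family b of the
    same size gives a square matrix with trivial left kernel, hence invertible, and b inherits the
    independence of B. *)
Lemma free_of_span (F : fieldType) (V : lmodType F) (I : finType) (B b : I -> V) :
  (forall c : I -> F, \sum_i c i *: B i = 0 -> forall i, c i = 0) ->
  (forall v, exists c : I -> F, v = \sum_i c i *: b i) ->
  forall c : I -> F, \sum_i c i *: b i = 0 -> forall i, c i = 0.
Proof.
move=> B_free b_span; have [C CE] := choice (fun i => b_span (B i)).
pose M : 'M[F]_#|I| := \matrix_(i, j) C (enum_val i) (enum_val j).
have sumE (x : 'rV[F]_#|I|) :
    \sum_i x 0 i *: B (enum_val i) = \sum_j (x *m M) 0 j *: b (enum_val j).
  under eq_bigr do rewrite CE scaler_sumr.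
  rewrite exchange_big /= (reindex (@enum_val I I)) /=; last first.
    by apply: onW_bij; exact: enum_val_bij.
  apply: eq_bigr => j _; rewrite mxE scaler_suml.
  by apply: eq_bigr => i _; rewrite mxE scalerA.
have x0 (x : 'rV[F]_#|I|) : \sum_i x 0 i *: B (enum_val i) = 0 -> x = 0.
  move=> e; apply/rowP=> i; rewrite mxE -(enum_valK i).
  apply: (B_free (fun i => x 0 (enum_rank i))).
  rewrite (reindex (@enum_val I I)) /=; last by apply: onW_bij; exact: enum_val_bij.
  by rewrite -[RHS]e; apply: eq_bigr => k _; rewrite enum_valK.
have M_free : row_free M.
  apply: inj_row_free => x xM; apply: x0; rewrite sumE xM big1 // => j _.
  by rewrite mxE scale0r.
have M_unit : M \in unitmx by rewrite -row_free_unit.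
move=> c e; pose y : 'rV[F]_#|I| := \row_j c (enum_val j).
have y0 : y = 0.
  rewrite -(mulmxKV M_unit y) (x0 (y *m invmx M)) ?mul0mx // sumE mulmxKV //.
  rewrite -[RHS]e [RHS](reindex (@enum_val I I)) /=; last first.
    by apply: onW_bij; exact: enum_val_bij.
  by apply: eq_bigr => k _; rewrite mxE.
by move=> i; rewrite -(enum_rankK i); move/rowP: y0 => /(_ (enum_rank i)); rewrite !mxE.
Qed.

(** * Simultaneous spectral decomposition of y and z *)

Section SpectralIdempotents.
Variables (F : fieldType) (A : algType F) (n d : nat) (zeta : F) (y z : A).
Variable mu : nat -> nat -> F.
Hypotheses (hz : n.-primitive_root zeta) (d_gt0 : (0 < d)%N).
Hypothesis A_comm : forall a b : A, a * b = b * a.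
Hypothesis yn1 : y ^+ n = 1.
Hypothesis A_gen : forall P : A -> Prop, P 1 ->
  (forall a b, P a -> P b -> P (a + b)) -> (forall c a, P a -> P (c *: a)) ->
  (forall a, P a -> P (y * a)) -> (forall a, P a -> P (z * a)) -> forall a, P a.
Hypothesis A_free : exists B : 'I_n * 'I_d -> A,
  forall c : 'I_n * 'I_d -> F, \sum_p c p *: B p = 0 -> forall p, c p = 0.
Hypothesis mu_root : forall k, (k < n)%N ->
  eigproj n zeta y k * \prod_(j < d) (z - (mu k j)%:A) = 0.
Hypothesis mu_inj : forall k j j', (k < n)%N -> (0 < j < d)%N -> (0 < j' < d)%N ->
  mu k j = mu k j' -> j = j'.
Hypothesis mu0_simple : forall k j, (k < n)%N -> (d %| k)%N -> (0 < j < d)%N ->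
  mu k 0 <> mu k j.
Hypothesis mu0_double : forall k, (k < n)%N -> ~~ (d %| k)%N ->
  exists2 j, (0 < j < d)%N & mu k 0 = mu k j.

Let e k := eigproj n zeta y k.
Let ev : {poly F} -> A := horner_alg z.

(* The multiplicity with which (z - mu k j) divides the minimal polynomial of z on
   the zeta^k-eigenspace of y; the double root mu k 0 is counted at its index j > 0. *)
Definition root_mult k j : nat :=
  if (d %| k)%N then 1 else if j == 0%N then 0 else (mu k j == mu k 0).+1.

Definition root_factor k j : {poly F} := ('X - (mu k j)%:P) ^+ root_mult k j.

Lemma root_factor_coprime k (j j' : 'I_d) : (k < n)%N -> j != j' ->
  coprimep (root_factor k j) (root_factor k j').
Proof.
move=> ltkn ne_j.
have cop : mu k j <> mu k j' -> coprimep (root_factor k j) (root_factor k j').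
  move=> ne; apply/coprimep_expl/coprimep_expr; rewrite coprimep_XsubC2 // subr_eq0.
  by apply/eqP=> e1; apply: ne.
have [j0|j_gt0] := posnP j; have [j'0|j'_gt0] := posnP j'.
- by case/eqP: ne_j; apply/val_inj; rewrite /= j0 j'0.
- have [dk|dk] := boolP (d %| k)%N.
    by apply: cop; rewrite j0; apply: mu0_simple => //; rewrite j'_gt0 ltn_ord.
  by rewrite /root_factor /root_mult (negbTE dk) j0 expr0 coprime1p.
- have [dk|dk] := boolP (d %| k)%N.
    by apply: cop; rewrite j'0; apply/nesym; apply: mu0_simple => //; rewrite j_gt0 ltn_ord.
  by rewrite /root_factor /root_mult (negbTE dk) j'0 expr0 coprimep1.
apply: cop => emu; case/eqP: ne_j; apply/val_inj.
by apply: (mu_inj ltkn) emu; rewrite ?j_gt0 ?j'_gt0 ltn_ord.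
Qed.

(** For d not dividing k, the factor dropped at j = 0 is the second copy of the factor at the unique
    j > 0 with mu k j = mu k 0. *)
Lemma prod_root_factor k : (k < n)%N ->
  \prod_(j < d) root_factor k j = \prod_(j < d) ('X - (mu k j)%:P).
Proof.
move=> ltkn; have [dk|dk] := boolP (d %| k)%N.
  by apply: eq_bigr => j _; rewrite /root_factor /root_mult dk expr1.
pose o : 'I_d := Ordinal d_gt0.
rewrite (bigD1 o) //= [RHS](bigD1 o) //= {1}/root_factor /root_mult (negbTE dk) /= expr0 mul1r.
have [j0 /andP[j0_gt0 ltj0] emu] := mu0_double ltkn dk.
have -> : \prod_(j < d | j != o) root_factor k j =
    \prod_(j < d | j != o) (('X - (mu k j)%:P) * ('X - (mu k j)%:P) ^+ (mu k j == mu k 0)).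
  apply: eq_bigr => j ne_j; rewrite /root_factor /root_mult (negbTE dk).
  by rewrite -val_eqE /= in ne_j; rewrite (negbTE ne_j) exprS.
rewrite big_split mulrC /=; congr (_ * _).
rewrite (bigD1 (Ordinal ltj0)) /=; last by rewrite -val_eqE /= -lt0n.
rewrite emu eqxx expr1 big1 ?mulr1 // => j /andP[jo jj0].
case: eqP => // emuj; case/eqP: jj0; apply/val_inj => /=.
apply: (mu_inj ltkn) emuj; rewrite ?j0_gt0 // ltn_ord andbT lt0n.
by rewrite -val_eqE /= in jo.
Qed.

Variable u : 'I_n -> 'I_d -> {poly F}.
Hypothesis uP : forall k : 'I_n,
  [/\ forall j : 'I_d, \prod_(j < d) root_factor k j %| root_factor k j * u k j,
      forall j j' : 'I_d, \prod_(j < d) root_factor k j %|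
        u k j * u k j' - (if j == j' then u k j else 0)
    & \prod_(j < d) root_factor k j %| 1 - \sum_j u k j].

Lemma ev_dvd (k : 'I_n) (r : {poly F}) : \prod_(j < d) root_factor k j %| r -> e k * ev r = 0.
Proof.
rewrite prod_root_factor // => /dvdpP[t ->].
rewrite /ev rmorphM /= rmorph_prod A_comm -mulrA [X in _ * X]A_comm.
have -> : \prod_(j < d) horner_alg z ('X - (mu k j)%:P) = \prod_(j < d) (z - (mu k j)%:A).
  by apply: eq_bigr => j _; rewrite rmorphB /= horner_algX horner_algC.
by rewrite mu_root // mulr0.
Qed.

Definition spec_idem (p : 'I_n * 'I_d) : A := e p.1 * ev (u p.1 p.2).

Lemma spec_idem_mul p p' : spec_idem p * spec_idem p' = if p == p' then spec_idem p else 0.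
Proof.
case: p p' => k j [k' j']; rewrite /spec_idem /= xpair_eqE.
rewrite -mulrA (A_comm (ev _)) -!mulrA (A_comm _ (ev _)) mulrA.
have -> : e k * e k' = if k == k' then e k' else 0.
  exact: (mul_eigproj_eigvec hz (ltn_ord k) (ltn_ord k') (mul_eigproj hz yn1 k')).
case: eqP => [<-|_] /=; last by rewrite mul0r.
have [_ uu _] := uP k; have := ev_dvd (uu j j').
rewrite /ev rmorphB rmorphM /= mulrBr => /eqP; rewrite subr_eq0 => /eqP ->.
by case: ifP => // _; rewrite rmorph0 mulr0.
Qed.

Lemma spec_idem_sum : \sum_p spec_idem p = 1.
Proof.
rewrite -(pair_bigA _ (fun (k : 'I_n) (j : 'I_d) => e k * ev (u k j))) /=.
rewrite -(sum_eigproj hz y); apply: eq_bigr => k _.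
rewrite -mulr_sumr -rmorph_sum /=.
have [_ _ u1] := uP k; have := ev_dvd u1.
rewrite /ev rmorphB rmorph1 mulrBr mulr1 => /eqP.
by rewrite subr_eq0 => /eqP <-.
Qed.

Lemma spec_idem_root (p : 'I_n * 'I_d) : (z - (mu p.1 p.2)%:A) ^+ root_mult p.1 p.2 * spec_idem p = 0.
Proof.
case: p => k j /=; rewrite /spec_idem mulrA [_ * e k]A_comm -mulrA.
have [u0 _ _] := uP k; rewrite -[RHS](ev_dvd (u0 j)); congr (_ * _).
by rewrite /ev rmorphM rmorphXn rmorphB /= horner_algX horner_algC.
Qed.

Lemma spec_idem_y (p : 'I_n * 'I_d) : y * spec_idem p = zeta ^+ p.1 *: spec_idem p.
Proof. by rewrite /spec_idem mulrA mul_eigproj // scalerAl. Qed.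

(** The pairs of positive multiplicity; at the others the idempotent is 0 and must not be counted as
    a summand. *)
Definition spec_good : {pred 'I_n * 'I_d} := fun p => (d %| p.1)%N || (0 < p.2)%N.
Definition spec_double (p : 'I_n * 'I_d) := ~~ (d %| p.1)%N && (mu p.1 p.2 == mu p.1 0).

Definition spec_type := {p : 'I_n * 'I_d | p \in spec_good}.

Definition spec_lambda (x : spec_type) : F := zeta ^+ (val x).1.
Definition spec_mu (x : spec_type) : F := mu (val x).1 (val x).2.
Definition spec_E (x : spec_type) : A := spec_idem (val x).
Definition spec_N (x : spec_type) : A := (z - (spec_mu x)%:A) * spec_E x.

Lemma spec_bad p : p \notin spec_good -> spec_idem p = 0.
Proof.
case: p => k j; rewrite unfold_in negb_or /= -leqNgt leqn0 => /andP[dk /eqP j0].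
by have := spec_idem_root (k, j); rewrite /root_mult /= (negbTE dk) j0 expr0 mul1r.
Qed.

Lemma spec_EE x x' : spec_E x * spec_E x' = if x == x' then spec_E x else 0.
Proof. by rewrite spec_idem_mul. Qed.

Lemma spec_E_sum : \sum_x spec_E x = 1.
Proof.
rewrite -spec_idem_sum [RHS](bigID (mem spec_good)) /= [X in _ = _ + X]big1 ?addr0; last first.
  by move=> p; exact: spec_bad.
by rewrite -(big_sub spec_good spec_idem).
Qed.

Lemma spec_EN x : spec_E x * spec_N x = spec_N x.
Proof. by rewrite /spec_N A_comm -mulrA spec_EE eqxx. Qed.

Lemma spec_simple x : ~~ spec_double (val x) -> spec_N x = 0.
Proof.
case: x => -[k j] gx; rewrite negb_and negbK /= => dbl.
have := spec_idem_root (k, j); rewrite /spec_N /spec_E /spec_mu /= /root_mult.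
move: gx dbl; rewrite unfold_in /=; case: (d %| k)%N => /= [_ _|j_gt0 /negbTE ->].
  by rewrite expr1.
by rewrite gtn_eqF // expr1.
Qed.

Lemma spec_NN x : spec_N x * spec_N x = 0.
Proof.
have [dbl|/spec_simple ->] := boolP (spec_double (val x)); last exact: mul0r.
rewrite /spec_N -mulrA (A_comm (spec_E x)) -mulrA spec_EE eqxx mulrA -expr2.
have := spec_idem_root (val x); case: x dbl => -[k j] gx /andP[/= dk emu].
rewrite /spec_E /spec_mu /= /root_mult (negbTE dk) emu.
by move: gx; rewrite unfold_in /= (negbTE dk) /= => /gtn_eqF ->.
Qed.

Lemma spec_yE x : y * spec_E x = spec_lambda x *: spec_E x.
Proof. exact: spec_idem_y. Qed.

Lemma spec_zE x : z * spec_E x = spec_mu x *: spec_E x + spec_N x.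
Proof. by rewrite /spec_N mulrBl mulr_algl addrC subrK. Qed.

Lemma spec_span a : exists alpha nu : spec_type -> F,
  a = \sum_x (alpha x *: spec_E x + nu x *: spec_N x).
Proof.
move: a; apply: A_gen.
- exists (fun=> 1), (fun=> 0); rewrite -spec_E_sum; apply: eq_bigr => x _.
  by rewrite scale1r scale0r addr0.
- move=> a b [a1 [n1 ->]] [a2 [n2 ->]].
  exists (fun x => a1 x + a2 x), (fun x => n1 x + n2 x); rewrite -big_split.
  by apply: eq_bigr => x _; rewrite !scalerDl addrACA.
- move=> c a [a1 [n1 ->]]; exists (fun x => c * a1 x), (fun x => c * n1 x).
  by rewrite scaler_sumr; apply: eq_bigr => x _; rewrite scalerDr !scalerA.
- move=> a [a1 [n1 ->]]; exists (fun x => spec_lambda x * a1 x),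
    (fun x => spec_lambda x * n1 x).
  rewrite mulr_sumr; apply: eq_bigr => x _.
  have yN : y * spec_N x = spec_lambda x *: spec_N x.
    by rewrite /spec_N mulrA (A_comm y) -mulrA spec_yE -scalerAr.
  by rewrite mulrDr -!scalerAr spec_yE yN !scalerA ![_ * zeta ^+ _]mulrC.
move=> a [a1 [n1 ->]]; exists (fun x => spec_mu x * a1 x),
  (fun x => spec_mu x * n1 x + a1 x).
rewrite mulr_sumr; apply: eq_bigr => x _.
have zN : z * spec_N x = spec_mu x *: spec_N x.
  rewrite -{1}spec_EN mulrA spec_zE mulrDl spec_NN addr0 -scalerAl.
  by rewrite spec_EN.
rewrite mulrDr -!scalerAr spec_zE zN scalerDr !scalerA scalerDl.
by rewrite ![_ * spec_mu _]mulrC -addrA [a1 x *: _ + _]addrC.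
Qed.

(** The family b has one member for each of the nd index pairs: E at the good ones and, at (k, 0)
    with d not dividing k, the N of the double root over k. It spans the algebra, so it is
    independent, and no member is 0. *)
Lemma spec_EN_neq0 : (forall x, spec_E x != 0) /\
  (forall x, spec_double (val x) -> spec_N x != 0).
Proof.
(* The sum over j names N without choosing the double root, all its other terms being 0. *)
pose b p := if p \in spec_good then spec_idem p
  else \sum_(j < d) (z - (mu p.1 j)%:A) * spec_idem (p.1, j).
have bE x : b (val x) = spec_E x by rewrite /b (valP x).
have bN x : spec_double (val x) -> b ((val x).1, Ordinal d_gt0) = spec_N x.
  case: x => -[k j] gx /andP[/= dk /eqP emu].
  have j_gt0 : (0 < j)%N by have := gx; rewrite unfold_in /= (negbTE dk).
  rewrite /b unfold_in /= (negbTE dk) /= (bigD1 j) //= big1 ?addr0 // => j' ne_j.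
  have [g'|g'] := boolP ((k, j') \in spec_good); last by rewrite spec_bad ?mulr0.
  apply: (@spec_simple (exist _ (k, j') g')); rewrite /spec_double /= dk /=.
  apply: contra_neqN ne_j => /eqP emu'; apply/val_inj.
  apply: (@mu_inj k) => //; rewrite ?emu ?emu' // ltn_ord ?j_gt0 // andbT.
  by move: g'; rewrite unfold_in /= (negbTE dk).
have [B B_free] := A_free.
have b_free : forall c : 'I_n * 'I_d -> F, \sum_p c p *: b p = 0 -> forall p, c p = 0.
  apply: free_of_span B_free _ => a; have [alpha [nu ->]] := spec_span a.
  elim/big_rec: _ => [|x t _ [c ->]].
    by exists (fun=> 0); rewrite big1 // => p _; rewrite scale0r.
  have single p w : \sum_p' (if p' == p then w else 0) *: b p' = w *: b p.
    rewrite (bigD1 p) //= eqxx big1 ?addr0 // => p' /negbTE ->.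
    exact: scale0r.
  have [nN [p pN]] : exists nN p, nu x *: spec_N x = nN *: b p.
    have [dbl|dbl] := boolP (spec_double (val x)).
      by exists (nu x), ((val x).1, Ordinal d_gt0); rewrite bN.
    by exists 0, (val x); rewrite spec_simple // scaler0 scale0r.
  exists (fun p' => (if p' == val x then alpha x else 0) + (if p' == p then nN else 0) + c p').
  under [RHS]eq_bigr do rewrite !scalerDl.
  by rewrite !big_split /= !single bE pN.
have b_neq0 p : b p != 0.
  apply/eqP=> bp0; have := b_free (fun p' => if p' == p then 1 else 0).
  rewrite (bigD1 p) //= eqxx bp0 scaler0 add0r big1 => [/(_ erefl p)|p' /negbTE ->].
    by rewrite eqxx => /eqP; rewrite oner_eq0.
  exact: scale0r.
by split=> x; [rewrite -bE | move=> /bN <-].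
Qed.

Lemma spec_N_eq0 x : (spec_N x == 0) = ~~ spec_double (val x).
Proof.
apply/idP/idP => [/eqP N0|/spec_simple -> //].
by apply/negP=> /(spec_EN_neq0.2 x); rewrite N0 eqxx.
Qed.

Lemma spec_good_gt0 (x : spec_type) : ~~ (d %| (val x).1)%N -> (0 < (val x).2)%N.
Proof. by have := valP x; rewrite unfold_in => /orP[->|]. Qed.

Lemma spec_lambda_mu_inj x x' : spec_lambda x = spec_lambda x' ->
  spec_mu x = spec_mu x' -> x = x'.
Proof.
rewrite /spec_lambda /spec_mu => /eqP; rewrite (eq_prim_root_expr hz) !modn_small //.
have := @spec_good_gt0 x; have := @spec_good_gt0 x'.
case: x x' => [[k j] gx] [[k' j'] gx'] /= gt' gt /eqP/val_inj kk' emu.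
apply/val_inj; rewrite /= -kk' in gt' emu gx' *; congr (_, _); apply/val_inj => /=.
have [j0|j_gt0] := posnP j; have [j'0|j'_gt0] := posnP j'; rewrite ?j0 ?j'0 //.
- rewrite j0 in emu gt; have dk : (d %| k)%N by apply: contraT => /gt.
  by case: (mu0_simple _ dk _ emu); rewrite ?j'_gt0 ltn_ord.
- rewrite j'0 in emu gt'; have dk : (d %| k)%N by apply: contraT => /gt'.
  by case: (mu0_simple _ dk _ (esym emu)); rewrite ?j_gt0 ltn_ord.
by apply: (mu_inj _ _ _ emu); rewrite ?j_gt0 ?j'_gt0 ltn_ord.
Qed.

Lemma spec_double_inj (x x' : spec_type) : spec_double (val x) -> spec_double (val x') ->
  (val x).1 = (val x').1 :> nat -> x = x'.
Proof.
case/andP=> _ /eqP ex /andP[_ /eqP ex'] kk'; apply: spec_lambda_mu_inj.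
  by rewrite /spec_lambda kk'.
by rewrite /spec_mu ex ex' kk'.
Qed.

Lemma spec_double_exists (k : 'I_n) : ~~ (d %| k)%N ->
  exists2 x : spec_type, spec_double (val x) & (val x).1 = k.
Proof.
move=> dk; have [j /andP[j_gt0 ltjd] emu] := mu0_double (ltn_ord k) dk.
have gx : (k, Ordinal ltjd) \in spec_good by rewrite unfold_in /= j_gt0 orbT.
exists (exist (fun p => p \in spec_good) _ gx) => //.
by rewrite /spec_double /= dk emu eqxx.
Qed.

Lemma card_spec_double :
  #|[pred x : spec_type | spec_N x != 0%R]| = #|[pred k : 'I_n | ~~ (d %| k)%N]|.
Proof.
have -> : #|[pred k : 'I_n | ~~ (d %| k)%N]| =
    #|[set (val x).1 | x in [pred x : spec_type | spec_double (val x)]]%SET|.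
  apply: eq_card => k; rewrite !inE; apply/idP/imsetP => [/spec_double_exists[x dx <-]|].
    by exists x.
  by case=> x; rewrite inE => /andP[dk _] ->.
rewrite card_in_imset => [|x x' dx dx' exx]; last first.
  by apply: spec_double_inj => //; rewrite exx.
by apply: eq_card => x; rewrite !inE spec_N_eq0 negbK.
Qed.

(** The excluded pairs are the (k, 0) with d not dividing k. *)
Lemma card_spec_type :
  (#|{: spec_type}| + #|[pred k : 'I_n | ~~ (d %| k)%N]| = n * d)%N.
Proof.
have <- : #|{: 'I_n * 'I_d}| = (n * d)%N by rewrite card_prod !card_ord.
rewrite card_sig -(cardC [pred p | p \in spec_good]); congr (_ + _)%N.
pose o : 'I_d := Ordinal d_gt0.
have o_inj : injective (fun k : 'I_n => (k, o)) by move=> k k' [].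
rewrite -(card_imset _ o_inj); apply: eq_card => -[k j]; rewrite !inE unfold_in /=.
rewrite negb_or -leqNgt leqn0; apply/imsetP/andP => [[k' dk' [-> ->]]|[dk /eqP j0]] //.
by exists k => //; congr (_, _); apply/val_inj.
Qed.

End SpectralIdempotents.

Lemma card_ord_ndvd n d : (0 < d)%N -> (d %| n)%N ->
  #|[pred k : 'I_n | ~~ (d %| k)%N]| = (n - n %/ d)%N.
Proof.
move=> d_gt0 dn; have := cardC [pred k : 'I_n | (d %| k)%N]; rewrite card_ord => cn.
suff e : #|[pred k : 'I_n | (d %| k)%N]| = (n %/ d)%N 
  by rewrite -[X in (X - _)%N]cn e addKn; exact: eq_card.
have ltdn (i : 'I_(n %/ d)) : (d * i < n)%N by rewrite mulnC -ltn_divRL.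
rewrite -[RHS]card_ord -(card_imset _ (f := fun i => Ordinal (ltdn i))); last first.
  move=> i i' /(congr1 val)/= /eqP; rewrite eqn_pmul2l // => /eqP e; exact/val_inj.
apply: eq_card => k; rewrite !inE; apply/idP/imsetP => [/dvdnP[i ki]|[i _ ->]]; last first.
  exact: dvdn_mulr.
have lti : (i < n %/ d)%N by rewrite ltn_divRL // -ki.
by exists (Ordinal lti) => //; apply/val_inj; rewrite /= ki mulnC.
Qed.

(** * The eigenvalues *)

Section ComplexRoots.
Variable R : realType.
Local Notation C := R[i].

Definition cis (a : R) : C := (cos a +i* sin a)%C.

Lemma cisD a b : cis (a + b) = cis a * cis b.
Proof. by rewrite /cis cosD sinD; simpc; congr (_ +i* _)%C; rewrite addrC. Qed.

Lemma cis0 : cis 0 = 1.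
Proof. by rewrite /cis cos0 sin0. Qed.

Lemma cisX a k : cis a ^+ k = cis (k%:R * a).
Proof.
elim: k => [|k IHk]; first by rewrite expr0 mul0r cis0.
by rewrite exprS IHk -cisD -natr1 mulrDl mul1r addrC.
Qed.

Lemma cisN a : cis (- a) * cis a = 1.
Proof. by rewrite -cisD addNr cis0. Qed.

Lemma cis_pi : cis pi = -1.
Proof. by apply/eqP; rewrite /cis cospi sinpi eq_complex /= oppr0 !eqxx. Qed.

Lemma cis_addN a : cis a + cis (- a) = 2 * (cos a)%:C%C.
Proof.
apply/eqP; rewrite /cis cosN sinN mulr_natl mulr2n eq_complex /=.
by rewrite subrr addr0 !eqxx.
Qed.

Lemma cis_subN_neq0 a : 0 < a < pi -> cis a - cis (- a) != 0.
Proof.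
move=> /sin_gt0_pi sina; rewrite /cis cosN sinN subr_eq0 eq_complex /= negb_and.
by apply/orP; right; rewrite -subr_eq0 opprK gt_eqF // addr_gt0.
Qed.

Lemma cos_lt1_sqr (a : R) : 0 < a < pi -> cos a ^+ 2 != 1.
Proof.
move=> /sin_gt0_pi sina; rewrite -(cos2Dsin2 a) -subr_eq0 opprD addrA subrr sub0r.
by rewrite oppr_eq0 sqrf_eq0 gt_eqF.
Qed.

Lemma cis_neq1 a : 0 < a < pi *+ 2 -> cis a != 1.
Proof.
move=> /andP[a0 a2]; apply/eqP=> e.
have ha : 0 < a / 2 < pi by rewrite divr_gt0 //= ltr_pdivrMr // mulr_natr.
have := cos_lt1_sqr ha; have : cos a = 1 by case: e.
rewrite {1}(splitr a) -mulr2n cos_mulr2n => h.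
have -> : cos (a / 2) ^+ 2 = 1 by lra.
by rewrite eqxx.
Qed.

Variables (n d : nat).
Hypotheses (n_gt0 : (0 < n)%N) (d_gt0 : (0 < d)%N) (hdn : (d %| n)%N).
Let n0 : n%:R != 0 :> R. Proof. by rewrite pnatr_eq0 -lt0n. Qed.
Let d0 : d%:R != 0 :> R. Proof. by rewrite pnatr_eq0 -lt0n. Qed.

Lemma omegaC_cis k : omegaC R n k = cis (2 * k%:R * pi / n%:R).
Proof. by []. Qed.

Lemma omegaCX k : omegaC R n k = omegaC R n 1 ^+ k.
Proof. by rewrite !omegaC_cis cisX; congr cis; field. Qed.

Lemma omegaC_prim : n.-primitive_root (omegaC R n 1).
Proof.
apply/andP; split=> //; apply/forallP=> i; rewrite unity_rootE -omegaCX omegaC_cis.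
apply/eqP; have [->|ne_i] := eqVneq i.+1 n.
  apply/eqP; have -> : 2 * n%:R * pi / n%:R = pi + pi :> R by field.
  by rewrite cisD cis_pi mulrNN mulr1.
apply/negbTE/cis_neq1; have lt_in : (i.+1 < n)%N by rewrite ltn_neqAle ne_i ltn_ord.
rewrite divr_gt0 ?mulr_gt0 ?pi_gt0 ?ltr0n //= ltr_pdivrMr ?ltr0n //.
by rewrite -[pi *+ 2]mulr_natl -!mulrA ltr_pM2l ?ltr0n // mulrC ltr_pM2l ?pi_gt0 // ltr_nat.
Qed.

Lemma omegaC_expn k : omegaC R n k ^+ (n %/ d) = cis (pi * k%:R / d%:R) ^+ 2.
Proof.
rewrite omegaC_cis !cisX; congr cis.
have -> : (n%:R : R) = (n %/ d)%:R * d%:R by rewrite -natrM divnK.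
have : (n %/ d)%:R != 0 :> R by rewrite pnatr_eq0 -lt0n divn_gt0 // dvdn_leq.
by move=> m0; field; rewrite m0 d0.
Qed.

Lemma omegaC_expn_eq1 k : (omegaC R n k ^+ (n %/ d) == 1) = (d %| k)%N.
Proof.
rewrite omegaCX -exprM -(prim_order_dvd omegaC_prim).
by rewrite -{1}(divnK hdn) mulnC dvdn_pmul2r // divn_gt0 // dvdn_leq.
Qed.

End ComplexRoots.

(** * Roots of the polynomials F_d *)

Lemma rmorph_dickson (B B' : pzRingType) (f : {rmorphism B -> B'}) (y z : B) s :
  f (dickson y z s) = dickson (f y) (f z) s.
Proof.
suff: f (dickson y z s) = dickson (f y) (f z) s /\
      f (dickson y z s.+1) = dickson (f y) (f z) s.+1 by case.
elim: s => [|s [IH1 IH2]]; first by rewrite /= rmorph0 rmorph1.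
by split=> //=; rewrite rmorphB !rmorphM IH1 IH2.
Qed.

(** The Binet formula F_s(t^2, t (a + b)) = t^(s-1) (a^s - b^s) / (a - b) for a b = 1, cleared of
    the denominator and multiplied by t so that it also makes sense at s = 0. *)
Lemma dickson_chebyshev (B : comNzRingType) (a b t : B) s : a * b = 1 ->
  dickson (t ^+ 2) (t * (a + b)) s * (a - b) * t = t ^+ s * (a ^+ s - b ^+ s).
Proof.
move=> ab; pose P s := dickson (t ^+ 2) (t * (a + b)) s * (a - b) * t
  = t ^+ s * (a ^+ s - b ^+ s).
suff: P s /\ P s.+1 by case.
elim: s => [|s [IH1 IH2]]; first by rewrite /P /= !expr0 subrr !mul0r mulr0 !expr1; split=> //; ring.
split=> //; rewrite /P in IH1 IH2 *.
have -> : dickson (t ^+ 2) (t * (a + b)) s.+2 =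
  t * (a + b) * dickson (t ^+ 2) (t * (a + b)) s.+1
  - t ^+ 2 * dickson (t ^+ 2) (t * (a + b)) s by [].
move: (dickson _ _ s.+1) (dickson _ _ s) IH1 IH2 => D1 D0 IH1 IH2.
transitivity (t * (a + b) * (D1 * (a - b) * t) - t ^+ 2 * (D0 * (a - b) * t)); first by ring.
rewrite IH1 IH2 [in RHS]exprS [in RHS](exprS a) [in RHS](exprS b) !exprS.
move: (a ^+ s) (b ^+ s) (t ^+ s) => u v w.
have e1 : a * b * u = u by rewrite ab mul1r.
have e2 : a * b * v = v by rewrite ab mul1r.
transitivity (t * t * w * (a * (a * u) + a * b * u - a * b * v - b * (b * v) - (u - v))).
  by ring.
by rewrite e1 e2; ring.
Qed.

Lemma dickson_monic (F : idomainType) (c : F) s :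
  dickson c%:P 'X s.+1 \is monic /\ size (dickson c%:P 'X s.+1) = s.+1.
Proof.
have [M] := ubnP s; elim: M s => // M IHM [|[|s]] ltM.
- by rewrite /= monic1 size_poly1.
- by rewrite /= mulr0 subr0 mulr1 monicX size_polyX.
have [m1 s1] := IHM s.+1 ltM; have [_ s0] := IHM s (ltnW ltM).
rewrite -[dickson _ _ s.+3]/('X * dickson c%:P 'X s.+2 - c%:P * dickson c%:P 'X s.+1).
have sX : size ('X * dickson c%:P 'X s.+2) = s.+3.
  by rewrite mulrC size_mulX ?s1 // monic_neq0.
have lt : (size (- (c%:P * dickson c%:P 'X s.+1))%R < size ('X * dickson c%:P 'X s.+2)%R)%N.
  rewrite sX size_polyN mul_polyC (leq_ltn_trans (size_scale_leq _ _)) // s0.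
  exact: leqW.
by rewrite monicE lead_coefDl // lead_coefM lead_coefX (monicP m1) mulr1 eqxx size_polyDl.
Qed.

Section Eigenvalues.
Variables (R : realType) (n d : nat) (s : nat -> R[i]).
Hypotheses (n_gt0 : (0 < n)%N) (d_gt0 : (0 < d)%N) (hdn : (d %| n)%N).
Local Notation C := R[i].
Local Notation m := (n %/ d)%N.
Hypothesis hs : forall k, (k < n)%N -> s k ^+ 2 = omegaC R n k ^+ m.

(** Index 0 is free among the sigma_{k,j} and receives the root of z - 1 - omega_k^m, so that all d
    roots are indexed by j < d. *)
Definition eigval (k j : nat) : C :=
  if j == 0%N then 1 + omegaC R n k ^+ m else sigmaC d s k j.

Let d0 : d%:R != 0 :> R. Proof. by rewrite pnatr_eq0 -lt0n. Qed.

Lemma sqrt_neq0 k : (k < n)%N -> s k != 0.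
Proof.
move=> ltkn; rewrite -sqrf_eq0 hs // expf_neq0 // omegaCX //.
by rewrite expf_neq0 // (prim_root_neq0 (omegaC_prim R n_gt0)).
Qed.

Lemma angle_itv j : (0 < j < d)%N -> 0 < (pi * j%:R / d%:R : R) < pi.
Proof.
case/andP=> j_gt0 ltjd; rewrite divr_gt0 ?mulr_gt0 ?pi_gt0 ?ltr0n //=.
by rewrite ltr_pdivrMr ?ltr0n // ltr_pM2l ?pi_gt0 // ltr_nat.
Qed.

Lemma sigmaE k j : sigmaC d s k j =
  s k * (cis (pi * j%:R / d%:R) + cis (- (pi * j%:R / d%:R))).
Proof. by rewrite cis_addN mulrCA mulrA. Qed.

Lemma eigval_inj k j j' : (k < n)%N -> (0 < j < d)%N -> (0 < j' < d)%N ->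
  eigval k j = eigval k j' -> j = j'.
Proof.
move=> ltkn hj hj'; have [j_gt0 _] := andP hj; have [j'_gt0 _] := andP hj'.
rewrite /eigval !gtn_eqF // /sigmaC.
have t0 : 2 * s k != 0 by rewrite mulf_neq0 ?sqrt_neq0 // pnatr_eq0.
move/(mulfI t0) => -[] e.
have inI i : (0 < i < d)%N -> pi * i%:R / d%:R \in `[0, pi : R].
  by move/angle_itv/andP => [h1 h2]; rewrite in_itv /= !ltW.
move/cos_inj: e => /(_ (inI _ hj) (inI _ hj')).
have d'0 : d%:R^-1 != 0 :> R by rewrite invr_eq0.
move/(mulIf d'0)/(mulfI _); rewrite gt_eqF ?pi_gt0 // => /(_ isT)/eqP.
by rewrite eqr_nat => /eqP.
Qed.

(** Squaring removes the unknown sign of s k and leaves 4 = 4 cos^2, impossible strictly between 0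
    and pi. *)
Lemma eigval0_simple k j : (k < n)%N -> (d %| k)%N -> (0 < j < d)%N ->
  eigval k 0 <> eigval k j.
Proof.
move=> ltkn dk hj; have [j_gt0 _] := andP hj.
have wm1 : omegaC R n k ^+ m = 1 by apply/eqP; rewrite omegaC_expn_eq1.
rewrite /eigval eqxx gtn_eqF // wm1 /sigmaC => e.
have : (1 + 1 : C) ^+ 2 = (2 * s k * (cos (pi * j%:R / d%:R))%:C%C) ^+ 2 by rewrite e.
rewrite !exprMn hs // wm1 mulr1 -[1 + 1]/(2 : C) -[LHS]mulr1 => /mulfI h.
have {h} := h _; rewrite expf_neq0 ?pnatr_eq0 // => /(_ isT)/esym/eqP.
rewrite -rmorphXn /= eq_complex /= eqxx andbT.
by apply/negP/cos_lt1_sqr/angle_itv.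
Qed.

(** With th = pi k / d, 1 + omega_k^m = 2 cos(th) exp(i th). Here exp(i th) is s k up to sign, and
    cos(th) is cos(pi r / d) up to sign, with r = k mod d nonzero. *)
Lemma eigval0_double k : (k < n)%N -> ~~ (d %| k)%N ->
  exists2 j, (0 < j < d)%N & eigval k 0 = eigval k j.
Proof.
move=> ltkn ndk; pose th : R := pi * k%:R / d%:R.
have r_gt0 : (0 < k %% d)%N by rewrite lt0n.
have ltrd : (k %% d < d)%N by rewrite ltn_pmod.
have hr : (0 < k %% d < d)%N by rewrite r_gt0.
have hr' : (0 < d - k %% d < d)%N by rewrite subn_gt0 ltrd ltn_subrL r_gt0.
have wm : omegaC R n k ^+ m = cis th ^+ 2 by exact: omegaC_expn.
have [b cE] : exists b : nat, cis th = (-1) ^+ b * s k.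
  have : cis th ^+ 2 == s k ^+ 2 by rewrite hs // wm.
  rewrite eqf_sqr => /orP[] /eqP ->.
    by exists 0%N; rewrite expr0 mul1r.
  by exists 1%N; rewrite expr1 mulN1r.
pose x : R := pi * (k %% d)%:R / d%:R.
have cos_th : cos th = (-1) ^+ (k %/ d) * cos x.
  have -> : th = x + pi *+ (k %/ d).
    by rewrite /th /x {1}(divn_eq k d) natrD natrM -mulr_natr; field.
  elim: (k %/ d)%N => [|i IHi]; first by rewrite addr0 mul1r.
  by rewrite mulrSr addrA cosDpi IHi exprS mulN1r mulNr.
have e0 : eigval k 0 = 2 * s k * ((-1) ^+ (b + k %/ d) * (cos x)%:C%C).
  have -> : eigval k 0 = (cis th + cis (- th)) * cis th.
    by rewrite /eigval eqxx wm mulrDl cisN -expr2 addrC.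
  rewrite cis_addN cE cos_th.
  rewrite rmorphM rmorphXn rmorphN1 exprD /=.
  by move: ((-1) ^+ b) ((-1) ^+ (k %/ d)) (cos x)%:C%C (s k) => u v w t; ring.
(* A total sign +1 gives j = r; a sign -1 is absorbed by j = d - r, since cos(pi - x) = - cos x. *)
rewrite -signr_odd in e0; case: odd e0 => e0; last first.
  by exists (k %% d)%N => //; rewrite e0 /eigval gtn_eqF // expr0 mul1r.
exists (d - k %% d)%N => //; rewrite e0 /eigval gtn_eqF; last by case/andP: hr'.
rewrite /sigmaC expr1 mulN1r -rmorphN; congr (_ * _%:C)%C.
have -> : pi * (d - k %% d)%:R / d%:R = pi - x :> R.
  by rewrite /x natrB ?(ltnW ltrd) //; field.
by rewrite cosB cospi sinpi mul0r addr0 mulN1r.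
Qed.

(** F_d is monic of degree d - 1 in z, so d - 1 distinct roots determine it. The Binet formula with
    a = exp(i pi j / d) and b = a^-1 shows that sigma_{k,j} is a root: a^d = b^d = (-1)^j, while a -
    b and s k are nonzero. *)
Lemma prod_eigval k : (k < n)%N ->
  ('X - (1 + omegaC R n k ^+ m)%:P) * dickson (omegaC R n k ^+ m)%:P 'X d =
  \prod_(j < d) ('X - (eigval k j)%:P).
Proof.
move=> ltkn; have inj := eigval_inj ltkn.
have rootE j : (0 < j < d)%N -> root (dickson (omegaC R n k ^+ m)%:P 'X d) (eigval k j).
  move=> hj; have [j_gt0 _] := andP hj; pose x : R := pi * j%:R / d%:R.
  have x_itv : 0 < x < pi by exact: angle_itv.
  rewrite rootE -[_.[_]]/(horner_eval _ _) rmorph_dickson /= /horner_eval hornerC hornerX.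
  rewrite /eigval gtn_eqF // sigmaE -hs //.
  have ab : cis x * cis (- x) = 1 by rewrite mulrC cisN.
  have := dickson_chebyshev (s k) d ab.
  have -> : cis x ^+ d = cis (- x) ^+ d.
    have cis_Npi : cis (- pi) = -1 :> C.
      by have := cisN (pi : R); rewrite cis_pi mulrN1 => /(congr1 -%R); rewrite opprK.
    have -> : cis x ^+ d = cis pi ^+ j.
      by rewrite !cisX; congr cis; rewrite /x; field.
    have -> : cis (- x) ^+ d = cis (- pi) ^+ j.
      by rewrite !cisX; congr cis; rewrite /x; field.
    by rewrite cis_pi cis_Npi.
  rewrite subrr mulr0 => /eqP; rewrite mulf_eq0 (negbTE (sqrt_neq0 ltkn)) orbF.
  by rewrite mulf_eq0 (negbTE (cis_subN_neq0 x_itv)) orbF.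
rewrite -(big_mkord xpredT (fun j => 'X - (eigval k j)%:P)) big_ltn //; congr (_ * _).
have [mon siz] := dickson_monic (omegaC R n k ^+ m) d.-1.
rewrite prednK // in mon siz.
pose rs := [seq eigval k j.+1 | j <- index_iota 0 d.-1].
have itv j : j \in index_iota 0 d.-1 -> (0 < j.+1 < d)%N.
  by rewrite mem_index_iota /= -ltnS prednK.
have -> : dickson (omegaC R n k ^+ m)%:P 'X d = \prod_(x <- rs) ('X - x%:P).
  rewrite -[RHS]scale1r -(monicP mon); apply: all_roots_prod_XsubC.
  - by rewrite size_map size_iota subn0 prednK.
  - by apply/allP=> _ /mapP[j /itv hj ->]; exact: rootE.
  rewrite uniq_rootsE map_inj_in_uniq ?iota_uniq // => i j /itv hi /itv hj.
  by move/(inj _ _ hi hj) => [].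
by rewrite /rs big_map big_add1.
Qed.

End Eigenvalues.

(** * The Green algebra over the complex numbers *)

Section GreenAlgebraModules.
Variables (R : realType) (n d : nat) (s : nat -> R[i]).
Hypotheses (n_gt0 : (0 < n)%N) (d_gt0 : (0 < d)%N) (hdn : (d %| n)%N).
Local Notation C := R[i].
Local Notation m := (n %/ d)%N.
Hypothesis hs : forall k, (k < n)%N -> s k ^+ 2 = omegaC R n k ^+ m.
Variables (A : algType C) (y z : A).
Hypothesis A_comm : forall a b : A, a * b = b * a.
Hypothesis yn1 : y ^+ n = 1.
Hypothesis A_gen : forall P : A -> Prop, P 1 ->
  (forall a b, P a -> P b -> P (a + b)) -> (forall c a, P a -> P (c *: a)) ->
  (forall a, P a -> P (y * a)) -> (forall a, P a -> P (z * a)) -> forall a, P a.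
Hypothesis A_free : exists B : 'I_n * 'I_d -> A,
  forall c : 'I_n * 'I_d -> C, \sum_p c p *: B p = 0 -> forall p, c p = 0.
Hypothesis yz_rel : z * dickson (y ^+ m) z d =
  dickson (y ^+ m) z d + y ^+ m * dickson (y ^+ m) z d.

Local Notation w := (omegaC R n 1).
Local Notation mu := (eigval n d s).
Let hz : n.-primitive_root w := omegaC_prim R n_gt0.

Lemma eigproj_ym k :
  eigproj n w y k * y ^+ m = omegaC R n k ^+ m *: eigproj n w y k.
Proof.
elim: (m) => [|i IHi]; first by rewrite !expr0 mulr1 scale1r.
rewrite [y ^+ _]exprSr mulrA IHi -scalerAl (A_comm _ y) mul_eigproj // scalerA.
by rewrite -(omegaCX R n_gt0) -exprSr.
Qed.

Lemma eigproj_dickson k l : eigproj n w y k * dickson (y ^+ m) z l =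
  eigproj n w y k * dickson (omegaC R n k ^+ m)%:A z l.
Proof.
set e := eigproj n w y k; set c := omegaC R n k ^+ m.
have ey : e * y ^+ m = e * c%:A by rewrite mulr_algr eigproj_ym.
pose P l := e * dickson (y ^+ m) z l = e * dickson c%:A z l.
suff: P l /\ P l.+1 by case.
elim: l => [|l [IH1 IH2]]; first by split.
split=> //; rewrite /P in IH1 IH2 *.
rewrite -[dickson (y ^+ m) z _]/(z * dickson (y ^+ m) z l.+1 - y ^+ m * dickson (y ^+ m) z l).
rewrite -[dickson c%:A z _]/(z * dickson c%:A z l.+1 - c%:A * dickson c%:A z l).
rewrite !mulrBr !(mulrA e) ey (A_comm e z) -!(mulrA z) IH2 (A_comm e c%:A) -!(mulrA c%:A).
by rewrite IH1.
Qed.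

(** On the eigenspace y^m is the scalar c, which turns the relation of the Green algebra into (z - 1
    - c) F_d(c, z) = 0. *)
Lemma eigproj_prod k : (k < n)%N ->
  eigproj n w y k * \prod_(j < d) (z - (mu k j)%:A) = 0.
Proof.
move=> ltkn; set c := omegaC R n k ^+ m.
have -> : \prod_(j < d) (z - (mu k j)%:A) = (z - (1 + c)%:A) * dickson c%:A z d.
  have -> : \prod_(j < d) (z - (mu k j)%:A) =
      horner_alg z (\prod_(j < d) ('X - (mu k j)%:P)).
    rewrite rmorph_prod; apply: eq_bigr => j _.
    by rewrite rmorphB /= horner_algX horner_algC.
  rewrite -prod_eigval // rmorphM rmorphB rmorph_dickson /=.
  by rewrite !horner_algX !horner_algC.
have ez : GRing.comm (eigproj n w y k) z := A_comm _ _.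
have h := eigproj_dickson k d; rewrite -/c in h.
rewrite mulrA (A_comm _ (z - _)) -mulrA -h mulrA (A_comm _ (eigproj _ _ _ _)) -mulrA.
have -> : (z - (1 + c)%:A) * dickson (y ^+ m) z d =
   (y ^+ m - c%:A) * dickson (y ^+ m) z d.
  by rewrite !mulrBl yz_rel scalerDl mulrDl scale1r mul1r opprD addrACA subrr add0r.
rewrite mulrA mulrBr mulr_algr.
rewrite eigproj_ym -/c.
by rewrite subrr mul0r.
Qed.

Let mu_inj := eigval_inj n_gt0 d_gt0 hs.
Let mu0_simple := eigval0_simple n_gt0 d_gt0 hdn hs.
Let mu0_double := eigval0_double n_gt0 d_gt0 hdn hs.

Lemma eigval_crt : exists u : 'I_n -> 'I_d -> {poly C}, forall k : 'I_n,
  [/\ forall j : 'I_d, \prod_(j < d) root_factor d mu k j %| root_factor d mu k j * u k j,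
      forall j j' : 'I_d, \prod_(j < d) root_factor d mu k j %|
        u k j * u k j' - (if j == j' then u k j else 0)
    & \prod_(j < d) root_factor d mu k j %| 1 - \sum_j u k j].
Proof.
have crt (k : 'I_n) := @crt_idempotents _ _ (fun j : 'I_d => root_factor d mu k j)
  (fun j j' => root_factor_coprime mu_inj mu0_simple (ltn_ord k)).
by have [u uP] := choice crt; exists u.
Qed.

Lemma green_algebra_modules :
  [/\ complete_list (list_index n d s) (list_mod n d y z),
      (list_index n d s #= `I_(n * d))%card,
      forall (lambda mu : C) (V : lmodType A),
        frakT n d s (lambda, mu) -> is_Cmod y z lambda mu V ->
        (projective V <-> mu <> 1 + lambda ^+ m \/ lambda ^+ m = 1)
    & forall (k : nat) (V : lmodType A),
        (k < n)%N -> ~~ (d %| k)%N -> is_Vmod n d y z k V -> projective V] /\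
  [/\ forall B : set A, is_block B -> has_dim B 1 \/ has_dim B 2,
      ([set B : set A | is_block B /\ has_dim B 1] #= `I_(n * d - 2 * (n - m)))%card
    & ([set B : set A | is_block B /\ has_dim B 2] #= `I_(n - m))%card].
Proof.
have [u uP] := eigval_crt.
have EE := spec_EE hz d_gt0 A_comm yn1 eigproj_prod mu_inj mu0_double uP.
have E1 := spec_E_sum hz d_gt0 A_comm eigproj_prod mu_inj mu0_double uP.
have EN := spec_EN hz d_gt0 A_comm yn1 eigproj_prod mu_inj mu0_double uP.
have NN := spec_NN hz d_gt0 A_comm yn1 eigproj_prod mu_inj mu0_double uP.
have span := spec_span hz d_gt0 A_comm yn1 A_gen eigproj_prod mu_inj mu0_double uP.
have [E0 _] := spec_EN_neq0 hz d_gt0 A_comm yn1 A_gen A_free eigproj_prod mu_inj mu0_double uP.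
have N0 := spec_N_eq0 hz d_gt0 A_comm yn1 A_gen A_free eigproj_prod mu_inj mu0_double uP.
have card_N := card_spec_double hz d_gt0 A_comm yn1 A_gen A_free eigproj_prod
  mu_inj mu0_simple mu0_double uP.
have lm_inj := @spec_lambda_mu_inj _ _ _ _ _ hz mu_inj mu0_simple.
have yE := spec_yE z hz yn1 u.
have zE := spec_zE w y z mu u.
have lineP := line_modP A_comm EE E1 EN NN yE zE lm_inj.
have planeP := plane_modP A_comm EE E1 EN NN yE zE lm_inj.
have lamE (x : spec_type n d) : spec_lambda w x = omegaC R n (val x).1.
  by rewrite /spec_lambda -omegaCX.
have muE (x : spec_type n d) : spec_double mu (val x) ->
    spec_mu mu x = 1 + omegaC R n (val x).1 ^+ m.
  by case/andP=> _ /eqP; rewrite /spec_mu => ->; rewrite /eigval eqxx.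
(* A line is named by its pair of eigenvalues; k alone names a plane, since each eigenspace of y has
   at most one double root. *)
pose psi (t : spec_type n d + spec_type n d) : C * C + nat :=
  match t with
  | inl x => inl (spec_lambda w x, spec_mu mu x)
  | inr x => inr (val (val x).1)
  end.
have psi_mod t (V : lmodType A) : t \in summand_index (spec_N w y z mu u) ->
    (list_mod n d y z (psi t) V <-> summand_mod (spec_E w y z u) (spec_N w y z mu u) t V).
  case: t => x; first by move=> _; rewrite /= lineP.
  rewrite unfold_in N0 negbK => dx; rewrite /= planeP /is_Vmod.
  by rewrite -(muE x dx) -lamE.
(* For d | k the index j = 0 supplies (omega_k, 2), as 1 + omega_k^m = 2. For other k that index is
   excluded, its root being one of the sigma_{k,j}. *)
have frakTE p : frakT n d s p <-> exists x : spec_type n d, p = (spec_lambda w x, spec_mu mu x).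
  split=> [[[k [ltkn dk ->]]|[k [j [ltkn /andP[j_gt0 lej] ->]]]]|[[[k j] gx] ->]].
  - have gx : (Ordinal ltkn, Ordinal d_gt0) \in @spec_good n d by rewrite unfold_in /= dk.
    exists (exist (fun p => p \in @spec_good n d) _ gx); rewrite lamE /spec_mu /eigval /=.
    by congr (_, _); move: dk; rewrite -(omegaC_expn_eq1 R n_gt0 d_gt0 hdn) => /eqP ->.
  - have ltjd : (j < d)%N by rewrite -(prednK d_gt0).
    have gx : (Ordinal ltkn, Ordinal ltjd) \in @spec_good n d.
      by rewrite unfold_in /= j_gt0 orbT.
    exists (exist (fun p => p \in @spec_good n d) _ gx); rewrite lamE /spec_mu /eigval /=.
    by rewrite gtn_eqF.
  rewrite lamE /spec_mu /eigval /=; case: eqP gx => [j0|/eqP]; last first.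
    rewrite -lt0n => j_gt0 _; right; exists k, j; split=> //.
    by apply/andP; split=> //; rewrite -ltnS prednK.
  rewrite unfold_in /= j0 orbF => dk; left; exists k; split=> //.
  by congr (_, _); move: dk; rewrite -(omegaC_expn_eq1 R n_gt0 d_gt0 hdn) => /eqP ->.
have index_eq : list_index n d s = [set psi t | t in [set t | t \in summand_index (spec_N w y z mu u)]].
  rewrite eqEsubset; split=> [[p|k]|_ [[x|x] /= hx <-]] /=.
  - by move/frakTE=> [x ->]; exists (inl x).
  - case=> ltkn dk; have [x dx ex] := spec_double_exists mu0_double (k := Ordinal ltkn) dk.
    by exists (inr x); rewrite /= ?ex // unfold_in N0 negbK.
  - by apply/frakTE; exists x.
  - by move: hx; rewrite unfold_in N0 negbK => /andP[].
have psi_inj : {in summand_index (spec_N w y z mu u) &, injective psi}.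
  move=> [x|x] [x'|x'] // hx hx' [].
    by move=> e1 e2; rewrite (lm_inj _ _ e1 e2).
  move: hx hx'; rewrite !unfold_in !N0 !negbK => dx dx' e.
  by rewrite (spec_double_inj hz mu_inj mu0_simple dx dx' e).
have cN : #|[pred x | spec_N w y z mu u x != 0%R]| = (n - m)%N.
  by rewrite card_N card_ord_ndvd.
have cX : (#|{: spec_type n d}| + (n - m) = n * d)%N.
  by rewrite -(card_ord_ndvd d_gt0 hdn) card_spec_type.
split; split.
- exact: (complete_list_summands A_comm EE E1 E0 EN NN span psi_mod index_eq psi_inj).
- rewrite index_eq -cX -cN -(card_summand_index (spec_N w y z mu u)).
  exact: card_image_pred.
(* Projectivity means N x = 0, that is, mu is not a double root: either it differs from 1 +
   lambda^m, or d | k, which is the same as lambda^m = 1. *)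
- move=> lambda mu0 V /frakTE[x [-> ->]] /lineP hV.
  rewrite (line_mod_projective A_comm EE E0 EN NN span hV).
  have := N0 x; rewrite lamE /spec_mu negb_and negbK => eN.
  have e1 := omegaC_expn_eq1 R n_gt0 d_gt0 hdn (val x).1.
  split=> [/eqP|h]; last apply/eqP; rewrite eN -e1.
    by case/orP=> [/eqP|/eqP]; [right | left].
  by case: h => /eqP ->; rewrite ?orbT.
- move=> k V ltkn dk hV; have [x dx ex] := spec_double_exists mu0_double (k := Ordinal ltkn) dk.
  apply: (plane_mod_projective A_comm EE EN NN span (x := x)).
  apply/planeP; move: hV; rewrite /is_Vmod (muE x dx) lamE ex; exact.
- move=> B; exact: (block_dim A_comm EE E1 E0 EN NN span).
(* There are nd - (n - m) summands, and n - m of them have N <> 0. *)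
- have := block_dim1_card A_comm EE E1 E0 EN NN span; congr (_ #= `I_ _)%card.
  rewrite -cX mul2n -addnn subnDA addnK -cN.
  rewrite -(cardC [pred x | spec_N w y z mu u x == 0]).
  by rewrite [X in (_ + X - _)%N](eq_card (B := [pred x | spec_N w y z mu u x != 0])) // addnK.
- rewrite -cN; exact: (block_dim2_card A_comm EE E1 E0 EN NN span).
Qed.

End GreenAlgebraModules.

(** The alternative lambda^m = 1 in the projectivity criterion covers the pairs (omega_k, 2) with d
    | k: there mu = 1 + lambda^m, but the root is simple, so the module is a direct factor of the
    algebra and projective. *)
Theorem corollary5p6 (K : closedFieldType) (charK : [pchar K] =i pred0)
    (n d : nat) (hn : (2 <= n)%N) (hd : (2 <= d)%N) (hdn : (d %| n)%N)
    (q : K) (hq : d.-primitive_root q)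
    (omega : K) (homega : n.-primitive_root omega)
    (homegaq : omega ^+ (n %/ d) = q)
    (R : realType) (s : nat -> R[i])
    (hs : forall k, (k < n)%N -> s k ^+ 2 = omegaC R n k ^+ (n %/ d)) :
  let m := (n %/ d)%N in
  let A := green R[i] n hq in
  let y : A := green_y hd hdn hq homega R[i] in
  let z : A := green_z hd hdn hq homega R[i] in
  [/\ complete_list (list_index n d s) (list_mod n d y z),
      (list_index n d s #= `I_(n * d))%card,
      forall (lambda mu : R[i]) (V : lmodType A),
        frakT n d s (lambda, mu) -> is_Cmod y z lambda mu V ->
        (projective V <-> mu <> 1 + lambda ^+ m \/ lambda ^+ m = 1)
    & forall (k : nat) (V : lmodType A),
        (k < n)%N -> ~~ (d %| k)%N -> is_Vmod n d y z k V -> projective V] /\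
  [/\ forall B : set A, is_block B -> has_dim B 1 \/ has_dim B 2,
      ([set B : set A | is_block B /\ has_dim B 1] #= `I_(n * d - 2 * (n - m)))%card
    & ([set B : set A | is_block B /\ has_dim B 2] #= `I_(n - m))%card].
Proof.
move=> m A y z.
have y_n : y ^+ n = 1 by exact: green_yn.
apply: (@green_algebra_modules R n d s (ltnW hn) (ltnW hd) hdn hs A y z) => //.
- exact: (green_mulC hd hdn homega homegaq).
(* Generation: the spanning elements y^i F_l(y^m, z) are reached from 1 by linear combinations and
   multiplications by y and z. *)
- move=> P P1 PD PZ Py Pz.
  have Pyi i a : P a -> P (y ^+ i * a).
    by move=> Pa; elim: i => [|i IHi]; rewrite ?expr0 ?mul1r // exprS -mulrA; exact: Py.
  have P0 : P 0 by rewrite -(scale0r (1 : A)); exact: PZ.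
  have PF l : P (dickson (y ^+ m) z l).
    suff: P (dickson (y ^+ m) z l) /\ P (dickson (y ^+ m) z l.+1) by case.
    elim: l => [|l [IH1 IH2]] //; split=> //.
    rewrite -[dickson _ _ _.+2]/(z * dickson (y ^+ m) z l.+1 - y ^+ m * dickson (y ^+ m) z l).
    by rewrite -scaleN1r; apply: PD; [exact: Pz | apply/PZ/Pyi].
  apply: (green_span_ind homegaq) => // i l _ _; exact/Pyi/PF.
- exists (fun p : 'I_n * 'I_d => y ^+ p.1 * dickson (y ^+ m) z p.2.+1) => c c0 [i l].
  apply: (green_free homegaq (c := fun i l => c (i, l))).
  by rewrite pair_bigA /= -[RHS]c0; apply: eq_bigr => -[].
- exact: green_rel.
Qed.
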